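(* The final zero blocking problem (given a graph $G$ and an integer $k$, decide whether $G$ contains a final zero blocking set of size at most $k$) is NP-complete when restricted to bipartite graphs, and also NP-complete when restricted to chordal graphs.
   Context: For a graph $G$, a final zero blocking set is a nonempty set $W\subseteq V(G)$ such that no vertex of $V(G)\setminus W$ has exactly one neighbor in $W$. A graph is chordal if every cycle of length at least four has a chord. *)

(* Defs.v *)
From mathcomp Require Import all_boot all_order all_algebra.

Set Implicit Arguments.
Unset Strict Implicit.
Unset Printing Implicit Defensive.

(** * Deterministic multitape Turing machines *)

Variant move := MoveL | Stay | MoveR.

(* A cell holds [Some a], or [None] for the blank.  A tape is infinite in both
   directions: [lft] lists the cells to the left of the head, nearest first,
   [rgt] those to its right, and every cell beyond these lists is blank. *)
Record tape (sym : Type) := Tape {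
  lft : seq (option sym);
  cur : option sym;
  rgt : seq (option sym) }.

Section Tapes.
Variable sym : Type.
Implicit Types (t : tape sym) (s : seq (option sym)).

Definition tape_of_cells s : tape sym :=
  if s is c :: s' then Tape [::] c s' else Tape [::] None [::].

Definition write (c : option sym) t : tape sym := Tape (lft t) c (rgt t).

Definition shift (m : move) t : tape sym :=
  match m with
  | MoveL => if lft t is c :: l then Tape l c (cur t :: rgt t)
             else Tape [::] None (cur t :: rgt t)
  | Stay => t
  | MoveR => if rgt t is c :: r then Tape (cur t :: lft t) c r
             else Tape (cur t :: lft t) None [::]
  end.

Fixpoint nonblank_prefix s : seq sym :=
  if s is Some a :: s' then a :: nonblank_prefix s' else [::].

Definition tape_word t : seq sym := nonblank_prefix (cur t :: rgt t).

End Tapes.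

(* A machine transforming words over [A] into words over [B]: both alphabets
   are embedded in the finite tape alphabet [sym], and the tape [io] carries
   the input at the start and the output at the end. *)
Record TM (A B : finType) := MkTM {
  sym : finType;
  tm_in : A -> sym;
  tm_in_inj : injective tm_in;
  tm_out : B -> sym;
  tm_out_inj : injective tm_out;
  tape_ix : finType;
  io : tape_ix;
  state : finType;
  start : state;
  halting : pred state;
  delta : state -> {ffun tape_ix -> option sym} ->
          state * (tape_ix -> option sym * move) }.

Section Run.
Variables (A B : finType) (M : TM A B).

Record config := Config {
  cstate : state M;
  ctapes : {ffun tape_ix M -> tape (sym M)} }.

Definition init (x : seq A) : config :=
  Config (start M)
    [ffun i => tape_of_cells
                 (if i == io M then [seq Some (tm_in M a) | a <- x] else [::])].

Definition step (c : config) : config :=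
  if halting (cstate c) then c else
  let: (q, act) := delta (cstate c) [ffun i => cur (ctapes c i)] in
  Config q [ffun i => shift (act i).2 (write (act i).1 (ctapes c i))].

Definition outputs_within (t : nat) (x : seq A) (y : seq B) : Prop :=
  let c := iter t step (init x) in
  halting (cstate c) /\ tape_word (ctapes c (io M)) = map (tm_out M) y.

End Run.

(** * Polynomial time, NP and NP-completeness *)

Definition polytime (A B : finType) (f : seq A -> seq B) : Prop :=
  exists (M : TM A B) (p : {poly nat}),
    forall x, outputs_within M p.[size x]%R x (f x).

Definition language (A : finType) := seq A -> Prop.

(* The pair (x, y) as a single word, over the disjoint union of alphabets. *)
Definition pair_word (A C : finType) (x : seq A) (y : seq C) :
    seq (A + C)%type := map inl x ++ map inr y.

Definition in_NP (A : finType) (L : language A) : Prop :=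
  exists (v : seq (A + bool)%type -> bool) (p : {poly nat}),
    polytime (fun w => [:: v w]) /\
    forall x, L x <->
      exists y : seq bool, size y <= p.[size x]%R /\ v (pair_word x y).

Definition poly_reducible (A B : finType) (L : language A) (L' : language B) :
    Prop :=
  exists f : seq A -> seq B, polytime f /\ forall x, L x <-> L' (f x).

Definition NP_hard (B : finType) (L : language B) : Prop :=
  forall (A : finType) (L' : language A), in_NP L' -> poly_reducible L' L.

Definition NP_complete_language (B : finType) (L : language B) : Prop :=
  in_NP L /\ NP_hard L.

Record decision_problem := DecisionProblem {
  instance : Type;
  yes : instance -> Prop;
  alphabet : finType;
  encode : instance -> seq alphabet }.

Definition yes_language (P : decision_problem) : language (alphabet P) :=
  fun w => exists i : instance P, encode i = w /\ yes i.

Definition NP_complete (P : decision_problem) : Prop :=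
  NP_complete_language (@yes_language P).

(** * Graphs *)

Record graph := Graph {
  n_vert : nat;
  adj : rel 'I_n_vert;
  adj_sym : symmetric adj;
  adj_irr : irreflexive adj }.

Definition final_zero_blocking (G : graph) (W : {set 'I_(n_vert G)}) : Prop :=
  W != set0 /\
  forall v, v \notin W -> #|[set u in W | adj v u]| <> 1.

Definition bipartite (G : graph) : Prop :=
  exists X : {set 'I_(n_vert G)},
    forall u v : 'I_(n_vert G), adj u v -> (u \in X) != (v \in X).

(* [next c] is the successor along the cycle, so a chord is an edge between
   two vertices of the cycle neither of which follows the other. *)
Definition chordal (G : graph) : Prop :=
  forall c : seq 'I_(n_vert G), 4 <= size c -> ucycle (@adj G) c ->
    exists u v, [/\ u \in c, v \in c, adj u v, v != next c u & u != next c v].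

(** * The final zero blocking problem *)

(* Binary digits, least significant first; 0 is the empty word. *)
Fixpoint bits_of_pos (p : BinNums.positive) : seq bool :=
  match p with
  | BinNums.xH => [:: true]
  | BinNums.xO p' => false :: bits_of_pos p'
  | BinNums.xI p' => true :: bits_of_pos p'
  end.

Definition bits_of_nat (n : nat) : seq bool :=
  if bin_of_nat n is BinNums.Npos p then bits_of_pos p else [::].

Definition bits_of_int (z : int) : seq bool :=
  (z < 0)%R :: bits_of_nat (absz z).

(* The rows of the adjacency matrix, each closed by the separator [None],
   followed by the sign bit and the binary digits of [k]. *)
Definition encode_graph_int (G : graph) (k : int) : seq (option bool) :=
  flatten [seq rcons [seq Some (adj u v) | v <- enum 'I_(n_vert G)] None
          | u <- enum 'I_(n_vert G)]
  ++ map Some (bits_of_int k).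

Definition final_zero_blocking_problem (C : graph -> Prop) : decision_problem :=
  @DecisionProblem
    ({G : graph | C G} * int)%type
    (fun i => exists W : {set 'I_(n_vert (sval i.1))},
       final_zero_blocking W /\ (Posz #|W| <= i.2)%R)
    (option bool)
    (fun i => encode_graph_int (sval i.1) i.2).

(* Main.v *)
From mathcomp Require Import all_boot all_order all_algebra.
From mathcomp Require Import zify.
From Stdlib Require Import FunctionalExtensionality.
Require Import Defs.

(* Polynomial time.  Every tape of a multitape machine is used as a stack, so
   that structured stack programs compile to machines.  On top of them sits a
   language of arithmetic expressions over unary numbers with random access to
   the input and with bounded iteration.  Every expression runs in polynomial
   time, hence so does any function whose output length and output letters are
   given by expressions.

   Membership in NP.  The certificate is the set itself together with a
   2-colouring, respectively, for every induced path u - v - w, a set closed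
   under adjacency outside N[v] - {u, w} that contains u and not w.

   Hardness.  A polynomial-time verifier gives a satisfiability instance whose
   variables describe the tape cells relative to the head.  From M variables
   and a set of clauses, build a graph on a root, the 2M literals and one check
   vertex for each set {root, v_i, v_j, not v_j} and {root} + clause, adjacent
   to the elements of its set.  Each check carries a pendant path so long that
   no blocking set of size M + 1 meets it; hence such a set W consists of the
   root and literals, and every check has a number of neighbours in W other
   than 1.  If the root is in W, then W selects exactly one literal of each
   variable and satisfies all clauses; otherwise W contains all literals, which
   is too many.  Without further edges the graph is bipartite; making the checks
   a clique changes nothing for W and gives a chordal graph. *)

Set Implicit Arguments.
Unset Strict Implicit.
Unset Printing Implicit Defensive.

Import GRing.Theory.

(** * Stack programs and their compilation to Turing machines *)

(** All running times come from one induction over expressions; afterwards feasibility means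
    definability only. The price is that numbers are unary, which is why a budget written in binary
    has to be truncated. A check lies outside W and therefore may not see exactly one element of W.
    Suppose the root is not in W. The check with i = j then makes the two literals of a variable
    enter W together, and the check of i and j carries membership from v_i to the variable j; so one
    literal forces all 2M of them, more than M + 1 once M is at least 2. If the root is in W, the
    checks with i = j ask for a literal of every variable, the M places that remain leave no room
    for a second one, and a clause check needs a true literal besides the root. An inner vertex of a
    pendant path outside W has both or none of its two neighbours in W. Hence a path that meets W
    has no two consecutive vertices outside W, and W contains at least half of its 2M + 4 vertices.
    The heads of a multitape machine move independently; in the tableau all of them stay in one
    column while the tapes slide, which keeps the transition rule local. *)

Definition upd (T : Type) (s : nat -> T) (k : nat) (v : T) : nat -> T :=
  fun j => if j == k then v else s j.

Lemma upd_same (T : Type) (s : nat -> T) k v : upd s k v k = v.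
Proof. by rewrite /upd eqxx. Qed.

Section StackPrograms.
Variable S : finType.

Inductive cmd :=
| Skip
| Push of nat & S
| Pop of nat
| Seq of cmd & cmd
| If of nat & (option S -> bool) & cmd & cmd
| While of nat & cmd.

Definition stacks := nat -> seq S.

(** The time index is the exact number of machine steps: a push first moves and then writes, a test
    takes one step, and passing from one half of a [Seq] to the other is free. *)
Inductive exec : cmd -> stacks -> nat -> stacks -> Prop :=
| ExecSkip s : exec Skip s 1 s
| ExecPush k a s : exec (Push k a) s 2 (upd s k (a :: s k))
| ExecPop k s : exec (Pop k) s 1 (upd s k (behead (s k)))
| ExecSeq c1 c2 s1 t1 s2 t2 s3 :
    exec c1 s1 t1 s2 -> exec c2 s2 t2 s3 -> exec (Seq c1 c2) s1 (t1 + t2) s3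
| ExecIf k p c1 c2 s t s' :
    exec (if p (ohead (s k)) then c1 else c2) s t s' ->
    exec (If k p c1 c2) s t.+1 s'
| ExecWhile0 k c s : s k = [::] -> exec (While k c) s 1 s
| ExecWhileS k c s1 t1 s2 t2 s3 :
    s1 k <> [::] -> exec c s1 t1 s2 -> exec (While k c) s2 t2 s3 ->
    exec (While k c) s1 (t1 + t2).+1 s3.

(** The additional [None] in the last two cases is the control point of the test. *)
Fixpoint pc (c : cmd) : finType :=
  match c with
  | Skip | Pop _ => unit
  | Push _ _ => bool
  | Seq a b => (pc a + pc b)%type
  | If _ _ a b => option (pc a + pc b)%type
  | While _ a => option (pc a)
  end.

Fixpoint entry (c : cmd) : pc c :=
  match c with
  | Skip => tt
  | Pop _ => tt
  | Push _ _ => false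
  | Seq a b => inl (entry a)
  | If _ _ a b => None
  | While _ a => None
  end.

(* The outer [option] on the next control point is [None] on exit. *)
Fixpoint trans (c : cmd) (rd : nat -> option S) :
    pc c -> option (pc c) * option (nat * option S * move) :=
  match c with
  | Skip => fun _ => (None, None)
  | Push k a => fun q : bool =>
      if q then (None, Some (k, Some a, Stay))
      else (Some true, Some (k, rd k, MoveL))
  | Pop k => fun _ => (None, Some (k, None, MoveR))
  | Seq a b => fun q : pc a + pc b =>
      match q with
      | inl q => let: (q', act) := trans rd q in
          (Some (if q' is Some q'' then inl q'' else inr (entry b)), act)
      | inr q => let: (q', act) := trans rd q in (omap inr q', act)
      end
  | If k p a b => fun q : option (pc a + pc b) =>
      match q with
      | None => (Some (Some (if p (rd k) then inl (entry a)
                             else inr (entry b))), None)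
      | Some (inl q) => let: (q', act) := trans rd q in
          (omap (fun q => Some (inl q)) q', act)
      | Some (inr q) => let: (q', act) := trans rd q in
          (omap (fun q => Some (inr q)) q', act)
      end
  | While k a => fun q : option (pc a) =>
      match q with
      | None => (if rd k is Some _ then Some (Some (entry a)) else None, None)
      | Some q => let: (q', act) := trans rd q in (Some q', act)
      end
  end.

Definition tapes := nat -> tape S.

Definition perform (act : option (nat * option S * move)) (ts : tapes) : tapes :=
  if act is Some (k, c, m) then upd ts k (shift m (write c (ts k))) else ts.

Definition advance c (q : pc c) (ts : tapes) : option (pc c) * tapes :=
  let: (q', act) := trans (fun k => cur (ts k)) q in (q', perform act ts).

Inductive reach c : option (pc c) -> tapes -> nat ->
    option (pc c) -> tapes -> Prop :=
| Reach0 q ts : reach q ts 0 q ts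
| ReachS q ts n q' ts' :
    reach (advance q ts).1 (advance q ts).2 n q' ts' ->
    reach (Some q) ts n.+1 q' ts'.

Lemma reach_trans c (q1 : option (pc c)) ts1 n1 q2 ts2 n2 q3 ts3 :
  reach q1 ts1 n1 q2 ts2 -> reach q2 ts2 n2 q3 ts3 ->
  reach q1 ts1 (n1 + n2) q3 ts3.
Proof. by elim=> // q ts n q' ts' _ IH /IH; apply: ReachS. Qed.

(** The simulation argument for compound commands: [e] sends the control points of a part, its exit
    included, to those of the whole. *)
Lemma reach_embed c d (e : option (pc c) -> option (pc d)) :
  (forall q ts, exists2 r, e (Some q) = Some r
    & advance r ts = (e (advance q ts).1, (advance q ts).2)) ->
  forall q ts n q' ts', reach q ts n q' ts' -> reach (e q) ts n (e q') ts'.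
Proof.
move=> He q ts n q' ts'; elim=> [q0 ts0|q0 ts0 n0 q1 ts1 _ IH].
  exact: Reach0.
have [r -> Hr] := He q0 ts0.
by apply: ReachS; rewrite Hr.
Qed.

(** The head stands on the top of the stack, which grows to the left. The numbers of stored blanks
    are left open because moves leave explicit blanks in the lists. *)
Definition represents (t : tape S) (s : seq S) : Prop :=
  exists i j, lft t = nseq i None /\ cur t :: rgt t = map Some s ++ nseq j None.

Lemma represents_cur t s : represents t s -> cur t = ohead s.
Proof. by move=> [i [j [_]]]; case: s => [|a s]; case: j => [|j] //= [->]. Qed.

Lemma represents_push t s a : represents t s ->
  represents (shift Stay (write (Some a) (shift MoveL (write (cur t) t))))
    (a :: s).
Proof.
case: t => l c r [i [j /= [-> E]]].
case: i => [|i] /=; [exists 0, j|exists i, j]; by split=> //=; rewrite E.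
Qed.

Lemma represents_pop t s :
  represents t s -> represents (shift MoveR (write None t)) (behead s).
Proof.
case: t => l c r [i [j /= [-> E]]]; rewrite /shift /write /=.
case: r E => [|c' r] E; exists i.+1.
  exists 1; split=> //=.
  case: s E => [|a s] //= [_]; by case: s.
case: s E => [|a s] /=; last by case=> _ ->; exists j.
by case: j => //= j [_ ->]; exists j.
Qed.

Lemma represents_upd (ts : tapes) (s : stacks) k t v :
  (forall i, represents (ts i) (s i)) -> represents t v ->
  forall i, represents (upd ts k t i) (upd s k v i).
Proof. by move=> H Ht i; rewrite /upd; case: ifP. Qed.

Lemma exec_reach c s t s' : exec c s t s' ->
  forall ts, (forall i, represents (ts i) (s i)) ->
  exists2 ts', reach (Some (entry c)) ts t None ts'
    & forall i, represents (ts' i) (s' i).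
Proof.
elim=> {c s t s'} [s|k a s|k s|c1 c2 s1 t1 s2 t2 s3 _ IH1 _ IH2
    |k p c1 c2 s t s' _ IH|k c s E|k c s1 t1 s2 t2 s3 E _ IH1 _ IH2] ts Hts.
- by exists ts => //; apply: ReachS; apply: Reach0.
- pose t1 := shift MoveL (write (cur (ts k)) (ts k)).
  exists (upd (upd ts k t1) k (shift Stay (write (Some a) (upd ts k t1 k)))).
    by apply: ReachS; apply: ReachS; apply: Reach0.
  rewrite upd_same => i; rewrite /upd; case: eqP => // _.
  exact: represents_push.
- exists (upd ts k (shift MoveR (write None (ts k)))).
    by apply: ReachS; apply: Reach0.
  by apply: represents_upd => //; apply: represents_pop.
- have [ts2 R1 H2] := IH1 _ Hts; have [ts3 R2 H3] := IH2 _ H2.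
  exists ts3 => //; apply: (@reach_trans (Seq c1 c2) _ _ _ (Some (inr (entry c2)))).
    pose e (q : option (pc c1)) : option (pc (Seq c1 c2)) :=
      Some (if q is Some q' then inl q' else inr (entry c2)).
    apply: (reach_embed (e := e)) R1 => q us; exists (inl q) => //.
    by rewrite /advance /=; case: (trans _ q) => [q' act].
  pose e (q : option (pc c2)) : option (pc (Seq c1 c2)) := omap inr q.
  apply: (reach_embed (e := e)) R2 => q us; exists (inr q) => //.
  by rewrite /advance /=; case: (trans _ q) => [q' act].
- have [ts' R H'] := IH _ Hts; exists ts' => //.
  apply: ReachS; rewrite /advance /= (represents_cur (Hts k)).
  case: (p _) R => R.
    pose e (q : option (pc c1)) : option (pc (If k p c1 c2)) :=
      omap (fun q => Some (inl q)) q.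
    apply: (reach_embed (e := e)) R => q us; exists (Some (inl q)) => //.
    by rewrite /advance /=; case: (trans _ q) => [q' act].
  pose e (q : option (pc c2)) : option (pc (If k p c1 c2)) :=
    omap (fun q => Some (inr q)) q.
  apply: (reach_embed (e := e)) R => q us; exists (Some (inr q)) => //.
  by rewrite /advance /=; case: (trans _ q) => [q' act].
- exists ts => //; apply: ReachS; rewrite /advance /= (represents_cur (Hts k)) E.
  exact: Reach0.
- have [ts2 R1 H2] := IH1 _ Hts; have [ts3 R2 H3] := IH2 _ H2.
  exists ts3 => //.
  apply: ReachS; rewrite /advance /= (represents_cur (Hts k)).
  case: (s1 k) E => //= a l _.
  apply: (@reach_trans (While k c) _ _ _ (Some None)); last exact: R2.
  (* The exit [None] of the body, taken as a control point of the loop, is the loop test. *)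
  pose e (q : option (pc c)) : option (pc (While k c)) := Some q.
  apply: (reach_embed (e := e)) R1 => q us; exists (Some q) => //.
  by rewrite /advance /=; case: (trans _ q) => [q' act].
Qed.

Fixpoint max_tape (c : cmd) : nat :=
  match c with
  | Skip => 0
  | Push k _ | Pop k => k
  | Seq a b => maxn (max_tape a) (max_tape b)
  | If k _ a b => maxn k (maxn (max_tape a) (max_tape b))
  | While k a => maxn k (max_tape a)
  end.

(** The machine has finitely many tapes and reads tape [k] as [inord k], which is the right tape
    only up to [max_tape]. *)
Lemma trans_ext c N (rd rd' : nat -> option S) : max_tape c <= N ->
  (forall k, k <= N -> rd k = rd' k) ->
  forall q : pc c, trans rd q = trans rd' q.
Proof.
move=> + E; elim: c => [|k a|k|c1 IH1 c2 IH2|k p c1 IH1 c2 IH2|k c IH] //=.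
- by move=> /E ->.
- by rewrite geq_max => /andP[/IH1 H1 /IH2 H2] [q|q]; rewrite (H1, H2).
- rewrite !geq_max => /and3P[/E -> /IH1 H1 /IH2 H2] [[q|q]|] //=;
    by rewrite (H1, H2).
- by rewrite geq_max => /andP[/E -> /IH H] [q|] //; rewrite H.
Qed.

Lemma trans_bound c N rd (q : pc c) : max_tape c <= N ->
  forall k o m, (trans rd q).2 = Some (k, o, m) -> k <= N.
Proof.
elim: c q => [|k a|k|c1 IH1 c2 IH2|k p c1 IH1 c2 IH2|k c IH] //=.
- by move=> [] ? ? ? ? [<-].
- by move=> _ ? ? ? ? [<-].
- rewrite geq_max => [[q|q]] /andP[/(IH1 _) H1 /(IH2 _) H2].
    by have := H1 q; case: (trans _ q).
  by have := H2 q; case: (trans _ q).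
- rewrite !geq_max => [[[q|q]|//]] /and3P[_ /(IH1 _) H1 /(IH2 _) H2].
    by have := H1 q; case: (trans _ q).
  by have := H2 q; case: (trans _ q).
- rewrite geq_max => [[q|//]] /andP[_ /(IH _) H].
  by have := H q; case: (trans _ q).
Qed.

(** * The Turing machine of a stack program *)

Section Machine.
Variables (A B : finType) (inA : A -> S) (inB : B -> S).
Hypotheses (inA_inj : injective inA) (inB_inj : injective inB).
Variable c : cmd.

Definition machine : TM A B :=
  @MkTM A B S inA inA_inj inB inB_inj 'I_(max_tape c).+1 ord0
    (option (pc c)) (Some (entry c)) (fun q => q == None)
    (fun oq rd =>
       if oq is Some q then
         let: (q', act) := trans (fun k => rd (inord k)) q in
         (q', fun i : 'I_(max_tape c).+1 => if act is Some (k, o, m) then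
                         if k == nat_of_ord i then (o, m) else (rd i, Stay)
                       else (rd i, Stay))
       else (None, fun i => (rd i, Stay))).

Definition restrict (ts : tapes) : {ffun tape_ix machine -> tape (sym machine)} :=
  [ffun i => ts (nat_of_ord (i : 'I_(max_tape c).+1))].

Lemma machine_step q ts :
  step (@Config _ _ machine (Some q) (restrict ts)) =
  @Config _ _ machine (advance q ts).1 (restrict (advance q ts).2).
Proof.
rewrite /step /=.
rewrite (@trans_ext c (max_tape c) _ (fun k => cur (ts k))) //; last first.
  by move=> k Hk; rewrite !ffunE inordK.
rewrite /advance; have := @trans_bound c _ (fun k => cur (ts k)) q (leqnn _).
case: (trans _ q) => q' [[[k o] m]|] /= Hb; congr Config; apply/ffunP => i;
  rewrite !ffunE /=.
  rewrite /upd [nat_of_ord i == k]eq_sym; case: eqP => [->|_] //=.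
  by case: (ts i).
by case: (ts i).
Qed.

Lemma machine_reach q ts n q' ts' : reach q ts n q' ts' ->
  iter n (@step _ _ machine) (@Config _ _ machine q (restrict ts)) =
  @Config _ _ machine q' (restrict ts').
Proof.
elim=> // q0 ts0 n0 q1 ts1 _ IH.
by rewrite iterSr machine_step.
Qed.

Lemma iter_halted (M : TM A B) n (cf : config M) :
  halting (cstate cf) -> iter n (@step _ _ M) cf = cf.
Proof. by move=> H; elim: n => //= n ->; rewrite /step H. Qed.

Lemma machine_outputs (x : seq A) (y : seq B) t T s' :
  exec c (fun k => if k == 0 then map inA x else [::]) t s' ->
  s' 0 = map inB y -> t <= T -> outputs_within machine T x y.
Proof.
move=> E Ey tT.
pose ts k := tape_of_cells (if k == 0 then map Some (map inA x) else [::]).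
have Hts : forall i, represents (ts i) (if i == 0 then map inA x else [::]).
  move=> i; rewrite /ts; case: eqP => _; last by exists 0, 1.
  case: (x) => [|a l] /=; first by exists 0, 1.
  by exists 0, 0; rewrite cats0.
have [ts' R H'] := exec_reach E Hts.
rewrite /outputs_within.
have -> : init machine x = @Config _ _ machine (Some (entry c)) (restrict ts).
  congr Config; apply/ffunP => i; rewrite !ffunE /ts.
  by rewrite -val_eqE /= -map_comp.
(* The machine has halted after [t] steps and idles for the remaining [T - t]. *)
rewrite -(subnK tT) iterD (machine_reach R) iter_halted //=; split=> //.
rewrite ffunE /= /tape_word.
have [i [j [_ ->]]] := H' 0; rewrite Ey.
by elim: y {Ey} => [|b y IH] /=; [case: j|rewrite IH].
Qed.

End Machine.
End StackPrograms.

(** * Polynomially bounded functions *)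

(** The base is at least 2, so that constants lie below powers and larger exponents give larger
    bounds; sums, products and powers keep this form. *)
Definition poly_bounded (f : nat -> nat) : Prop :=
  exists C, forall s, f s <= (s + 2) ^ C.

Lemma poly_bounded_const n : poly_bounded (fun=> n).
Proof.
exists n => s; apply: leq_trans (ltnW (ltn_expl n (ltnSn 1))) _.
by case: n => // n; rewrite leq_exp2r ?leq_addl.
Qed.

Lemma poly_bounded_id : poly_bounded id.
Proof. by exists 1 => s; rewrite expn1 leq_addr. Qed.

Lemma poly_bounded_mul f g :
  poly_bounded f -> poly_bounded g -> poly_bounded (fun s => f s * g s).
Proof. by move=> [C HC] [D HD]; exists (C + D) => s; rewrite expnD leq_mul. Qed.

Lemma poly_bounded_add f g :
  poly_bounded f -> poly_bounded g -> poly_bounded (fun s => f s + g s).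
Proof.
move=> [C HC] [D HD]; exists (C + D).+1 => s.
have H1 : (s + 2) ^ C <= (s + 2) ^ (C + D).
  by rewrite leq_pexp2l ?leq_addr // addn2.
have H2 : (s + 2) ^ D <= (s + 2) ^ (C + D).
  by rewrite leq_pexp2l ?leq_addl // addn2.
rewrite expnS; have := HC s; have := HD s; nia.
Qed.

Lemma poly_bounded_expn C f :
  poly_bounded f -> poly_bounded (fun s => (f s + 2) ^ C).
Proof.
move=> /poly_bounded_add /(_ (poly_bounded_const 2)) [D HD].
exists (D * C) => s; rewrite expnM.
by case: C => // C; rewrite leq_exp2r.
Qed.

Ltac pbound := cbv beta; first
  [ eassumption
  | apply: poly_bounded_const
  | apply: poly_bounded_id
  | apply: poly_bounded_expn; pbound
  | apply: poly_bounded_add; pbound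
  | apply: poly_bounded_mul; pbound ].

(** * Counter programs *)

Section Run.
Variable S : finType.
Implicit Types (c : cmd S) (s : stacks S).

Definition run c s T s' := exists2 t, t <= T & exec c s t s'.

Lemma run_weaken c s T s' T1 : run c s T s' -> T <= T1 -> run c s T1 s'.
Proof. by move=> [t Ht E] H; exists t => //; apply: leq_trans H. Qed.

Lemma run_skip s : run (Skip S) s 1 s.
Proof. by exists 1 => //; constructor. Qed.

Lemma run_seq c1 c2 s1 T1 s2 T2 s3 :
  run c1 s1 T1 s2 -> run c2 s2 T2 s3 -> run (Seq c1 c2) s1 (T1 + T2) s3.
Proof.
by move=> [t1 H1 E1] [t2 H2 E2]; exists (t1 + t2); [lia|apply: ExecSeq E1 E2].
Qed.

Lemma run_if k p c1 c2 s T s' :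
  run (if p (ohead (s k)) then c1 else c2) s T s' ->
  run (If k p c1 c2) s T.+1 s'.
Proof. by move=> [t H E]; exists t.+1 => //; constructor. Qed.

Lemma run_loop k c n T (I : nat -> stacks S) :
  (forall i, i < n -> I i k <> [::]) -> I n k = [::] ->
  (forall i, i < n -> run c (I i) T (I i.+1)) ->
  run (While k c) (I 0) (n * T.+1).+1 (I n).
Proof.
elim: n I => [|n IH] I H1 H2 H3.
  by exists 1 => //; constructor.
have [t Ht E] := H3 0 (ltn0Sn _).
have [t' Ht' E'] := IH (fun i => I i.+1) (fun i => H1 i.+1) H2 (fun i => H3 i.+1).
exists (t + t').+1; first by nia.
by apply: ExecWhileS E E'; apply: H1.
Qed.

End Run.

Section Counters.
Variables A B : finType.

(* [None] is the tally mark of the unary counters. *)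
Definition letter : finType := option (A + B)%type.
Definition in_letter (a : A) : letter := Some (inl a).
Definition out_letter (b : B) : letter := Some (inr b).
Definition tally : letter := None.

Lemma in_letter_inj : injective in_letter. Proof. by move=> a b []. Qed.
Lemma out_letter_inj : injective out_letter. Proof. by move=> a b []. Qed.

Notation prog := (cmd letter).
Notation "c1 ;; c2" := (Seq c1 c2) (at level 85, right associativity).

(* Tape 0 is the input/output tape, tapes 1 and 2 hold the input word split at
   a reading position, and tape [r.+3] is the unary counter [r]. *)
Definition conf (l r : seq A) (o : seq letter) (R : nat -> nat) : stacks letter :=
  fun k => match k with
           | 0 => o
           | 1 => map in_letter r
           | 2 => map in_letter l
           | k.+3 => nseq (R k) tally
           end.

Lemma conf_ext l r o R R' : R =1 R' -> conf l r o R = conf l r o R'.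
Proof.
move=> E; apply: functional_extensionality => [[|[|[|k]]]] //=.
by rewrite E.
Qed.

Definition inc d : prog := Push d.+3 tally.
Definition dec d : prog := Pop letter d.+3.
Definition loop r c : prog := While r.+3 c.

Section Fixed.
Variables (l r : seq A) (o : seq letter).
Implicit Type R : nat -> nat.
Local Notation M := (conf l r o).

Lemma run_inc d R : run (inc d) (M R) 2 (M (upd R d (R d).+1)).
Proof.
exists 2 => //; have -> : M (upd R d (R d).+1) = upd (M R) d.+3 (tally :: M R d.+3).
  apply: functional_extensionality => [[|[|[|k]]]] //=.
  by rewrite /upd !eqSS; case: eqP.
exact: ExecPush.
Qed.

Lemma run_dec d R : run (dec d) (M R) 1 (M (upd R d (R d).-1)).
Proof.
exists 1 => //; have -> : M (upd R d (R d).-1) = upd (M R) d.+3 (behead (M R d.+3)).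
  apply: functional_extensionality => [[|[|[|k]]]] //=.
  by rewrite /upd !eqSS; case: eqP => // _; case: (R d).
exact: ExecPop.
Qed.

Lemma run_eq (c : prog) R1 T R2 R1' T' R2' :
  run c (M R1) T (M R2) -> R1 =1 R1' -> R2 =1 R2' -> T <= T' ->
  run c (M R1') T' (M R2').
Proof.
by move=> H /conf_ext <- /conf_ext <- HT; apply: run_weaken HT.
Qed.

Lemma run_count k (c : prog) n T (R : nat -> nat -> nat) :
  (forall i, R i k = n - i) ->
  (forall i, i < n -> run c (M (R i)) T (M (R i.+1))) ->
  run (loop k c) (M (R 0)) (n * T.+1).+1 (M (R n)).
Proof.
move=> E H; apply: (run_loop (I := fun i => M (R i))) => //= [i Hi|].
  by rewrite E -(subnSK Hi).
by rewrite E subnn.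
Qed.

End Fixed.

Ltac split_regs := rewrite /upd;
  repeat (let E := fresh "E" in
          case: eqP => E; try (exfalso; clear - E; lia); try subst).
Ltac regs := let k := fresh "k" in move=> k; split_regs; try lia.

Section Moves.
Variables (l r : seq A) (o : seq letter).
Implicit Type R : nat -> nat.
Local Notation M := (conf l r o).

Definition move_reg s d : prog := loop s (dec s ;; inc d).
(** Reading a counter destroys it; the second copy in [e] is there to restore [s]. *)
Definition copy_reg s d e : prog :=
  loop s (dec s ;; inc d ;; inc e) ;; move_reg e s.
Definition clear_reg s : prog := loop s (dec s).
Definition sub_reg s d : prog := loop s (dec s ;; dec d).

Lemma run_move_reg s d R : s != d ->
  run (move_reg s d) (M R) (R s * 4).+1 (M (upd (upd R s 0) d (R d + R s))).
Proof.
move=> sd.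
apply: run_eq (@run_count l r o s _ (R s) 3
  (fun i => upd (upd R s (R s - i)) d (R d + i)) _ _) _ _ _ => //; try by regs.
move=> i Hi; apply: run_eq (run_seq (run_dec _ _ _ s _) (run_inc _ _ _ d _)) _ _ _;
  by [|regs].
Qed.

Lemma run_sub_reg s d R : s != d ->
  run (sub_reg s d) (M R) (R s * 4).+1 (M (upd (upd R s 0) d (R d - R s))).
Proof.
move=> sd.
apply: run_eq (@run_count l r o s _ (R s) 3
  (fun i => upd (upd R s (R s - i)) d (R d - i)) _ _) _ _ _ => //; try by regs.
move=> i Hi; apply: run_eq (run_seq (run_dec _ _ _ s _) (run_dec _ _ _ d _)) _ _ _;
  by [|regs].
Qed.

Lemma run_clear_reg s R :
  run (clear_reg s) (M R) (R s * 4).+1 (M (upd R s 0)).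
Proof.
apply: run_eq (@run_count l r o s _ (R s) 1
  (fun i => upd R s (R s - i)) _ _) _ _ _; try lia; try by regs.
by move=> i Hi; apply: run_eq (run_dec _ _ _ s _) _ _ _; by [|regs].
Qed.

Lemma run_copy_reg s d e R : s != d -> s != e -> d != e -> R e = 0 ->
  run (copy_reg s d e) (M R) (R s * 10 + 2) (M (upd R d (R d + R s))).
Proof.
move=> sd se de e0.
have H1 : run (loop s (dec s ;; inc d ;; inc e)) (M R) (R s * 6).+1
   (M (upd (upd (upd R s 0) d (R d + R s)) e (R s))).
  apply: run_eq (@run_count l r o s _ (R s) 5
    (fun i => upd (upd (upd R s (R s - i)) d (R d + i)) e i) _ _) _ _ _ => //;
    try by regs.
  move=> i Hi; apply: run_eq (run_seq (run_dec _ _ _ s _)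
    (run_seq (run_inc _ _ _ d _) (run_inc _ _ _ e _))) _ _ _; by [|regs].
apply: run_eq (run_seq H1 (@run_move_reg e s _ _)) _ _ _ => //; first lia.
  by regs.
by rewrite upd_same; lia.
Qed.

(** Implements the truncation in [Iter]: [c] is the cap, and [e] records what is taken from it, so
    that it can be restored. *)
Definition min_reg s c d e : prog :=
  loop s (dec s ;; If c.+3 (fun h => h != None) (dec c ;; inc d ;; inc e)
                     (Skip letter)) ;; move_reg e c.

Lemma run_min_reg s c d e R : uniq [:: s; c; d; e] -> R e = 0 ->
  run (min_reg s c d e) (M R) (R s * 13 + 2)
    (M (upd (upd R s 0) d (R d + minn (R s) (R c)))).
Proof.
rewrite /= !inE => Hu e0.
have H1 : run (loop s (dec s ;; If c.+3 (fun h => h != None)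
   (dec c ;; inc d ;; inc e) (Skip letter))) (M R) (R s * 8).+1
   (M (upd (upd (upd (upd R s 0) c (R c - R s)) d (R d + minn (R s) (R c))) e
       (minn (R s) (R c)))).
  apply: run_eq (@run_count l r o s _ (R s) 7
    (fun i => upd (upd (upd (upd R s (R s - i)) c (R c - i)) d
                (R d + minn i (R c))) e (minn i (R c))) _ _) _ _ _ => //; try by regs.
  move=> i Hi.
  apply: run_eq (run_seq (run_dec _ _ _ s _) (@run_if _ _ _ _ _ _ 5 (M
    (upd (upd (upd (upd R s (R s - i.+1)) c (R c - i.+1)) d
                (R d + minn i.+1 (R c))) e (minn i.+1 (R c)))) _))
    (fun=> erefl) (fun=> erefl) (leqnn 7).
  set X := (X in M X); have Xc : X c = R c - i.
    by rewrite /X; split_regs; lia.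
  rewrite [conf _ _ _ _ _]/= Xc.
  case E : (R c - i) => [|j] /=.
    apply: run_eq (run_skip _) _ _ _ => //; by move=> k; rewrite /X; move: k; regs.
  apply: run_eq (run_seq (run_dec _ _ _ c _)
    (run_seq (run_inc _ _ _ d _) (run_inc _ _ _ e _))) _ _ _ => //.
  by move=> k; rewrite /X; move: k; regs.
apply: run_eq (run_seq H1 (@run_move_reg e c _ _)) _ _ _ => //; first lia.
  by regs.
by rewrite upd_same; lia.
Qed.

End Moves.

(** * Reading the input word *)

Fixpoint incs n d : prog := if n is n'.+1 then inc d ;; incs n' d else Skip letter.

Lemma run_incs n d l r o R :
  run (incs n d) (conf l r o R) (n * 2 + 1) (conf l r o (upd R d (R d + n))).
Proof.
elim: n R => [|n IH] R /=.
  by apply: run_eq (run_skip _) _ _ _ => //; regs.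
by apply: run_eq (run_seq (run_inc _ _ _ d _) (IH _)) _ _ _; by [|regs|lia].
Qed.

(** A push names its letter, so moving an unknown letter takes a case distinction over the
    alphabet. *)
Fixpoint move_letter_of (s : seq A) i j : prog :=
  if s is a :: s' then
    If i (pred1 (Some (in_letter a))) (Pop letter i ;; Push j (in_letter a))
       (move_letter_of s' i j)
  else Skip letter.
Definition move_letter i j : prog := move_letter_of (enum A) i j.

Lemma run_move_letter i j a u s : s i = in_letter a :: u -> i != j ->
  run (move_letter i j) s (#|A| + 4)
    (upd (upd s i u) j (in_letter a :: s j)).
Proof.
move=> Ei ij; rewrite /move_letter cardE.
have: a \in enum A by rewrite mem_enum.
elim: (enum A) => //= b e IH; rewrite inE => Ha.
rewrite addSn; apply: run_if; rewrite Ei /=.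
case: eqP => [[E]|E].
  subst b; exists 3; first by lia.
  have -> : upd (upd s i u) j (in_letter a :: s j) =
    upd (upd s i (behead (s i))) j (in_letter a :: upd s i (behead (s i)) j).
    by rewrite Ei /= {5}/upd eq_sym (negbTE ij).
  exact: ExecSeq (ExecPop _ _) (ExecPush _ _ _).
apply: IH; case/orP: Ha => // /eqP E'; by case: E; rewrite E'.
Qed.

Lemma run_move_letter_nil i j s : s i = [::] ->
  run (move_letter i j) s (#|A| + 4) s.
Proof.
move=> Ei; rewrite /move_letter cardE.
elim: (enum A) => [|b e IH] /=.
  by apply: run_weaken (run_skip _) _.
by rewrite addSn; apply: run_if; rewrite Ei.
Qed.

Lemma run_advance x i o R :
  run (move_letter 1 2) (conf (rev (take i x)) (drop i x) o R) (#|A| + 4)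
    (conf (rev (take i.+1 x)) (drop i.+1 x) o R).
Proof.
case: (ltnP i (size x)) => Hi; last first.
  rewrite !take_oversize ?drop_oversize //; try lia.
  exact: run_move_letter_nil.
have a0 : A by case: x Hi.
rewrite (take_nth a0) // (drop_nth a0) // rev_rcons.
have -> : conf (nth a0 x i :: rev (take i x)) (drop i.+1 x) o R =
  upd (upd (conf (rev (take i x)) (nth a0 x i :: drop i.+1 x) o R) 1
    (map in_letter (drop i.+1 x))) 2
    (in_letter (nth a0 x i) :: map in_letter (rev (take i x))).
  by apply: functional_extensionality => [[|[|[|k]]]].
exact: run_move_letter.
Qed.

Definition rewind : prog := While 2 (move_letter 2 1).

Lemma run_rewind l r o R :
  run rewind (conf l r o R) (size l * (#|A| + 5)).+1 (conf [::] (catrev l r) o R).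
Proof.
elim: l r => [|a l IH] r /=; first by exists 1 => //; constructor.
have [t Ht E] := @run_move_letter 2 1 a (map in_letter l)
  (conf (a :: l) r o R) erefl isT.
have [t' Ht' E'] := IH (a :: r).
exists (t + t').+1.
  by move: Ht Ht'; move: #|A| (size l) => n p; nia.
apply: ExecWhileS E _ => //.
suff <- : conf l (a :: r) o R = upd (upd (conf (a :: l) r o R) 2
  (map in_letter l)) 1 (in_letter a :: conf (a :: l) r o R 1) by [].
by apply: functional_extensionality => [[|[|[|k]]]].
Qed.

(** Codes start at 1 because 0 is the value read beyond the end of the input. *)
Definition code (a : A) : nat := (enum_rank a).+1.

Lemma code_le a : code a <= #|A|.
Proof. exact: ltn_ord. Qed.

Fixpoint code_switch (s : seq A) d : prog :=
  if s is a :: s' then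
    If 1 (pred1 (Some (in_letter a))) (incs (code a) d) (code_switch s' d)
  else Skip letter.

Lemma run_code_switch l r o R d :
  run (code_switch (enum A) d) (conf l r o R) (#|A| * 3 + 1)
    (conf l r o (upd R d (R d + nth 0 (map code r) 0))).
Proof.
have -> : #|A| * 3 + 1 = size (enum A) + (#|A| * 2 + 1) by rewrite -cardE; move: #|A| => n; lia.
have: forall a, ohead r = Some a -> a \in enum A by move=> a; rewrite mem_enum.
elim: (enum A) => [|b e IH] H.
  case: r H => [|a r] H; last by have := H a erefl.
  rewrite [nth _ _ _]/=.
  by apply: run_eq (run_skip _) _ _ _; by [|regs|rewrite addn1 addnS].
rewrite [code_switch _ _]/= [size _]/= addSn; apply: run_if.
rewrite [pred1 _ _]/=; case: eqP => [E|E].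
  case: r E {IH H} => // a r [->].
  rewrite -[inc d ;; _]/(incs (code b) d).
  apply: run_eq (run_incs _ _ _ _ _ _) _ _ _ => //.
  by have := code_le b; move: (code b) #|A| => i n; lia.
apply: IH => a Ha; have := H a Ha; rewrite inE => /orP[/eqP Eab|//].
by case: E; rewrite -Eab; case: r Ha {H} => //= ? ? [->].
Qed.

(** * Arithmetic expressions over unary numbers *)

Inductive expr :=
| One
| Var
| Wk of expr
| Let of expr & expr
| Add of expr & expr
| Sub of expr & expr
| Mul of expr & expr
| Len
| Inp of expr
| Iter of expr & expr & expr & expr.

Fixpoint capped_iter (cap : nat) (F : nat -> nat -> nat) n init : nat :=
  if n is n'.+1 then minn (F n' (capped_iter cap F n' init)) cap
  else minn init cap.

(* [Iter n init cap body] iterates [body] [n] times; the accumulator and the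
   loop index are the variables 0 and 1 of [body].  The accumulator is
   truncated at [cap], so that every expression has polynomial size. *)
Fixpoint eval (e : expr) (x : seq A) (v : seq nat) : nat :=
  match e with
  | One => 1
  | Var => head 0 v
  | Wk e => eval e x (behead v)
  | Let a b => eval b x (eval a x v :: v)
  | Add a b => eval a x v + eval b x v
  | Sub a b => eval a x v - eval b x v
  | Mul a b => eval a x v * eval b x v
  | Len => size x
  | Inp a => nth 0 (map code x) (eval a x v)
  | Iter n i c b => capped_iter (eval c x v)
      (fun j acc => eval b x (acc :: j :: v)) (eval n x v) (eval i x v)
  end.

Lemma capped_iter_le cap F n i : capped_iter cap F n i <= cap.
Proof. by case: n => [|n] /=; rewrite geq_minr. Qed.

(** An iteration is bounded by its cap alone, whatever its body computes; without this the exponent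
    could not be chosen uniformly in the number of rounds. *)
Lemma eval_bounded e : exists C, forall x v,
  eval e x v <= (size x + sumn v + 2) ^ C.
Proof.
elim: e => [||e [C H]|a [C H] b [D K]|a [C H] b [D K]|a [C H] b [D K]
  |a [C H] b [D K]||e _|n _ i _ c [C H] b _] /=.
- by exists 1 => x v; lia.
- by exists 1 => x [|y v] /=; lia.
- exists C => x v; apply: leq_trans (H _ _) _.
  case: C {H} => // C; rewrite leq_exp2r //; case: v => //= y v; lia.
- have [E HE] : poly_bounded (fun s => ((s + (s + 2) ^ C) + 2) ^ D) by pbound.
  exists E => x v; apply: leq_trans (K _ _) _; apply: leq_trans (HE _).
  case: D {K HE} => // D; rewrite leq_exp2r //=; have := H x v; lia.
- have [E HE] : poly_bounded (fun s => (s + 2) ^ C + (s + 2) ^ D) by pbound.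
  by exists E => x v; apply: leq_trans (HE _); apply: leq_add.
- by exists C => x v; apply: leq_trans (leq_subr _ _) (H _ _).
- have [E HE] : poly_bounded (fun s => (s + 2) ^ C * (s + 2) ^ D) by pbound.
  by exists E => x v; apply: leq_trans (HE _); apply: leq_mul.
- by exists 1 => x v; lia.
- have [E HE] := poly_bounded_const #|A|.
  exists E => x v; apply: leq_trans (HE _).
  move: (eval _ _ _) => j; case: (ltnP j (size x)) => Hj; last first.
    by rewrite nth_default // size_map.
  have a0 : A by case: x Hj.
  rewrite (nth_map a0) // /code; exact: ltn_ord.
- by exists C => x v; apply: leq_trans (capped_iter_le _ _ _ _) (H _ _).
Qed.

(* [m] lists the registers of the variables; the value is left in register
   [d], and every register from [d] on is free. *)
Fixpoint comp (e : expr) (m : seq nat) (d : nat) : prog :=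
  match e with
  | One => inc d
  | Var => if m is s :: _ then copy_reg s d d.+1 else Skip letter
  | Wk e => comp e (behead m) d
  | Let a b => comp a m d ;; comp b (d :: m) d.+1 ;;
               clear_reg d ;; move_reg d.+1 d
  | Add a b => comp a m d ;; comp b m d.+1 ;; move_reg d.+1 d
  | Sub a b => comp a m d ;; comp b m d.+1 ;; sub_reg d.+1 d
  | Mul a b => comp a m d.+1 ;; comp b m d.+2 ;;
               loop d.+1 (dec d.+1 ;; copy_reg d.+2 d d.+3) ;; clear_reg d.+2
  | Len => While 1 (move_letter 1 2 ;; inc d) ;; rewind
  | Inp a => comp a m d.+1 ;; loop d.+1 (dec d.+1 ;; move_letter 1 2) ;;
             code_switch (enum A) d ;; rewind
  | Iter n i c b =>
      comp n m d.+1 ;; comp c m d.+3 ;; comp i m d.+4 ;;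
      min_reg d.+4 d.+3 d d.+4.+1 ;;
      loop d.+1 (dec d.+1 ;; comp b (d :: d.+2 :: m) d.+4 ;; clear_reg d ;;
                 min_reg d.+4 d.+3 d d.+4.+1 ;; inc d.+2) ;;
      clear_reg d.+2 ;; clear_reg d.+3
  end.

(** * Correctness and running time of compiled expressions *)

Definition comp_spec e := exists C, forall m d R x o,
  all (fun v => v < d) m -> (forall k, d <= k -> R k = 0) ->
  run (comp e m d) (conf [::] x o R) ((size x + sumn (map R m) + 2) ^ C)
      (conf [::] x o (upd R d (eval e x (map R m)))).

Lemma map_upd m d (R : nat -> nat) k v :
  all (fun v => v < d) m -> d <= k -> map (upd R k v) m = map R m.
Proof.
move=> /allP Hm Hk; apply/eq_in_map => i /Hm Hi.
by rewrite /upd; case: eqP => //; lia.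
Qed.

Lemma all_lt_le m d d' : all (fun v => v < d) m -> d <= d' ->
  all (fun v => v < d') m.
Proof. by move=> /allP H Hd; apply/allP => i /H; lia. Qed.

Lemma expn_mono C a b : a <= b -> (a + 2) ^ C <= (b + 2) ^ C.
Proof. by move=> H; case: C => // C; rewrite leq_exp2r ?leq_add2r. Qed.

Ltac free_regs H := let k := fresh "k" in let Hk := fresh "Hk" in
  move=> k Hk; split_regs; try lia; try (apply: H; lia).
Ltac regs0 H := regs; rewrite ?H //; lia.

Lemma comp_spec_One : comp_spec One.
Proof.
exists 1 => m d R x o _ H; apply: run_eq (run_inc _ _ _ _ _) _ _ _ => //=.
  by rewrite H.
lia.
Qed.

Lemma comp_spec_Var : comp_spec Var.
Proof.
have [C HC] : poly_bounded (fun s => s * 10 + 2) by pbound.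
exists C => [[|s m]] d R x o Hm H /=.
  apply: run_eq (run_skip _) _ _ _ => //; last by rewrite expn_gt0 addn2.
  by regs0 H.
move: Hm => /= /andP[Hs Hm].
apply: run_eq (run_copy_reg _ _ _ _ _ _ _) _ _ _ => //; try lia.
- by rewrite H.
- by rewrite H.
by apply: leq_trans (HC _); lia.
Qed.

Lemma comp_spec_Wk e : comp_spec e -> comp_spec (Wk e).
Proof.
move=> [C HC]; exists C => m d R x o Hm H /=.
rewrite behead_map; apply: run_weaken (HC (behead m) d R x o _ H) _.
  by case: m Hm => //= v m /andP[].
by apply: expn_mono; case: m {Hm} => //= *; lia.
Qed.

Lemma comp_spec_Let a b : comp_spec a -> comp_spec b -> comp_spec (Let a b).
Proof.
move=> [Ca HCa] [Cb HCb]; have [Da HDa] := eval_bounded a.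
have [Db HDb] := eval_bounded b.
have [C HC] : poly_bounded (fun s => (s + 2) ^ Ca +
    ((s + (s + 2) ^ Da) + 2) ^ Cb +
    ((s + 2) ^ Da + ((s + (s + 2) ^ Da) + 2) ^ Db) * 4 + 2) by pbound.
exists C => m d R x o Hm H /=; set s := size x + sumn _.
have H1 := HCa m d R x o Hm H; have := HDa x (map R m).
move: H1; set va := eval a _ _ => H1 Hva.
have := HCb (d :: m) d.+1 (upd R d va) x o; rewrite /= ltnS leqnn upd_same.
rewrite (map_upd _ _ Hm) //.
have -> // : all (fun v => v < d.+1) m by apply: all_lt_le Hm _.
have := HDb x (va :: map R m); set vb := eval b _ _ => Hvb /(_ isT) H2.
have {}H2 := H2 ltac:(free_regs H).
apply: run_eq (run_seq H1 (run_seq H2 (run_seq (run_clear_reg _ _ _ d _)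
  (run_move_reg _ _ _ _ (_ : d.+1 != d))))) _ _ _ => //; first by lia.
  by regs0 H.
have -> : upd (upd R d va) d.+1 vb d = va.
  by rewrite /upd eqxx; case: eqP => //; lia.
have -> : upd (upd (upd R d va) d.+1 vb) d 0 d.+1 = vb.
  by rewrite /upd eqxx; case: eqP => //; lia.
apply: leq_trans (HC s); rewrite -/s in Hva *.
have E : size x + sumn (va :: map R m) <= s + (s + 2) ^ Da.
  by rewrite /= /s; move: Hva; rewrite /s; lia.
have := expn_mono Cb E; have := expn_mono Db E.
rewrite /= in Hvb *; lia.
Qed.

(** Serves [Add] and [Sub] alike. The arithmetic operation behind [op] is expressed by evaluating
    [op Var (Wk Var)] at the two values. *)
Lemma comp_spec_bin op f a b :
  (forall m d, comp (op a b) m d = (comp a m d ;; comp b m d.+1 ;; f d.+1 d)) ->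
  (forall l r o d R, run (f d.+1 d) (conf l r o R) (R d.+1 * 4).+1
    (conf l r o (upd (upd R d.+1 0) d
       (eval (op Var (Wk Var)) [::] [:: R d; R d.+1])))) ->
  (forall x v, eval (op a b) x v =
     eval (op Var (Wk Var)) [::] [:: eval a x v; eval b x v]) ->
  comp_spec a -> comp_spec b -> comp_spec (op a b).
Proof.
move=> Hc Hf He [Ca HCa] [Cb HCb]; have [Db HDb] := eval_bounded b.
have [C HC] : poly_bounded (fun s => (s + 2) ^ Ca + (s + 2) ^ Cb +
   ((s + 2) ^ Db) * 4 + 1) by pbound.
exists C => m d R x o Hm H; rewrite Hc He.
set va := eval a _ _; set vb := eval b _ _.
have := HCb m d.+1 (upd R d va) x o; rewrite (map_upd _ _ Hm) //.
have -> // : all (fun v => v < d.+1) m by apply: all_lt_le Hm _.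
rewrite -/vb => /(_ isT) H2; have {}H2 := H2 ltac:(free_regs H).
apply: run_eq (run_seq (HCa m d R x o Hm H) (run_seq H2 (Hf _ _ _ d _))) _ _ _ => //.
  have -> : upd (upd R d va) d.+1 vb d = va.
    by rewrite /upd eqxx; case: eqP => //; lia.
  by rewrite upd_same; regs0 H.
by rewrite upd_same; apply: leq_trans (HC _); have := HDb x (map R m); lia.
Qed.

Lemma comp_spec_Add a b : comp_spec a -> comp_spec b -> comp_spec (Add a b).
Proof.
apply: (@comp_spec_bin Add move_reg) => // l r o d R.
by apply: run_move_reg; lia.
Qed.

Lemma comp_spec_Sub a b : comp_spec a -> comp_spec b -> comp_spec (Sub a b).
Proof.
apply: (@comp_spec_bin Sub sub_reg) => // l r o d R.
by apply: run_sub_reg; lia.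
Qed.

Lemma comp_spec_Mul a b : comp_spec a -> comp_spec b -> comp_spec (Mul a b).
Proof.
move=> [Ca HCa] [Cb HCb]; have [Da HDa] := eval_bounded a.
have [Db HDb] := eval_bounded b.
have [C HC] : poly_bounded (fun s => (s + 2) ^ Ca + (s + 2) ^ Cb +
   (s + 2) ^ Da * ((s + 2) ^ Db * 10 + 4) + ((s + 2) ^ Db) * 4 + 2) by pbound.
exists C => m d R x o Hm H /=.
have := HCa m d.+1 R x o (all_lt_le Hm (leqnSn _)) => H1.
have {}H1 := H1 ltac:(free_regs H).
have := HDa x (map R m); move: H1; set va := eval a _ _ => H1 Hva.
have := HCb m d.+2 (upd R d.+1 va) x o (all_lt_le Hm (leqW (leqnSn _))).
rewrite (map_upd _ _ Hm) // => H2; have {}H2 := H2 ltac:(free_regs H).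
have := HDb x (map R m); move: H2; set vb := eval b _ _ => H2 Hvb.
have H3 : run (loop d.+1 (dec d.+1 ;; copy_reg d.+2 d d.+3))
  (conf [::] x o (upd (upd R d.+1 va) d.+2 vb)) (va * (vb * 10 + 4)).+1
  (conf [::] x o (upd (upd R d (va * vb)) d.+2 vb)).
  apply: run_eq (@run_count [::] x o d.+1 _ va (vb * 10 + 3)
     (fun i => upd (upd (upd R d (i * vb)) d.+1 (va - i)) d.+2 vb) _ _) _ _ _.
  - by regs.
  - move=> i Hi; apply: run_eq (run_seq (run_dec _ _ _ d.+1 _)
      (run_copy_reg _ _ _ (_ : d.+2 != d) (_ : d.+2 != d.+3) (_ : d != d.+3) _))
      (fun=> erefl) _ _; try lia.
    + by split_regs; try lia; apply: H; lia.
    + by regs; rewrite mulSn; lia.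
    + have -> : upd (upd (upd (upd R d (i * vb)) d.+1 (va - i)) d.+2 vb) d.+1
        (upd (upd (upd R d (i * vb)) d.+1 (va - i)) d.+2 vb d.+1).-1 d.+2 = vb.
        by split_regs; lia.
      lia.
  - by regs0 H.
  - by regs0 H.
  - by rewrite -addnS.
apply: run_eq (run_seq H1 (run_seq H2 (run_seq H3
  (run_clear_reg _ _ _ d.+2 _)))) _ _ _ => //; first by regs0 H.
rewrite upd_same; apply: leq_trans (HC _).
have : va * (vb * 10 + 4) <= (size x + sumn [seq R i | i <- m] + 2) ^ Da *
   ((size x + sumn [seq R i | i <- m] + 2) ^ Db * 10 + 4).
  by apply: leq_mul => //; rewrite leq_add2r leq_mul2r Hvb orbT.
move: (va * _) (_ ^ Da * _) => p q; lia.
Qed.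

Lemma run_rewind_take x i o R :
  run rewind (conf (rev (take i x)) (drop i x) o R) (size x * (#|A| + 5)).+1
    (conf [::] x o R).
Proof.
have := run_rewind (rev (take i x)) (drop i x) o R.
rewrite catrevE revK cat_take_drop => H; apply: run_weaken H _.
by rewrite ltnS leq_mul2r size_rev size_take_min geq_minr orbT.
Qed.

Lemma comp_spec_Len : comp_spec Len.
Proof.
have [C HC] : poly_bounded (fun s => s * (#|A| + 7) + s * (#|A| + 5) + 2)
  by pbound.
exists C => m d R x o Hm H /=.
pose I i := conf (rev (take i x)) (drop i x) o (upd R d i).
have H1 : run (While 1 (move_letter 1 2 ;; inc d)) (conf [::] x o R)
    (size x * (#|A| + 7)).+1 (I (size x)).
  have -> : conf [::] x o R = I 0.
    by rewrite /I take0 drop0; apply: conf_ext; regs0 H.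
  have -> : #|A| + 7 = (#|A| + 6).+1 by rewrite addnS.
  apply: run_loop => [i Hi|| i Hi].
  - by rewrite /I /= => /(congr1 size); rewrite size_map size_drop /=; lia.
  - by rewrite /I /= drop_size.
  - have -> : #|A| + 6 = #|A| + 4 + 2 by rewrite -addnA.
    apply: run_seq (run_advance _ _ _ _) _.
    by apply: run_eq (run_inc _ _ _ d _) _ _ _ => //; regs.
apply: run_weaken (run_seq H1 (run_rewind_take _ _ _ _)) _.
apply: leq_trans (HC _); rewrite -addn1 -(addn1 (_ * (#|A| + 5))).
have : size x <= size x + sumn (map R m) by lia.
move: (size x) (#|A|) (sumn _) => p q r; nia.
Qed.

Lemma comp_spec_Inp e : comp_spec e -> comp_spec (Inp e).
Proof.
move=> [Ce HCe]; have [De HDe] := eval_bounded e.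
have [C HC] : poly_bounded (fun s => (s + 2) ^ Ce +
   (s + 2) ^ De * (#|A| + 6) + (#|A| * 3 + 1) + s * (#|A| + 5) + 2)
  by pbound.
exists C => m d R x o Hm H /=.
have H1 := HCe m d.+1 R x o (all_lt_le Hm (leqnSn _)).
have {}H1 := H1 ltac:(free_regs H).
have := HDe x (map R m); move: H1; set v := eval e _ _ => H1 Hv.
pose I i := conf (rev (take i x)) (drop i x) o (upd R d.+1 (v - i)).
have H2 : run (loop d.+1 (dec d.+1 ;; move_letter 1 2))
   (conf [::] x o (upd R d.+1 v)) (v * (#|A| + 6)).+1 (I v).
  have -> : conf [::] x o (upd R d.+1 v) = I 0.
    by rewrite /I take0 drop0 subn0.
  have -> : #|A| + 6 = (1 + (#|A| + 4)).+1 by rewrite add1n !addnS.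
  apply: run_loop => [i Hi|| i Hi].
  - by rewrite /I /= upd_same -(subnSK Hi).
  - by rewrite /I /= upd_same subnn.
  - apply: run_seq (run_advance _ _ _ _).
    by apply: run_eq (run_dec _ _ _ d.+1 _) _ _ _ => //; regs.
apply: run_weaken (run_seq H1 (run_seq H2 (run_seq (run_code_switch _ _ _ _ d)
  (_ : run _ _ (size x * (#|A| + 5)).+1 _)))) _.
  have -> : upd R d (nth 0 (map code x) v) =
    upd (upd R d.+1 (v - v)) d
       (upd R d.+1 (v - v) d + nth 0 (map code (drop v x)) 0).
    apply: functional_extensionality.
    by rewrite map_drop nth_drop addn0 subnn; regs0 H.
  exact: run_rewind_take.
apply: leq_trans (HC _).
have : v * (#|A| + 6) <= (size x + sumn [seq R i | i <- m] + 2) ^ De * (#|A| + 6).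
  by rewrite leq_mul2r Hv orbT.
have : size x * (#|A| + 5) <= (size x + sumn [seq R i | i <- m]) * (#|A| + 5).
  by rewrite leq_mul2r leq_addr orbT.
move: (v * _) (size x * _) ((_ + _) * (_ + 5)) (_ ^ _ * (_ + _)) (_ ^ Ce) (_ * 3).
lia.
Qed.

Lemma comp_spec_Iter n i c b : comp_spec n -> comp_spec i -> comp_spec c ->
  comp_spec b -> comp_spec (Iter n i c b).
Proof.
move=> [Cn HCn] [Ci HCi] [Cc HCc] [Cb HCb].
have [Dn HDn] := eval_bounded n; have [Di HDi] := eval_bounded i.
have [Dc HDc] := eval_bounded c; have [Db HDb] := eval_bounded b.
(* The environment of the body has two more entries, the accumulator, at most the cap, and the
   index, below the number of rounds; [S] bounds the resulting size and [TB] the time of one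
   round. *)
pose S s := s + (s + 2) ^ Dc + (s + 2) ^ Dn.
pose TB s := (S s + 2) ^ Cb + (s + 2) ^ Dc * 4 + (S s + 2) ^ Db * 13 + 6.
have [C HC] : poly_bounded (fun s => (s + 2) ^ Cn + (s + 2) ^ Cc +
   (s + 2) ^ Ci + (s + 2) ^ Di * 13 + (s + 2) ^ Dn * (TB s + 1) +
   (s + 2) ^ Dn * 4 + (s + 2) ^ Dc * 4 + 5) by rewrite /TB /S; pbound.
exists C => m d R x o Hm H /=; set s := size x + sumn _.
have Es : size x + sumn (map R m) = s by [].
have H1 := HCn m d.+1 R x o (all_lt_le Hm (leqnSn _)).
have {}H1 := H1 ltac:(free_regs H).
have := HDn x (map R m); move: H1; rewrite -/s; set vn := eval n _ _ => H1 Hvn.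
have := HCc m d.+3 (upd R d.+1 vn) x o (all_lt_le Hm (leqW (leqW (leqnSn _)))).
rewrite (map_upd _ _ Hm) // => H2; have {}H2 := H2 ltac:(free_regs H).
have := HDc x (map R m); move: H2; rewrite -/s; set vc := eval c _ _ => H2 Hvc.
have Hm4 : all (fun v => v < d.+4) m by apply: all_lt_le Hm _; lia.
have := HCi m d.+4 (upd (upd R d.+1 vn) d.+3 vc) x o Hm4.
rewrite !(map_upd _ _ Hm) //; last by lia.
move=> H3; have {}H3 := H3 ltac:(free_regs H).
have := HDi x (map R m); move: H3; rewrite -/s; set vi := eval i _ _ => H3 Hvi.
pose F j acc := eval b x (acc :: j :: map R m).
(* Layout of the loop: accumulator in [d], remaining rounds in [d.+1], index in [d.+2], cap in
   [d.+3]; the body is evaluated from [d.+4] on. *)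
pose Q a j k := upd (upd (upd (upd R d a) d.+1 (vn - j)) d.+2 j) d.+3 k.
have Hu : uniq [:: d.+4; d.+3; d; d.+4.+1] by rewrite /= !inE; lia.
have H4 : run (min_reg d.+4 d.+3 d d.+4.+1)
  (conf [::] x o (upd (upd (upd R d.+1 vn) d.+3 vc) d.+4 vi)) (vi * 13 + 2)
  (conf [::] x o (Q (minn vi vc) 0 vc)).
  apply: run_eq (run_min_reg _ _ _ Hu _) (fun=> erefl) _ _.
  - by split_regs; try lia; apply: H; lia.
  - by rewrite /Q; regs0 H.
  - by rewrite upd_same.
pose J j := Q (capped_iter vc F j vi) j vc.
have H5 : run (loop d.+1 (dec d.+1 ;; comp b (d :: d.+2 :: m) d.+4 ;;
    clear_reg d ;; min_reg d.+4 d.+3 d d.+4.+1 ;; inc d.+2))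
  (conf [::] x o (J 0)) (vn * (TB s).+1).+1 (conf [::] x o (J vn)).
  apply: run_count => [j|j Hj].
    by rewrite /J /Q; split_regs; lia.
  set a := capped_iter vc F j vi.
  have Ha : a <= vc by exact: capped_iter_le.
  pose P v w := upd (upd (upd (upd (upd R d v) d.+1 (vn - j.+1)) d.+2 j) d.+3 vc)
    d.+4 w.
  have K1 : run (dec d.+1) (conf [::] x o (J j)) 1 (conf [::] x o (P a 0)).
    apply: run_eq (run_dec _ _ _ d.+1 _) (fun=> erefl) _ _ => //.
    by rewrite /J -/a /P /Q; regs0 H.
  have K2 : run (comp b (d :: d.+2 :: m) d.+4) (conf [::] x o (P a 0))
      ((S s + 2) ^ Cb) (conf [::] x o (P a (F j a))).
    have EP : map (P a 0) (d :: d.+2 :: m) = a :: j :: map R m.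
      rewrite /= /P !(map_upd _ _ Hm) //; try lia.
      congr [:: _, _ & _]; split_regs; lia.
    have := HCb (d :: d.+2 :: m) d.+4 (P a 0) x o.
    rewrite EP /= Hm4 -/(F j a) => K.
    have {}K := K ltac:(lia) ltac:(rewrite /P; free_regs H).
    apply: run_eq K _ _ _ => //; first by rewrite /P; regs0 H.
    by apply: expn_mono; rewrite /S; lia.
  have K3 : run (clear_reg d) (conf [::] x o (P a (F j a))) ((s + 2) ^ Dc * 4).+1
      (conf [::] x o (P 0 (F j a))).
    apply: run_eq (run_clear_reg _ _ _ d _) (fun=> erefl) _ _.
      by rewrite /P; regs0 H.
    have -> : P a (F j a) d = a by rewrite /P; split_regs; lia.
    lia.
  have HF : F j a <= (S s + 2) ^ Db.
    apply: leq_trans (HDb _ _) _; apply: expn_mono; rewrite /S /=; lia.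
  have K4 : run (min_reg d.+4 d.+3 d d.+4.+1) (conf [::] x o (P 0 (F j a)))
      ((S s + 2) ^ Db * 13 + 2) (conf [::] x o (P (minn (F j a) vc) 0)).
    apply: run_eq (run_min_reg _ _ _ Hu _) (fun=> erefl) _ _.
    - by rewrite /P; split_regs; try lia; apply: H; lia.
    - by rewrite /P; regs0 H.
    - by rewrite /P upd_same; lia.
  apply: run_eq (run_seq K1 (run_seq K2 (run_seq K3 (run_seq K4
    (run_inc _ _ _ d.+2 _))))) (fun=> erefl) _ _.
    by rewrite /J /= -/a /P /Q; regs0 H.
  by rewrite /TB; lia.
have := run_seq H1 (run_seq H2 (run_seq H3 (run_seq H4 (run_seq H5
  (run_seq (run_clear_reg _ _ _ d.+2 _) (run_clear_reg _ _ _ d.+3 _)))))).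
move=> K; apply: run_eq K (fun=> erefl) _ _.
  by rewrite /J /Q /F; regs0 H.
have -> : J vn d.+2 = vn by rewrite /J /Q; split_regs; lia.
have -> : upd (J vn) d.+2 0 d.+3 = vc.
  by rewrite /J /Q; split_regs; lia.
apply: leq_trans (HC s).
have : vn * (TB s).+1 <= (s + 2) ^ Dn * (TB s + 1).
  by rewrite -addn1 leq_mul2r Hvn orbT.
move: (vn * (TB s).+1) ((s + 2) ^ Dn * _) => p q; lia.
Qed.

Lemma comp_ok e : comp_spec e.
Proof.
elim: e => [||e H|a Ha b Hb|a Ha b Hb|a Ha b Hb|a Ha b Hb||e H|n Hn i Hi c Hc b Hb].
- exact: comp_spec_One.
- exact: comp_spec_Var.
- exact: comp_spec_Wk.
- exact: comp_spec_Let.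
- exact: comp_spec_Add.
- exact: comp_spec_Sub.
- exact: comp_spec_Mul.
- exact: comp_spec_Len.
- exact: comp_spec_Inp.
- exact: comp_spec_Iter.
Qed.

(** * Emission of the output word *)

Fixpoint out_switch (s : seq B) b0 : prog :=
  if s is b :: s' then
    If 4 (fun h => h == None) (Push 0 (out_letter b)) (dec 1 ;; out_switch s' b0)
  else Push 0 (out_letter b0).

Lemma run_out_switch s b0 x o R :
  run (out_switch s b0) (conf [::] x o R) (size s * 2 + 2)
    (conf [::] x (out_letter (nth b0 s (R 1)) :: o) (upd R 1 (R 1 - size s))).
Proof.
have P b u Q : run (Push 0 (out_letter b)) (conf [::] x u Q) 2
    (conf [::] x (out_letter b :: u) Q).
  exists 2 => //.
  have -> : conf [::] x (out_letter b :: u) Q =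
    upd (conf [::] x u Q) 0 (out_letter b :: conf [::] x u Q 0).
    by apply: functional_extensionality => [[|k]].
  exact: ExecPush.
elim: s R => [|b s IH] R.
  rewrite nth_nil [size _]/= subn0.
  by rewrite (@conf_ext _ _ _ (upd R 1 (R 1)) R); [exact: P|regs].
have -> : size (b :: s) * 2 + 2 = (1 + (size s * 2 + 2)).+1.
  by rewrite [size _]/=; lia.
apply: run_if; rewrite [conf _ _ _ _ _]/=.
case E : (R 1) => [|n] /=.
  rewrite (@conf_ext _ _ _ (upd R 1 _) R); last by regs.
  by apply: run_weaken (P _ _ _) _; lia.
apply: run_seq (run_dec _ _ _ 1 _) _.
have := IH (upd R 1 (R 1).-1); rewrite upd_same E /= => H.
rewrite (_ : conf _ _ (_ :: o) _ = conf [::] x (out_letter (nth b0 s n) :: o)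
  (upd (upd R 1 n) 1 (n - size s))) //.
by apply: conf_ext; regs.
Qed.

(** The output tape is a stack, so the letters are pushed from the last to the first while register
    0 counts down. Register 1, which is tape 4, holds the index of the letter to push. *)
Definition emit (L G : expr) (bs : seq B) b0 : prog :=
  While 0 (move_letter 0 2) ;; rewind ;; comp L [::] 0 ;;
  loop 0 (dec 0 ;; comp G [:: 0] 1 ;; out_switch bs b0 ;; clear_reg 1).

Definition emitted (L G : expr) (bs : seq B) b0 (x : seq A) : seq B :=
  mkseq (fun i => nth b0 bs (eval G x [:: i])) (eval L x [::]).

Lemma run_emit L G bs b0 : exists C, forall x, exists2 s,
  run (emit L G bs b0) (fun k => if k == 0 then map in_letter x else [::])
    ((size x + 2) ^ C) s
  & s 0 = map out_letter (emitted L G bs b0 x).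
Proof.
have [CL HCL] := comp_ok L; have [CG HCG] := comp_ok G.
have [DL HDL] := eval_bounded L; have [DG HDG] := eval_bounded G.
pose TB s := (s + (s + 2) ^ DL + 2) ^ CG + (s + (s + 2) ^ DL + 2) ^ DG * 4 +
   (size bs * 2 + 2) + 2.
have [C HC] : poly_bounded (fun s => s * (#|A| + 5) + s * (#|A| + 5) +
   (s + 2) ^ CL + (s + 2) ^ DL * (TB s + 1) + 3) by rewrite /TB; pbound.
exists C => x; set y := emitted _ _ _ _ _.
pose Z : nat -> nat := fun=> 0.
pose n := eval L x [::].
exists (conf [::] x (map out_letter y) Z) => //.
have H1 : run (While 0 (move_letter 0 2))
   (fun k => if k == 0 then map in_letter x else [::])
   (size x * (#|A| + 5)).+1 (conf (rev x) [::] [::] Z).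
  pose I i := conf (rev (take i x)) [::] (map in_letter (drop i x)) Z.
  have -> : (fun k => if k == 0 then map in_letter x else [::]) = I 0.
    apply: functional_extensionality => k; rewrite /I take0 drop0 /Z.
    by case: k => [|[|[|k]]].
  have -> : conf (rev x) [::] [::] Z = I (size x).
    by rewrite /I take_size drop_size.
  have -> : #|A| + 5 = (#|A| + 4).+1 by rewrite addnS.
  apply: run_loop => [i Hi|| i Hi].
  - by rewrite /I /= => /(congr1 size); rewrite size_map size_drop /=; lia.
  - by rewrite /I /= drop_size.
  - have a0 : A by case: x Hi {y n I}.
    have := @run_move_letter 0 2 (nth a0 x i) (map in_letter (drop i.+1 x)) (I i).
    rewrite {1}/I /= -map_cons -drop_nth // => /(_ erefl isT) H.
    suff -> : I i.+1 = upd (upd (I i) 0 (map in_letter (drop i.+1 x))) 2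
       (in_letter (nth a0 x i) :: I i 2) by [].
    apply: functional_extensionality => [[|[|[|k]]]] //=.
    by rewrite (take_nth a0) // rev_rcons.
have H2 : run rewind (conf (rev x) [::] [::] Z) (size x * (#|A| + 5)).+1
    (conf [::] x [::] Z).
  have := run_rewind (rev x) [::] [::] Z.
  by rewrite catrevE revK cats0 size_rev.
have H3 := HCL [::] 0 Z x [::] isT (fun _ _ => erefl).
rewrite /= addn0 -/n in H3.
have Hn : n <= (size x + 2) ^ DL by have := HDL x [::]; rewrite /= addn0.
have sy : size y = n by rewrite size_mkseq.
pose I j := conf [::] x (map out_letter (drop (n - j) y)) (upd Z 0 (n - j)).
have H4 : run (loop 0 (dec 0 ;; comp G [:: 0] 1 ;; out_switch bs b0 ;; clear_reg 1))
   (I 0) (n * (TB (size x)).+1).+1 (I n).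
  apply: run_loop => [j Hj|| j Hj].
  - by rewrite /I /= upd_same -(subnSK Hj).
  - by rewrite /I /= upd_same subnn.
  set i := n - j.+1.
  have Ei : n - j = i.+1 by rewrite /i; lia.
  have Hi : i < n by lia.
  pose o := map out_letter (drop i.+1 y).
  have K1 : run (dec 0) (I j) 1 (conf [::] x o (upd Z 0 i)).
    rewrite /I Ei -/o; apply: run_eq (run_dec _ _ _ 0 _) (fun=> erefl) _ _ => //.
    by regs.
  have K2 : run (comp G [:: 0] 1) (conf [::] x o (upd Z 0 i))
      ((size x + (size x + 2) ^ DL + 2) ^ CG)
      (conf [::] x o (upd (upd Z 0 i) 1 (eval G x [:: i]))).
    have := HCG [:: 0] 1 (upd Z 0 i) x o isT.
    rewrite /= upd_same addn0 => K; have {}K := K ltac:(by case).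
    by apply: run_weaken K _; apply: expn_mono; lia.
  set g := eval G x [:: i] in K2.
  have K3 := run_out_switch bs b0 x o (upd (upd Z 0 i) 1 g).
  rewrite upd_same in K3.
  have K4 := run_clear_reg [::] x (out_letter (nth b0 bs g) :: o) 1
    (upd (upd (upd Z 0 i) 1 g) 1 (g - size bs)).
  rewrite upd_same in K4.
  have := run_seq K1 (run_seq K2 (run_seq K3 K4)).
  rewrite (@conf_ext _ _ _ (upd _ _ 0) (upd Z 0 i)); last by regs.
  have -> : out_letter (nth b0 bs g) :: o = map out_letter (drop (n - j.+1) y).
    rewrite -/i (drop_nth b0) ?sy //= -/o; congr (out_letter _ :: _).
    by rewrite nth_mkseq.
  move=> K; apply: run_weaken K _.
  have : g <= (size x + (size x + 2) ^ DL + 2) ^ DG.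
    apply: leq_trans (HDG _ _) _; apply: expn_mono => /=; lia.
  rewrite /TB; lia.
have -> : conf [::] x (map out_letter y) Z = I n.
  by rewrite /I subnn drop0; apply: conf_ext; regs.
have E0 : I 0 = conf [::] x [::] (upd Z 0 n).
  by rewrite /I subn0 -sy drop_size.
rewrite E0 in H4.
apply: run_weaken (run_seq H1 (run_seq H2 (run_seq H3 H4))) _.
apply: leq_trans (HC _).
have : n * (TB (size x)).+1 <= (size x + 2) ^ DL * (TB (size x) + 1).
  by rewrite -addn1 leq_mul2r Hn orbT.
move: (n * _) (_ * (_ + 1)) (_ * (_ + 5)) => p q r; lia.
Qed.

End Counters.

Lemma horner_nat_bound C n : (('X + 2%:P) ^+ C : {poly nat}).[n]%R = (n + 2) ^ C.
Proof.
elim: C => [|C IH]; first by rewrite expr0 hornerC.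
by rewrite exprS hornerM IH expnS hornerD hornerX hornerC.
Qed.

Lemma emitted_polytime (A B : finType) (L G : expr) (bs : seq B) b0 (f : seq A -> seq B) :
  (forall x, f x = emitted L G bs b0 x) -> polytime f.
Proof.
move=> Hf; have [C HC] := run_emit A L G bs b0.
exists (machine (@in_letter_inj A B) (@out_letter_inj A B) (emit A L G bs b0)).
exists (('X + 2%:P) ^+ C)%R => x; rewrite horner_nat_bound.
have [s [t Ht E] Es] := HC x.
by apply: machine_outputs E _ Ht; rewrite Es Hf.
Qed.

(** * Functions definable by expressions *)

(* A definable function takes the input word and an environment of unary
   numbers.  Environments are functions, so that a shifted environment
   [fun k => v k.+1] applied to a numeral reduces by conversion. *)
Definition definable (A : finType) (f : seq A -> (nat -> nat) -> nat) : Prop :=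
  exists e, forall x s, eval e x s = f x (nth 0 s).

Lemma count_lt_iota q n : q <= n -> count (fun i => i < q) (iota 0 n) = q.
Proof.
move=> Hq; rewrite -(subnKC Hq) iotaD count_cat add0n.
rewrite (@eq_in_count _ _ predT) ?count_predT ?size_iota; last first.
  by move=> i; rewrite mem_iota /= => ->.
rewrite (@eq_in_count _ _ pred0) ?count_pred0 ?addn0 //.
by move=> i; rewrite mem_iota /= => /andP[Hi _]; rewrite ltnNge Hi.
Qed.

Section Definable.
Variable A : finType.
Implicit Types (f g h : seq A -> (nat -> nat) -> nat)
  (a b : seq A -> (nat -> nat) -> bool).

Lemma def_one : definable (fun (_ : seq A) _ => 1).
Proof. by exists One. Qed.

Lemma def_var i : definable (fun (_ : seq A) v => v i).
Proof.
elim: i => [|i [e He]]; first by exists Var => x s; rewrite /= nth0.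
by exists (Wk e) => x s /=; rewrite He nth_behead.
Qed.

Lemma def_len : definable (fun (x : seq A) _ => size x).
Proof. by exists Len. Qed.

Lemma def_shift f : definable f -> definable (fun x v => f x (fun k => v k.+1)).
Proof.
move=> [e He]; exists (Wk e) => x s; rewrite /= He; congr f.
by apply: functional_extensionality => k; rewrite nth_behead.
Qed.

Lemma def_let f (F : seq A -> nat -> (nat -> nat) -> nat) :
  definable f -> definable (fun x v => F x (v 0) (fun k => v k.+1)) ->
  definable (fun x v => F x (f x v) v).
Proof. by move=> [e He] [d Hd]; exists (Let e d) => x s; rewrite /= Hd He. Qed.

Lemma def_add f g : definable f -> definable g -> definable (fun x v => f x v + g x v).
Proof. by move=> [e He] [d Hd]; exists (Add e d) => x s; rewrite /= Hd He. Qed.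

Lemma def_sub f g : definable f -> definable g -> definable (fun x v => f x v - g x v).
Proof. by move=> [e He] [d Hd]; exists (Sub e d) => x s; rewrite /= Hd He. Qed.

Lemma def_mul f g : definable f -> definable g -> definable (fun x v => f x v * g x v).
Proof. by move=> [e He] [d Hd]; exists (Mul e d) => x s; rewrite /= Hd He. Qed.

Definition letter_at (x : seq A) i := nth 0 (map (@code A) x) i.

Lemma def_letter_at f : definable f -> definable (fun x v => letter_at x (f x v)).
Proof. by move=> [e He]; exists (Inp e) => x s; rewrite /= He. Qed.

Lemma def_ext f g : (forall x v, f x v = g x v) -> definable f -> definable g.
Proof. by move=> E [e He]; exists e => x s; rewrite He E. Qed.

Lemma def_const n : definable (fun (_ : seq A) _ => n).
Proof.
elim: n => [|n IH]; first exact: (@def_ext _ _ _ (def_sub def_one def_one)).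
apply: def_ext (def_add IH def_one) => x v; exact: addn1.
Qed.

Lemma def_succ f : definable f -> definable (fun x v => (f x v).+1).
Proof.
move=> H; apply: def_ext (def_add H def_one) => x v; exact: addn1.
Qed.

Lemma def_pred f : definable f -> definable (fun x v => (f x v).-1).
Proof.
move=> H; apply: def_ext (def_sub H def_one) => x v; exact: subn1.
Qed.

Lemma capped_iter_ext c F G n i : (forall j acc, F j acc = G j acc) ->
  capped_iter c F n i = capped_iter c G n i.
Proof. by move=> E; elim: n => //= n ->; rewrite E. Qed.

Lemma def_iter n i c (F : seq A -> nat -> nat -> (nat -> nat) -> nat) :
  definable n -> definable i -> definable c ->
  definable (fun x v => F x (v 1) (v 0) (fun k => v k.+2)) ->
  definable (fun x v => capped_iter (c x v) (fun j acc => F x j acc v) (n x v) (i x v)).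
Proof.
move=> [en Hn] [ei Hi] [ec Hc] [eF HF]; exists (Iter en ei ec eF) => x s /=.
by rewrite Hn Hi Hc; apply: capped_iter_ext => j acc; rewrite HF.
Qed.

(** Substitution: [F] is shown definable once, with a variable as its argument, and the actual
    argument is bound by a [Let]. *)
Lemma def_call1 (F : seq A -> nat -> nat) f :
  definable (fun x v => F x (v 0)) -> definable f ->
  definable (fun x v => F x (f x v)).
Proof. by move=> HF Hf; apply: (@def_let f (fun x y _ => F x y)). Qed.

Lemma def_call2 (F : seq A -> nat -> nat -> nat) f g :
  definable (fun x v => F x (v 0) (v 1)) -> definable f -> definable g ->
  definable (fun x v => F x (f x v) (g x v)).
Proof.
move=> HF Hf Hg; apply: (@def_let g (fun x y v => F x (f x v) y)) Hg _.
exact: (@def_let _ (fun x y v => F x y (v 0))) (def_shift Hf) HF.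
Qed.

Lemma def_leq f g : definable f -> definable g ->
  definable (fun x v => f x v <= g x v : nat).
Proof.
move=> Hf Hg; apply: def_ext (def_sub def_one (def_sub Hf Hg)) => x v.
by rewrite /leq; case: (f x v - g x v).
Qed.

Lemma def_and a b : definable (fun x v => a x v : nat) ->
  definable (fun x v => b x v : nat) -> definable (fun x v => a x v && b x v : nat).
Proof.
by move=> Ha Hb; apply: def_ext (def_mul Ha Hb) => x v; rewrite mulnb.
Qed.

Lemma def_not a : definable (fun x v => a x v : nat) ->
  definable (fun x v => ~~ a x v : nat).
Proof.
by move=> Ha; apply: def_ext (def_sub def_one Ha) => x v; case: (a x v).
Qed.

Lemma def_or a b : definable (fun x v => a x v : nat) ->
  definable (fun x v => b x v : nat) -> definable (fun x v => a x v || b x v : nat).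
Proof.
move=> Ha Hb; apply: def_ext (def_not (def_and (def_not Ha) (def_not Hb))) => x v.
by case: (a x v); case: (b x v).
Qed.

Lemma def_imply a b : definable (fun x v => a x v : nat) ->
  definable (fun x v => b x v : nat) -> definable (fun x v => a x v ==> b x v : nat).
Proof.
move=> Ha Hb; apply: def_ext (def_or (def_not Ha) Hb) => x v.
by case: (a x v); case: (b x v).
Qed.

Lemma def_eq f g : definable f -> definable g ->
  definable (fun x v => f x v == g x v : nat).
Proof.
move=> Hf Hg; apply: def_ext (def_and (def_leq Hf Hg) (def_leq Hg Hf)) => x v.
by rewrite eqn_leq.
Qed.

Lemma def_eqb a b : definable (fun x v => a x v : nat) ->
  definable (fun x v => b x v : nat) -> definable (fun x v => a x v == b x v : nat).
Proof.
move=> Ha Hb; apply: def_ext (def_eq Ha Hb) => x v.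
by case: (a x v); case: (b x v).
Qed.

Lemma def_if a f g : definable (fun x v => a x v : nat) -> definable f ->
  definable g -> definable (fun x v => if a x v then f x v else g x v).
Proof.
move=> Ha Hf Hg.
apply: def_ext (def_add (def_mul Ha Hf) (def_mul (def_not Ha) Hg)) => x v.
by case: (a x v); rewrite /= ?mul1n ?mul0n ?addn0.
Qed.

Lemma def_ifb a b (c : seq A -> (nat -> nat) -> bool) : definable (fun x v => a x v : nat) ->
  definable (fun x v => b x v : nat) -> definable (fun x v => c x v : nat) ->
  definable (fun x v => nat_of_bool (if a x v then b x v else c x v)).
Proof.
by move=> Ha Hb Hc; apply: def_ext (def_if Ha Hb Hc) => x v; case: (a x v).
Qed.

Lemma def_count n (P : seq A -> nat -> (nat -> nat) -> bool) :
  definable n -> definable (fun x v => P x (v 0) (fun k => v k.+1) : nat) ->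
  definable (fun x v => count (fun i => P x i v) (iota 0 (n x v))).
Proof.
move=> Hn HP.
(* A count never exceeds the number of rounds, which can therefore serve as the cap. *)
apply: def_ext (def_iter (F := fun x i acc v => acc + P x i v) Hn (def_const 0) Hn _).
  move=> x v; suff: forall N m, m <= N -> capped_iter N
    (fun i acc => acc + P x i v) m 0 = count (fun i => P x i v) (iota 0 m).
    by apply.
  move=> N; elim=> [|m IH] Hm; first by rewrite /= min0n.
  rewrite [LHS]/=.
  rewrite IH; last exact: ltnW.
  rewrite -[in RHS]addn1 iotaD count_cat /= addn0 add0n.
  apply/minn_idPl; apply: leq_trans Hm; have := count_size (fun i => P x i v) (iota 0 m).
  by rewrite size_iota -addn1; case: (P x m v); lia.
exact: def_add (def_var 0) (def_shift HP).
Qed.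

Lemma def_all n (P : seq A -> nat -> (nat -> nat) -> bool) :
  definable n -> definable (fun x v => P x (v 0) (fun k => v k.+1) : nat) ->
  definable (fun x v => all (fun i => P x i v) (iota 0 (n x v)) : nat).
Proof.
move=> Hn HP; apply: def_ext (def_eq (def_count Hn HP) Hn) => x v.
by rewrite all_count size_iota.
Qed.

Lemma def_has n (P : seq A -> nat -> (nat -> nat) -> bool) :
  definable n -> definable (fun x v => P x (v 0) (fun k => v k.+1) : nat) ->
  definable (fun x v => has (fun i => P x i v) (iota 0 (n x v)) : nat).
Proof.
move=> Hn HP; apply: def_ext (def_leq def_one (def_count Hn HP)) => x v.
by rewrite has_count.
Qed.

(** Turns division into a bounded count, and thereby into an expression. *)
Lemma divn_count (m d : nat) : 0 < d ->
  m %/ d = count (fun q => q.+1 * d <= m) (iota 0 m).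
Proof.
move=> d0; have H k : k.+1 * d <= m = (k < m %/ d) by rewrite leq_divRL.
by rewrite (eq_count H) count_lt_iota // leq_div.
Qed.

Lemma def_div f g : definable f -> definable g -> definable (fun x v => f x v %/ g x v).
Proof.
apply: (def_call2 (F := fun _ p d => p %/ d)).
(* The factor [0 < v 1] yields the convention that division by 0 is 0. *)
apply: (def_ext (f := fun x v => (0 < v 1) * count (fun q => q.+1 * v 1 <= v 0) (iota 0 (v 0)))).
  move=> x v; case: (posnP (v 1)) => [->|H] /=; first by rewrite divn0.
  by rewrite mul1n -divn_count.
apply: def_mul; first exact: def_leq def_one (def_var 1).
apply: (def_count (P := fun x q v => q.+1 * v 1 <= v 0)) (def_var 0) _.
exact: def_leq (def_mul (def_succ (def_var 0)) (def_var 2)) (def_var 1).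
Qed.

Lemma def_mod f g : definable f -> definable g -> definable (fun x v => f x v %% g x v).
Proof.
apply: (def_call2 (F := fun _ p d => p %% d)).
apply: def_ext (def_sub (def_var 0) (def_mul (def_div (def_var 0) (def_var 1)) (def_var 1))).
by move=> x v /=; rewrite {1}(divn_eq (v 0) (v 1)) addKn.
Qed.

(** Halving never increases a number, so the initial value is a sufficient cap. This makes binary
    digits definable. *)
Lemma def_iter_half f g : definable f -> definable g ->
  definable (fun x v => iter (f x v) half (g x v)).
Proof.
move=> Hf Hg.
apply: def_ext (def_iter (F := fun x i acc v => acc %/ 2) Hf Hg Hg _).
  move=> x v; set k := g x v; elim: (f x v) => [|n IH] /=; first exact: minnn.
  rewrite IH divn2; apply/minn_idPl.
  by elim: n {IH} => [|n IH] /=; rewrite ?half_leq //; lia.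
exact: def_div (def_var 0) (def_const 2).
Qed.

Lemma def_table (s : seq nat) f : definable f -> definable (fun x v => nth 0 s (f x v)).
Proof.
apply: (def_call1 (F := fun _ i => nth 0 s i)).
elim: s => [|y s IH]; first by apply: def_ext (def_const 0) => x v; rewrite nth_nil.
apply: def_ext (def_if (def_eq (def_var 0) (def_const 0)) (def_const y)
  (def_call1 (F := fun _ i => nth 0 s i) IH (def_pred (def_var 0)))) => x v.
by case: (v 0).
Qed.

Lemma def_horner (p : {poly nat}) f : definable f -> definable (fun x v => p.[f x v]%R).
Proof.
apply: (def_call1 (F := fun _ i => p.[i]%R)); rewrite /horner.
elim: (polyseq p) => [|y s IH] /=; first exact: def_const.
exact: def_add (def_mul IH (def_var 0)) (def_const y).
Qed.

Theorem definable_polytime (B : finType) (bs : seq B) (b0 : B) (f : seq A -> seq B)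
    (L : seq A -> nat) (G : seq A -> nat -> nat) :
  definable (fun x _ => L x) -> definable (fun x v => G x (v 0)) ->
  (forall x, f x = mkseq (fun i => nth b0 bs (G x i)) (L x)) -> polytime f.
Proof.
move=> [eL HL] [eG HG] Hf; apply: (@emitted_polytime A B eL eG bs b0) => x.
rewrite Hf /emitted HL; apply: eq_mkseq => i; by rewrite HG.
Qed.

End Definable.

(* Dispatch on the head symbol: blind application of the lemmas would unfold
   the defined functions. *)
Ltac definability_hook := fail.
Ltac definability_step := cbv beta; first
  [ match goal with H : definable ?f |- definable ?g => constr_eq f g; exact: H end
  | definability_hook
  | lazymatch goal with
    | |- definable (fun x v => nat_of_bool (andb _ _)) => apply: def_and
    | |- definable (fun x v => nat_of_bool (orb _ _)) => apply: def_or
    | |- definable (fun x v => nat_of_bool (negb _)) => apply: def_not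
    | |- definable (fun x v => nat_of_bool (implb _ _)) => apply: def_imply
    | |- definable (fun x v => nat_of_bool (leq _ _)) => apply: def_leq
    | |- definable (fun x v => nat_of_bool (has _ _)) => apply: def_has
    | |- definable (fun x v => nat_of_bool (all _ _)) => apply: def_all
    | |- definable (fun x v => nat_of_bool (_ == _)) =>
        first [apply: def_eq | apply: def_eqb]
    | |- definable (fun x v => nat_of_bool (if _ then _ else _)) => apply: def_ifb
    | |- definable (fun x v => if _ then _ else _) => apply: def_if
    | |- definable (fun x v => addn _ _) => apply: def_add
    | |- definable (fun x v => subn _ _) => apply: def_sub
    | |- definable (fun x v => muln _ _) => apply: def_mul
    | |- definable (fun x v => divn _ _) => apply: def_div
    | |- definable (fun x v => modn _ _) => apply: def_mod
    | |- definable (fun x v => iter _ half _) => apply: def_iter_half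
    | |- definable (fun x v => count _ _) => apply: def_count
    | |- definable (fun x v => nth 0 _ _) => apply: def_table
    | |- definable (fun x v => horner _ _) => apply: def_horner
    | |- definable (fun x v => letter_at _ _) => apply: def_letter_at
    | |- definable (fun x v => size _) => apply: def_len
    | |- definable (fun x v => v _) => apply: def_var
    | |- definable (fun x v => _.+1) => apply: def_succ
    | |- definable (fun x v => predn _) => apply: def_pred
    | _ => apply: def_const
    end ].
Ltac definability := repeat definability_step.

(** * Binary digits *)

Lemma bits_of_nat0 : bits_of_nat 0 = [::]. Proof. by []. Qed.

Lemma bits_of_nat_pos p : bits_of_nat (nat_of_pos p) = bits_of_pos p.
Proof. by rewrite /bits_of_nat -[nat_of_pos p]/(nat_of_bin (BinNums.Npos p)) nat_of_binK. Qed.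

Lemma bits_of_natS n : 0 < n -> bits_of_nat n = odd n :: bits_of_nat n./2.
Proof.
move=> n0; have : n = nat_of_bin (bin_of_nat n) by rewrite bin_of_natK.
case: (bin_of_nat n) => [|p] /= E; first by rewrite E in n0.
rewrite E bits_of_nat_pos; case: p {E} => [p|p|] //=.
  by rewrite -(bits_of_nat_pos p) NatTrec.doubleE odd_double uphalf_double.
by rewrite -(bits_of_nat_pos p) NatTrec.doubleE odd_double doubleK.
Qed.

Lemma bits_of_nat_ind (P : nat -> Prop) :
  P 0 -> (forall n, 0 < n -> P n./2 -> P n) -> forall n, P n.
Proof.
move=> P0 PS n; have [m] := ubnP n; elim: m n => // m IH n Hn.
case: (posnP n) => [->//|n0]; apply: PS => //; apply: IH; lia.
Qed.

Fixpoint bits_val (s : seq bool) : nat :=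
  if s is b :: s' then b + (bits_val s').*2 else 0.

Lemma bits_of_natK n : bits_val (bits_of_nat n) = n.
Proof.
elim/bits_of_nat_ind: n => // n n0 IH.
by rewrite bits_of_natS //= IH odd_double_half.
Qed.

(** A digit word is canonical when its most significant digit, the last one, is 1; the default
    [true] admits the empty word, which encodes 0. *)
Lemma bits_valK s : last true s -> bits_of_nat (bits_val s) = s.
Proof.
elim: s => // b s IH /= Hl.
have Hs : last true s by case: s Hl {IH}.
rewrite bits_of_natS; first by rewrite oddD odd_double addbF oddb half_bit_double IH.
case: b Hl => // Hl; case: s IH Hs Hl => // c s IH Hs _.
have := IH Hs; case: (bits_val _) => //= *; lia.
Qed.

Lemma last_bits_of_nat n : last true (bits_of_nat n).
Proof.
elim/bits_of_nat_ind: n => // n n0 IH; rewrite bits_of_natS //=.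
case: n n0 IH => [//|[//|n]] _ IH.
by move: IH; rewrite [n.+2./2]/= bits_of_natS.
Qed.

Lemma size_bits_of_nat n : size (bits_of_nat n) <= n.
Proof.
elim/bits_of_nat_ind: n => // n n0 IH; rewrite bits_of_natS //=; lia.
Qed.

Lemma bits_of_nat_nth n j : nth false (bits_of_nat n) j = odd (iter j half n).
Proof.
elim: j n => [|j IH] n; case: (posnP n) => [->|n0] //.
- by rewrite bits_of_natS.
- by rewrite iterSr -(IH 0) bits_of_nat0 !nth_nil.
- by rewrite bits_of_natS //= IH -iterSr.
Qed.

Lemma iter_half_gt0 n j : (0 < iter j half n) = (j < size (bits_of_nat n)).
Proof.
elim: j n => [|j IH] n; case: (posnP n) => [->|n0] //.
- by rewrite /= bits_of_natS // n0.
- by rewrite iterSr IH.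
- by rewrite bits_of_natS // iterSr IH.
Qed.

(** Written as a count over a range bounded by [n] so as to be definable; a number [n] has at most
    [n] binary digits. *)
Definition nbits n := count (fun j => 0 < iter j half n) (iota 0 n).

Lemma bits_of_natE n :
  bits_of_nat n = mkseq (fun j => odd (iter j half n)) (nbits n).
Proof.
have E : nbits n = size (bits_of_nat n).
  rewrite /nbits (eq_count (iter_half_gt0 n)) count_lt_iota //.
  exact: size_bits_of_nat.
apply: (@eq_from_nth _ false); first by rewrite size_mkseq.
by move=> i Hi; rewrite nth_mkseq ?E // bits_of_nat_nth.
Qed.

(** * Graphs as words *)

(** Adjacency on all numbers, false out of range: expressions handle only numbers, and graphs whose
    orders are not known to agree become comparable. *)
Definition nat_adj (G : graph) (i j : nat) : bool :=
  if insub i is Some u then if insub j is Some v then @adj G u v else false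
  else false.

Lemma nat_adjE (G : graph) (u v : 'I_(n_vert G)) : nat_adj G u v = adj u v.
Proof. by rewrite /nat_adj !valK. Qed.

Definition graph_of n (a : nat -> nat -> bool) (a_sym : symmetric a)
    (a_irr : irreflexive a) : graph :=
  @Graph n (fun u v => a u v) (fun u v => a_sym u v) (fun u => a_irr u).

Lemma nat_adj_graph_of n a a_sym a_irr i j :
  nat_adj (@graph_of n a a_sym a_irr) i j = [&& i < n, j < n & a i j].
Proof.
rewrite /nat_adj; case: insubP => [u -> <-|/negbTE -> //].
by case: insubP => [v -> <-|/negbTE -> //].
Qed.

Lemma nat_adj_sym G : symmetric (nat_adj G).
Proof.
move=> i j; rewrite /nat_adj; case: insubP => [u _ _|_]; case: insubP => // v _ _.
exact: adj_sym.
Qed.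

Lemma nat_adj_irr G : irreflexive (nat_adj G).
Proof.
move=> i; rewrite /nat_adj; case: insubP => // u _ _; exact: adj_irr.
Qed.

Lemma nat_adj_ltn G i j : nat_adj G i j -> (i < n_vert G) && (j < n_vert G).
Proof. by rewrite /nat_adj; case: insubP => // u -> _; case: insubP => // v ->. Qed.

Definition mat_row n (a : nat -> nat -> bool) i : seq (option bool) :=
  rcons (mkseq (fun j => Some (a i j)) n) None.
Definition mat_word n a := flatten (mkseq (mat_row n a) n).

Lemma size_mat_row n a i : size (mat_row n a i) = n.+1.
Proof. by rewrite size_rcons size_mkseq. Qed.

Lemma sumn_map_const (T : Type) (s : seq T) c : sumn [seq c | _ <- s] = size s * c.
Proof. by elim: s => //= _ s ->. Qed.

Lemma size_mat_word n a : size (mat_word n a) = n * n.+1.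
Proof.
rewrite size_flatten /shape /mkseq -map_comp (eq_map (size_mat_row n a)).
by rewrite sumn_map_const size_iota.
Qed.

Lemma nth_flatten_uniform (T : Type) (x0 : T) c ss i j :
  all (fun s => size s == c) ss -> i < size ss -> j < c ->
  nth x0 (flatten ss) (i * c + j) = nth x0 (nth [::] ss i) j.
Proof.
elim: ss i => // s ss IH [|i] /= /andP[/eqP Hs Hss] Hi Hj; rewrite nth_cat Hs.
  by rewrite mul0n add0n Hj.
by rewrite mulSn -addnA ltnNge leq_addr /= addKn IH.
Qed.

Lemma nth_mat_word n a i j : i < n -> j <= n ->
  nth None (mat_word n a) (i * n.+1 + j) = if j == n then None else Some (a i j).
Proof.
move=> Hi Hj; rewrite /mat_word nth_flatten_uniform ?size_mkseq //.
  rewrite nth_mkseq // nth_rcons size_mkseq; case: ltngtP Hj => // Hjn _.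
  by rewrite nth_mkseq.
by rewrite all_map; apply/allP => k _ /=; rewrite size_mat_row.
Qed.

Lemma mat_wordE n a : mat_word n a =
  mkseq (fun p => if p %% n.+1 == n then None
                  else Some (a (p %/ n.+1) (p %% n.+1))) (n * n.+1).
Proof.
apply: (@eq_from_nth _ None); rewrite size_mat_word ?size_mkseq // => p Hp.
rewrite nth_mkseq // {1}(divn_eq p n.+1) nth_mat_word //.
  by rewrite ltn_divLR.
by rewrite -ltnS ltn_mod.
Qed.

(** Each row contributes one separator, so a word reveals the order of its graph before the rows are
    located. *)
Lemma count_None_mat_word n a : count_mem None (mat_word n a) = n.
Proof.
rewrite count_flatten /mkseq -map_comp (@eq_map _ _ _ (fun=> 1)).
  by rewrite sumn_map_const size_iota muln1.
move=> i /=; rewrite /mat_row -cats1 count_cat /= addn1; congr _.+1.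
by rewrite count_map (eq_count (a2 := pred0)) ?count_pred0.
Qed.

Lemma count_None_map_Some (s : seq bool) : count_mem None (map Some s) = 0.
Proof. by elim: s. Qed.

(** The [Some false] after the matrix is the sign bit of a nonnegative number; a negative bound
    never gives a yes-instance. *)
Definition graph_word n a (K : nat) : seq (option bool) :=
  mat_word n a ++ Some false :: map Some (bits_of_nat K).

Lemma map_enum_mkseq (T : Type) n (f : 'I_n -> T) (g : nat -> T) :
  (forall u : 'I_n, f u = g u) -> map f (enum 'I_n) = mkseq g n.
Proof.
by move=> E; rewrite /mkseq -val_enum_ord -map_comp; apply: eq_map.
Qed.

Lemma encode_graph_intE G k : encode_graph_int G k =
  mat_word (n_vert G) (nat_adj G) ++ map Some (bits_of_int k).
Proof.
congr (flatten _ ++ _); apply: map_enum_mkseq => u.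
congr (rcons _ _); apply: map_enum_mkseq => v; by rewrite nat_adjE.
Qed.

Lemma graph_word_inj n a K n' a' K' : graph_word n a K = graph_word n' a' K' ->
  [/\ n = n', K = K' & forall i j, i < n -> j < n -> a i j = a' i j].
Proof.
move=> E; have Hn : n = n'.
  have := congr1 (count_mem None) E.
  by rewrite !count_cat /= !count_None_map_Some !count_None_mat_word !addn0.
subst n'; move/eqP: E; rewrite eqseq_cat ?size_mat_word // => /andP[/eqP Em /eqP[]].
move=> /(inj_map Some_inj) EK; split=> //.
  by rewrite -(bits_of_natK K) EK bits_of_natK.
move=> i j Hi Hj; have := congr1 (fun w => nth None w (i * n.+1 + j)) Em.
by rewrite !nth_mat_word ?(ltnW Hj) // (ltn_eqF Hj) => [[]].
Qed.

(** Final zero blocking sets are known as forts in zero forcing. This boolean form, with predicates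
    on numbers for sets, can be evaluated by expressions. *)
Definition small_fort n (a : nat -> nat -> bool) (K : nat) (S : nat -> bool) :=
  [&& has (fun i => S i) (iota 0 n),
      all (fun i => ~~ S i ==> (count (fun j => S j && a i j) (iota 0 n) != 1))
          (iota 0 n)
    & count (fun i => S i) (iota 0 n) <= K].

Lemma card_ord_count n (P : nat -> bool) :
  #|[set u : 'I_n | P u]| = count P (iota 0 n).
Proof.
rewrite cardsE cardE /enum_mem size_filter -enumT -val_enum_ord count_map.
exact: eq_count.
Qed.

Lemma small_fortP G K :
  (exists W : {set 'I_(n_vert G)}, final_zero_blocking W /\ #|W| <= K) <->
  exists S, small_fort (n_vert G) (nat_adj G) K S.
Proof.
split=> [[W [[W0 HW] HK]]|[S /and3P[S0 /allP HS HK]]].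
  pose S i := if insub i is Some u then u \in W else false.
  have ES (u : 'I_(n_vert G)) : S u = (u \in W) by rewrite /S valK.
  exists S; apply/and3P; split.
  - case/set0Pn: W0 => u Hu; apply/hasP; exists (val u); last by rewrite ES.
    by rewrite mem_iota /=.
  - apply/allP => i; rewrite mem_iota /= add0n => Hi.
    apply/implyP; rewrite -[i]/(val (Ordinal Hi)) ES => /HW /eqP.
    rewrite -card_ord_count; congr (_ != _); apply: eq_card => u.
    by rewrite !inE ES nat_adjE.
  - rewrite -card_ord_count; move: HK; congr (_ <= _).
    by apply: eq_card => u; rewrite !inE ES.
exists [set u : 'I_(n_vert G) | S u]; split; last by rewrite card_ord_count.
split=> [|u].
  case/hasP: S0 => i; rewrite mem_iota /= add0n => Hi Si.
  by apply/set0Pn; exists (Ordinal Hi); rewrite inE.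
rewrite inE => Su; have := HS u; rewrite mem_iota /= add0n ltn_ord => /(_ isT).
rewrite Su /= -card_ord_count => /eqP; congr (_ <> _); apply: eq_card => v.
by rewrite !inE nat_adjE.
Qed.

Lemma yes_languageP (C : graph -> Prop) w :
  yes_language (P := final_zero_blocking_problem C) w <->
  exists G K, [/\ C G, w = graph_word (n_vert G) (nat_adj G) K &
    exists S, small_fort (n_vert G) (nat_adj G) K S].
Proof.
split=> [[[[G CG] k] /= [<- [W [HW]]]]|[G [K [CG -> HS]]]].
  case: k => // K; rewrite lez_nat => HK; exists G, K; split=> //.
    by rewrite encode_graph_intE.
  by apply/small_fortP; exists W.
exists (exist _ G CG, Posz K); split=> /=; first by rewrite encode_graph_intE.
by have [W [HW HK]] := (small_fortP G K).2 HS; exists W.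
Qed.

(** * Membership in NP *)

(** The leading 0 answers the letter code 0 of positions beyond the input. *)
Definition letter_table (A : finType) (g : A -> nat) : seq nat := 0 :: map g (enum A).

Lemma nth_letter_table (A : finType) (g : A -> nat) x i :
  nth 0 (letter_table g) (letter_at x i) = nth 0 (map g x) i.
Proof.
rewrite /letter_at; case: (ltnP i (size x)) => Hi; last first.
  by rewrite ![nth 0 (map _ _) i]nth_default ?size_map.
have a0 : A by case: x Hi.
rewrite !(nth_map a0) // /code /= (nth_map a0) ?nth_enum_rank //.
by rewrite -cardE.
Qed.

Lemma def_nth_map (A : finType) (g : A -> nat) f : definable f ->
  definable (fun x v => nth 0 (map g x) (f x v)).
Proof.
move=> Hf; apply: def_ext (def_table (letter_table g) (def_letter_at Hf)) => x v.
exact: nth_letter_table.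
Qed.

Section Verifier.

Notation W := (seq (option bool + bool)%type).

(** The code 0 is kept for certificate letters and for positions beyond the word. *)
Definition cell_code (o : option bool) : nat :=
  match o with None => 1 | Some false => 2 | Some true => 3 end.
Definition graph_part (a : (option bool + bool)%type) : nat :=
  if a is inl o then cell_code o else 0.
Definition cert_part (a : (option bool + bool)%type) : nat :=
  if a is inr true then 1 else 0.

Definition cell (w : W) i := nth 0 (map graph_part w) i.
Definition glen (w : W) := count (fun i => cell w i != 0) (iota 0 (size w)).
Definition order (w : W) := count (fun i => cell w i == 1) (iota 0 (size w)).
Definition edge (w : W) i j :=
  [&& i < order w, j < order w & cell w (i * (order w).+1 + j) == 3].
Definition cert (w : W) i := nth 0 (map cert_part w) (glen w + i) == 1.
(* The number [k], truncated at the number of vertices. *)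
Definition budget (w : W) := capped_iter (order w)
  (fun i acc => acc * 2 + (cell w ((glen w).-1 - i) == 3))
  (glen w - (order w * (order w).+1).+1) 0.

Lemma def_cell f : definable f -> definable (fun w v => cell w (f w v)).
Proof. exact: def_nth_map. Qed.

Lemma def_glen : definable (fun w _ => glen w).
Proof.
apply: def_count; first exact: def_len.
exact: def_not (def_eq (def_cell (def_var _ 0)) (def_const _ 0)).
Qed.

Lemma def_order : definable (fun w _ => order w).
Proof.
apply: def_count; first exact: def_len.
exact: def_eq (def_cell (def_var _ 0)) (def_const _ 1).
Qed.

Ltac definability_hook ::= lazymatch goal with
  | |- definable (fun w v => glen _) => apply: def_glen
  | |- definable (fun w v => order _) => apply: def_order
  | |- definable (fun w v => cell _ _) => apply: def_cell
  end.

Lemma def_edge f g : definable f -> definable g ->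
  definable (fun w v => edge w (f w v) (g w v) : nat).
Proof.
move=> Hf Hg; apply: (def_call2 (F := fun w i j => edge w i j : nat)) Hf Hg.
by rewrite /edge; definability.
Qed.

Lemma def_cert f : definable f -> definable (fun w v => cert w (f w v) : nat).
Proof.
move=> Hf; apply: def_eq; last exact: def_const.
apply: def_nth_map; definability.
Qed.

Lemma def_budget : definable (fun w _ => budget w).
Proof. by apply: def_iter; definability. Qed.

Ltac definability_hook ::= lazymatch goal with
  | |- definable (fun w v => glen _) => apply: def_glen
  | |- definable (fun w v => order _) => apply: def_order
  | |- definable (fun w v => budget _) => apply: def_budget
  | |- definable (fun w v => cell _ _) => apply: def_cell
  | |- definable (fun w v => nat_of_bool (edge _ _ _)) => apply: def_edge
  | |- definable (fun w v => nat_of_bool (cert _ _)) => apply: def_cert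
  end.

Variable C : graph -> Prop.
Variable chk : nat -> (nat -> nat -> bool) -> (nat -> bool) -> bool.
Hypothesis def_chk :
  definable (fun w _ => chk (order w) (edge w) (fun z => cert w (order w + z)) : nat).
Hypothesis chk_sound : forall G Y, chk (n_vert G) (nat_adj G) Y -> C G.
(** The fourth power is what chordality asks for: one bit for each triple [u], [v], [w] and each
    vertex. *)
Hypothesis chk_complete : forall G, C G -> exists2 Y,
  chk (n_vert G) (nat_adj G) Y & forall z, n_vert G ^ 4 <= z -> Y z = false.

(** The yes language contains only encodings, so every condition before the last two serves to
    recognise one: a matrix with its separators in place, symmetry, irreflexivity, a nonnegative
    sign, digits free of separators, and a nonzero most significant digit. *)
Definition verify (w : W) : bool :=
  [&& order w * (order w).+1 < glen w,
      all (fun i => all (fun j =>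
          if j == order w then cell w (i * (order w).+1 + j) == 1
          else 1 < cell w (i * (order w).+1 + j)) (iota 0 (order w).+1))
        (iota 0 (order w)),
      all (fun i => all (fun j => edge w i j == edge w j i) (iota 0 (order w)))
        (iota 0 (order w)),
      all (fun i => ~~ edge w i i) (iota 0 (order w)),
      cell w (order w * (order w).+1) == 2,
      all (fun p => (order w * (order w).+1 < p) ==> (1 < cell w p))
        (iota 0 (glen w)),
      (glen w == (order w * (order w).+1).+1) || (cell w (glen w).-1 == 3),
      small_fort (order w) (edge w) (budget w) (cert w)
    & chk (order w) (edge w) (fun z => cert w (order w + z))].

Lemma verify_polytime : polytime (fun w => [:: verify w]).
Proof.
apply: (@definable_polytime _ _ [:: false; true] false _ (fun=> 1)
  (fun w _ => verify w)).
- exact: def_const.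
- rewrite /verify /small_fort; definability.
- by move=> w; case: (verify w).
Qed.

Section Pair.
Variables (x : seq (option bool)) (y : seq bool).
Let w := pair_word x y.

Lemma map_graph_part : map graph_part w = map cell_code x ++ nseq (size y) 0.
Proof.
rewrite map_cat -!map_comp; congr (_ ++ _).
by elim: y => //= b y' ->.
Qed.

Lemma cell_pair i : cell w i = nth 0 (map cell_code x) i.
Proof.
rewrite /cell map_graph_part nth_cat; case: ifP => // Hi.
rewrite nth_nseq [RHS]nth_default; first by case: ifP.
by rewrite leqNgt Hi.
Qed.

Lemma cell_code_gt0 o : 0 < cell_code o. Proof. by case: o => [[]|]. Qed.

Lemma glen_pair : glen w = size x.
Proof.
rewrite /glen (@eq_count _ _ (fun i => i < size x)).
  by rewrite count_lt_iota // size_cat !size_map leq_addr.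
move=> i; rewrite cell_pair; case: (ltnP i (size x)) => Hi.
  by rewrite (nth_map None) // -lt0n cell_code_gt0.
by rewrite nth_default ?size_map.
Qed.

Lemma order_pair : order w = count_mem None x.
Proof.
rewrite /order /cell; have -> : size w = size (map graph_part w) by rewrite size_map.
rewrite -(count_map (nth 0 (map graph_part w)) (pred1 1)) -/(mkseq _ _) mkseq_nth.
rewrite map_graph_part count_cat count_nseq /= mul0n addn0 count_map.
by apply: eq_count => [[[]|]].
Qed.

Lemma cert_pair i : cert w i = nth false y i.
Proof.
rewrite /cert glen_pair map_cat -!map_comp nth_cat size_map ltnNge leq_addr /= addKn.
elim: y i => [|b y' IH] [|i] //=; by case: b.
Qed.

End Pair.

(** Horner's scheme from the most significant digit. Truncating in every round amounts to truncating
    once at the end, since doubling a value that has reached the cap does not bring it below the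
    cap. *)
Lemma budget_bits (w : W) (bs : seq bool) :
  let m := (order w * (order w).+1).+1 in
  glen w = m + size bs ->
  (forall i, i < size bs -> (cell w (m + i) == 3) = nth false bs i) ->
  budget w = minn (bits_val bs) (order w).
Proof.
move=> m Eg Ec; rewrite /budget -/m Eg addKn.
suff H i : i <= size bs -> capped_iter (order w)
   (fun i acc => acc * 2 + (cell w ((m + size bs).-1 - i) == 3)) i 0 =
   minn (bits_val (drop (size bs - i) bs)) (order w).
  by rewrite H // subnn drop0.
elim: i => [|i IH] Hi /=; first by rewrite subn0 drop_size.
have -> : (m + size bs).-1 - i = m + (size bs - i.+1) by rewrite /m; lia.
rewrite IH ?(ltnW Hi) // Ec; last by lia.
rewrite (drop_nth false (n := size bs - i.+1)); last by lia.
by rewrite subnSK //=; lia.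
Qed.

Lemma small_fort_ext n a K S S' : (forall i, i < n -> S i = S' i) ->
  small_fort n a K S = small_fort n a K S'.
Proof.
move=> E; have E' : {in iota 0 n, S =1 S'} by move=> i; rewrite mem_iota => /E.
rewrite /small_fort (eq_in_has E') (eq_in_count E'); congr [&& _, _ & _].
apply: eq_in_all => i Hi; rewrite E' //; congr (_ ==> (_ != _)).
by apply: eq_in_count => j Hj; rewrite E'.
Qed.

(** No set of vertices has more than [n] elements; this justifies the truncated [budget]. *)
Lemma small_fort_min n a K S : small_fort n a (minn K n) S = small_fort n a K S.
Proof.
rewrite /small_fort leq_min.
by have := count_size S (iota 0 n); rewrite size_iota => ->; rewrite andbT.
Qed.

Lemma verify_complete x : yes_language (P := final_zero_blocking_problem C) x ->
  exists2 y, size y <= count_mem None x + count_mem None x ^ 4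
    & verify (pair_word x y).
Proof.
move=> /yes_languageP[G [K [CG Ex [S HS]]]].
have [Y HY Y0] := chk_complete CG; set n := n_vert G in HY Y0 Ex HS.
have Hn : count_mem None x = n.
  by rewrite Ex count_cat /= count_None_map_Some count_None_mat_word !addn0.
pose y := mkseq (fun i => if i < n then S i else Y (i - n)) (n + n ^ 4).
exists y; first by rewrite size_mkseq Hn.
set w := pair_word x y.
have Eo : order w = n by rewrite order_pair.
have Eg : glen w = (n * n.+1).+1 + size (bits_of_nat K).
  by rewrite glen_pair Ex size_cat /= size_map size_mat_word addnS addSn.
have Em i j : i < n -> j <= n ->
    cell w (i * n.+1 + j) = cell_code (if j == n then None else Some (nat_adj G i j)).
  move=> Hi Hj; have H : i * n.+1 + j < n * n.+1 by nia.
  rewrite cell_pair (nth_map None) Ex; last first.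
    by rewrite size_cat size_mat_word; apply: leq_trans H (leq_addr _ _).
  by rewrite nth_cat size_mat_word H nth_mat_word.
have Ee : edge w = nat_adj G.
  apply: functional_extensionality => i; apply: functional_extensionality => j.
  rewrite /edge Eo; case: (ltnP i n) => Hi; last first.
    by apply/esym/negbTE; apply: contraL Hi => /nat_adj_ltn/andP[+ _]; rewrite -ltnNge.
  case: (ltnP j n) => Hj; last first.
    by apply/esym/negbTE; apply: contraL Hj => /nat_adj_ltn/andP[_]; rewrite -ltnNge.
  by rewrite Em ?(ltnW Hj) // (ltn_eqF Hj); case: (nat_adj G i j).
have Eb i : i < size (bits_of_nat K) ->
    cell w ((n * n.+1).+1 + i) = cell_code (Some (nth false (bits_of_nat K) i)).
  move=> Hi; rewrite cell_pair Ex map_cat nth_cat size_map size_mat_word addSn.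
  rewrite ltnNge (leq_trans (leq_addr i _) (leqnSn _)) /= subSn ?leq_addr // addKn /=.
  by rewrite -map_comp (nth_map false).
have EB : budget w = minn K n.
  rewrite (@budget_bits _ (bits_of_nat K)) Eo ?bits_of_natK // => i Hi.
  by rewrite Eb //; case: (nth _ _ _).
have Ec1 i : i < n -> cert w i = S i.
  by move=> Hi; rewrite cert_pair nth_mkseq ?Hi // ltn_addr.
have Ec2 : (fun z => cert w (n + z)) = Y.
  apply: functional_extensionality => z; rewrite cert_pair.
  case: (ltnP z (n ^ 4)) => Hz.
    by rewrite nth_mkseq ?ltn_add2l // ltnNge leq_addr /= addKn.
  by rewrite nth_default ?Y0 // size_mkseq leq_add2l.
rewrite /verify Eo Ee EB Ec2 small_fort_min (small_fort_ext _ _ Ec1) HS HY Eg.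
rewrite ltnS leq_addr; apply/and5P; split=> //.
- apply/allP => i; rewrite mem_iota add0n => /andP[_ Hi].
  apply/allP => j; rewrite mem_iota add0n ltnS => /andP[_ Hj].
  by rewrite Em //; case: eqP => //; case: (nat_adj G i j).
- by apply/allP => i _; apply/allP => j _; rewrite nat_adj_sym.
- by apply/allP => i _; rewrite nat_adj_irr.
- apply/and5P; split=> //.
    by rewrite cell_pair Ex map_cat nth_cat size_map size_mat_word ltnn subnn.
    apply/allP => p; rewrite mem_iota /= add0n => Hp; apply/implyP => Hm.
    rewrite -(subnKC Hm) Eb; first by case: (nth _ _ _).
    by lia.
  rewrite -[X in _ == X]addn0 eqn_add2l size_eq0.
  case: (posnP K) => [->//|K0]; apply/orP; right.
  have s0 : 0 < size (bits_of_nat K) by rewrite bits_of_natS.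
  have -> : ((n * n.+1).+1 + size (bits_of_nat K)).-1 =
     (n * n.+1).+1 + (size (bits_of_nat K)).-1 by lia.
  rewrite Eb; last by lia.
  have := last_bits_of_nat K; rewrite (last_nth false).
  by case: (bits_of_nat K) s0 => //= b s _ ->.
Qed.

(** The graph is read off [edge w] and the number off the trailing digits; the main point is that
    encoding them again gives back exactly [x]. *)
Lemma verify_sound x y : verify (pair_word x y) ->
  yes_language (P := final_zero_blocking_problem C) x.
Proof.
set w := pair_word x y => /and5P[Hg Hm Hs Hi /and5P[Hsg Hb Hl HS Hc]].
set n := order w in Hg Hm Hs Hi Hsg Hb Hl HS Hc.
have Ec i : i < size x -> cell w i = cell_code (nth None x i).
  by move=> H; rewrite cell_pair (nth_map None).
have Eg : glen w = size x := glen_pair x y.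
rewrite Eg in Hg Hb Hl; set m := n * n.+1 in Hg Hsg Hb Hl.
pose bs := map (fun o => o == Some true) (drop m.+1 x).
have sb : size bs = size x - m.+1 by rewrite size_map size_drop.
have e_sym : symmetric (edge w).
  move=> i j; case: (boolP ((i < n) && (j < n))) => [/andP[Hi' Hj']|].
    have /allP/(_ i) := Hs; rewrite mem_iota => /(_ Hi') /allP/(_ j).
    by rewrite mem_iota => /(_ Hj') /eqP.
  by rewrite /edge -/n; case: (i < n); case: (j < n).
have e_irr : irreflexive (edge w).
  move=> i; case: (ltnP i n) => Hi'.
    have /allP/(_ i) := Hi; rewrite mem_iota => /(_ Hi'); exact: negbTE.
  by rewrite /edge -/n ltnNge Hi'.
have Ebs i : i < size bs -> nth None x (m.+1 + i) = Some (nth false bs i).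
  rewrite sb => Hi'; rewrite (nth_map None) ?size_drop // nth_drop.
  have /allP/(_ (m.+1 + i)) := Hb; rewrite mem_iota /= => /(_ _)/implyP.
  have Hlt : m.+1 + i < size x by lia.
  rewrite Ec // => /(_ Hlt (leq_addr _ _)).
  by case: (nth _ _ _) => [[]|].
have Ex : x = graph_word n (edge w) (bits_val bs).
  rewrite /graph_word bits_valK; last first.
    case/orP: Hl => [/eqP Hl|Hl].
      by rewrite /bs drop_oversize // Hl.
    case: (posnP (size bs)) => [/size0nil -> //|Hb0].
    rewrite (last_nth false).
    have -> : nth false (true :: bs) (size bs) = nth false bs (size bs).-1.
      by rewrite -{1}(prednK Hb0).
    have := Ebs (size bs).-1; rewrite prednK // => /(_ (leqnn _)).
    have -> : m.+1 + (size bs).-1 = (size x).-1 by lia.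
    move: Hl; rewrite Ec; last by lia.
    by case: (nth None x _) => [[]|] // _ [<-].
  rewrite -[LHS](cat_take_drop m); congr (_ ++ _).
    rewrite mat_wordE; apply: (@eq_from_nth _ None).
      by rewrite size_takel ?size_mkseq // ltnW.
    rewrite size_takel ?(ltnW Hg) // => p Hp; rewrite nth_take // nth_mkseq //.
    have Hq : p %/ n.+1 < n by rewrite ltn_divLR.
    have Hr : p %% n.+1 < n.+1 by rewrite ltn_mod.
    have /allP/(_ (p %/ n.+1)) := Hm; rewrite mem_iota => /(_ Hq) /allP.
    move=> /(_ (p %% n.+1)); rewrite (mem_iota 0 n.+1) => /(_ Hr).
    rewrite /edge -/n Hq; move: Hr; rewrite ltnS leq_eqVlt.
    rewrite -divn_eq Ec; last exact: leq_ltn_trans (ltnW Hp) Hg.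
    case: eqP => [_ _|_ /= ->]; by case: (nth None x p) => [[]|].
  rewrite (drop_nth None) //; congr (_ :: _).
    by move: Hsg; rewrite Ec //; case: (nth _ _ _) => [[]|].
  apply: (@eq_from_nth _ None); first by rewrite size_drop size_map sb.
  move=> i; rewrite size_drop -sb => Hi'.
  by rewrite nth_drop Ebs // (nth_map false).
apply/yes_languageP; pose G := graph_of n e_sym e_irr.
have EG : nat_adj G = edge w.
  apply: functional_extensionality => i; apply: functional_extensionality => j.
  by rewrite nat_adj_graph_of /edge -/n; case: (i < n); case: (j < n).
exists G, (bits_val bs); rewrite /= EG; split=> //.
  by apply: (chk_sound (Y := fun z => cert w (n + z))); rewrite EG.
exists (cert w); rewrite -small_fort_min.
suff <- : budget w = minn (bits_val bs) n by [].
apply: budget_bits; first by rewrite Eg sb -/n -/m; lia.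
move=> i Hi'; rewrite -/n -/m Ec; last by lia.
by rewrite Ebs //; case: (nth _ _ _).
Qed.

Theorem final_zero_blocking_in_NP :
  in_NP (yes_language (P := final_zero_blocking_problem C)).
Proof.
exists verify, ('X + 'X^4)%R; split; first exact: verify_polytime.
move=> x; split; last by move=> [y [_ /verify_sound]].
move=> /verify_complete [y Hy Hv]; exists y; split=> //.
rewrite hornerD hornerX hornerXn; apply: leq_trans Hy _.
have H := count_size (pred1 None) x.
by apply: leq_add => //; rewrite leq_exp2r.
Qed.

End Verifier.

(** * Certificates for bipartite and chordal graphs *)

Ltac definability_hook ::= lazymatch goal with
  | |- definable (fun w v => order _) => apply: def_order
  | |- definable (fun w v => nat_of_bool (edge _ _ _)) => apply: def_edge
  | |- definable (fun w v => nat_of_bool (cert _ _)) => apply: def_cert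
  end.

Lemma all_iotaP n (P : nat -> bool) :
  reflect (forall u : 'I_n, P u) (all P (iota 0 n)).
Proof.
apply: (iffP allP) => H; first by move=> u; apply: H; rewrite mem_iota /=.
by move=> i; rewrite mem_iota /= add0n => Hi; apply: (H (Ordinal Hi)).
Qed.

Lemma leq_self_expn4 n : n <= n ^ 4.
Proof. by case: n => // n; rewrite -{1}(expn1 n.+1) leq_pexp2l. Qed.

Definition bipartite_check n (a : nat -> nat -> bool) (Y : nat -> bool) :=
  all (fun i => all (fun j => a i j ==> (Y i != Y j)) (iota 0 n)) (iota 0 n).

Theorem bipartite_in_NP :
  in_NP (yes_language (P := final_zero_blocking_problem bipartite)).
Proof.
apply: (@final_zero_blocking_in_NP _ bipartite_check).
- by rewrite /bipartite_check; definability.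
- move=> G Y /all_iotaP HY; exists [set u : 'I_(n_vert G) | Y u] => u v.
  have /all_iotaP/(_ v) := HY u; rewrite nat_adjE !inE; exact: implyP.
- move=> G [X HX]; pose Y i := if insub i is Some u then u \in X else false.
  have EY (u : 'I_(n_vert G)) : Y u = (u \in X) by rewrite /Y valK.
  exists Y.
    apply/all_iotaP => u; apply/all_iotaP => v; rewrite nat_adjE !EY.
    by apply/implyP; apply: HX.
  move=> z Hz; rewrite /Y insubF //; apply/negbTE.
  by rewrite -leqNgt; apply: leq_trans Hz; apply: leq_self_expn4.
Qed.

Lemma next_nth_uniq (T : eqType) (x0 : T) c i : uniq c -> i < size c ->
  next c (nth x0 c i) = nth x0 c (if i.+1 == size c then 0 else i.+1).
Proof.
move=> Hu Hi; rewrite next_nth mem_nth // index_uniq //.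
case: c Hu Hi => // y p Hu /= Hi; rewrite eqSS; case: eqP => [->|Hn].
  by rewrite nth_default.
by apply: set_nth_default; move: Hi; rewrite ltnS leq_eqVlt; case: eqP.
Qed.

(* Chordality amounts to: for every induced path u - v - w, deleting the
   closed neighbourhood of v other than u and w separates u from w.  The
   component of u is the certificate. *)
Definition off_path (G : graph) (u v w q : 'I_(n_vert G)) : bool :=
  [|| q == u, q == w | (q != v) && ~~ adj v q].

Definition detour (G : graph) (u v w : 'I_(n_vert G)) : rel 'I_(n_vert G) :=
  [rel p q | adj p q && off_path u v w q].

(** A shortest detour closes up with [v] to a cycle of length at least 4. A chord at [v] would end
    in a vertex that [off_path] forbids, and any other chord would shorten the detour. *)
Lemma chordal_no_detour (G : graph) (u v w : 'I_(n_vert G)) :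
  chordal G -> adj u v -> adj v w -> ~~ adj u w -> u != w ->
  ~~ connect (detour u v w) u w.
Proof.
move=> HG uv vw uw u_w.
pose ok := off_path u v w; pose e := detour u v w.
apply/negP => /connectP [p0 Hp0 Ep0].
pose Q k := [exists t : k.-tuple 'I_(n_vert G), path e u t && (last u t == w)].
have QP p : path e u p -> last u p = w -> Q (size p).
  by move=> H1 H2; apply/existsP; exists (in_tuple p); rewrite /= H1 H2 eqxx.
have exQ : exists k, Q k by exists (size p0); apply: QP.
have [k /existsP[t /andP[Ht /eqP Et]] Hk] := ex_minnP exQ.
have Hmin p : path e u p -> last u p = w -> k <= size p.
  by move=> H1 H2; apply: Hk; apply: QP.
have [p [Hp Hu sp Ep]] : exists p, [/\ path e u p, uniq (u :: p), size p <= k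
    & last u p = w].
  case: (shortenP Ht) (Et) => p Hp Hu Hs Ep; exists p; split=> //.
  by rewrite -(size_tuple t); apply: uniq_leq_size => //; case/andP: Hu.
have {}Hmin q : path e u q -> last u q = w -> size p <= size q.
  by move=> H1 H2; apply: leq_trans sp (Hmin _ H1 H2).
have u_v : u != v by apply: contraTneq uv => ->; rewrite adj_irr.
have v_w : v != w by apply: contraTneq vw => ->; rewrite adj_irr.
have okp : all ok (u :: p).
  rewrite /= {1}/ok {1}/off_path eqxx /=; move: {Hu sp Ep Hmin}p {1}u Hp.
  by elim=> //= b p IH a /andP[/andP[_ Hb] /IH ->]; rewrite andbT.
have v_p : v \notin u :: p.
  apply/negP => /(allP okp); rewrite /ok /off_path eqxx /= orbF => /orP[]/eqP E.
    by rewrite E eqxx in u_v.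
  by rewrite E eqxx in v_w.
have adjp : path (@adj G) u p by apply: sub_path Hp => a b /andP[].
have sp2 : 1 < size p.
  case: p Hp Ep {Hu sp Hmin okp v_p adjp} => [|a [|b p]] //= => [_ E|/andP[/andP[ua _] _] E].
    by rewrite E eqxx in u_w.
  by rewrite -E ua in uw.
pose c := v :: u :: p.
have Hc : uniq c by rewrite /c [uniq _]/= v_p.
have Hcyc : ucycle (@adj G) c.
  apply/andP; split=> //=; rewrite adj_sym uv /= rcons_path adjp Ep /=.
  by rewrite adj_sym.
have [x [y [xc yc xy yx' xy']]] := HG c sp2 Hcyc.
have nx i : i < size c -> next c (nth v c i) =
  nth v c (if i.+1 == size c then 0 else i.+1) by apply: next_nth_uniq.
have Ew : nth v c (size c).-1 = w by rewrite nth_last -Ep.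
(* The chord is described by its positions on the cycle, taken in increasing order; they are neither
   consecutive nor the first and the last. *)
suff key i j : i < j -> j < size c -> adj (nth v c i) (nth v c j) ->
    j != i.+1 -> ~~ ((i == 0) && (j.+1 == size c)) -> False.
  have Ex := nth_index v xc; have Ey := nth_index v yc.
  have ix : index x c < size c by rewrite index_mem.
  have iy : index y c < size c by rewrite index_mem.
  case: (ltngtP (index x c) (index y c)) => H.
  - apply: (key _ _ H iy); rewrite ?Ex ?Ey //.
      apply: contra yx' => /eqP E; rewrite -[in next c x]Ex nx // -{1}Ey E.
      by rewrite -E (ltn_eqF iy).
    apply: contra xy' => /andP[/eqP E1 /eqP E2].
    by rewrite -[in next c y]Ey nx // E2 eqxx -{1}Ex E1.
  - apply: (key _ _ H ix); rewrite ?Ex ?Ey // 1?adj_sym //.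
      apply: contra xy' => /eqP E; rewrite -[in next c y]Ey nx // -{1}Ex E.
      by rewrite -E (ltn_eqF ix).
    apply: contra yx' => /andP[/eqP E1 /eqP E2].
    by rewrite -[in next c x]Ex nx // E2 eqxx -{1}Ey E1.
  - by move: xy; rewrite -Ex H Ey adj_irr.
case: i => [|i] ij jc aij ji; last move=> _.
  case: j ij jc aij ji => // j _ jc aij ji /= jN.
  have Hj : nth v (u :: p) j \in u :: p by apply: mem_nth.
  have := allP okp _ Hj; rewrite /ok /off_path [in ~~ adj _ _]aij andbF orbF.
  have Hup : uniq (u :: p) by [].
  case/orP=> /eqP E.
    by move: E; rewrite -[in RHS]/(nth v (u :: p) 0) => /eqP; rewrite nth_uniq // => /eqP E; rewrite E in ji.
  move: E; rewrite -{}Ep (last_nth v) => /eqP; rewrite nth_uniq // => /eqP E.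
  by rewrite E eqxx in jN.
case: j ij jc aij ji => // [[//|j]] ij jc aij ji.
have Hi : i < j by move: ij ji; clear; lia.
have Hj : j < size p by [].
have Hip : i <= size p by apply: ltnW (ltn_trans Hi Hj).
have Ei : last u (take i p) = nth v (u :: p) i.
  rewrite (last_nth v) size_takel //.
  by case: i {ij aij ji Hip} Hi => // i Hi /=; rewrite nth_take.
have := Hmin (take i p ++ drop j p).
rewrite cat_path take_path // Ei (drop_nth v Hj) /= last_cat /=.
have -> : last (nth v p j) (drop j.+1 p) = w.
  rewrite -Ep -[in RHS](cat_take_drop j p) last_cat (drop_nth v Hj) //.
have -> : path e (nth v p j) (drop j.+1 p).
  move: Hp; rewrite -{1}(cat_take_drop j p) cat_path (drop_nth v Hj) /=.
  by case/and3P.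
have -> : e (nth v (u :: p) i) (nth v p j).
  rewrite /e /detour /= [adj _ _]aij.
  by apply: (allP okp); rewrite inE mem_nth ?orbT.
move=> /(_ isT erefl).
rewrite size_cat /= size_takel // size_drop; move: Hi Hj; clear; lia.
Qed.

(** On a chordless cycle the only neighbours of [v] are [u] and [w], so the stretch from [u] to [w]
    that avoids [v] is a detour, and [S] would propagate along it to [w]. *)
Lemma no_detour_chordal (G : graph) :
  (forall u v w : 'I_(n_vert G), adj u v -> adj v w -> ~~ adj u w -> u != w ->
    exists S : pred 'I_(n_vert G), [/\ S u, ~~ S w &
      forall p q, S p -> adj p q -> off_path u v w q -> S q]) ->
  chordal G.
Proof.
move=> H c c4 /andP[Hcyc Hc].
case: (boolP [exists x, exists y, [&& x \in c, y \in c, adj x y, y != next c x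
  & x != next c y]]) => [/existsP[x /existsP[y /and5P[*]]]|no_chord].
  by exists x, y.
have {no_chord}nc x y : x \in c -> y \in c -> adj x y ->
    (y == next c x) || (x == next c y).
  move=> xc yc xy; apply: contraR no_chord; rewrite negb_or => /andP[h1 h2].
  by apply/existsP; exists x; apply/existsP; exists y; apply/and5P.
case: c c4 Hcyc Hc nc => // v [//|u s] s2 Hcyc Hc nc; exfalso.
set c := v :: u :: s in Hc nc s2.
have nx i : i < size c -> next c (nth v c i) =
  nth v c (if i.+1 == size c then 0 else i.+1) by apply: next_nth_uniq.
move: Hcyc; rewrite /= rcons_path => /and3P[vu Hp wv].
set w := last u s in wv.
have Ew : w = nth v c (size s).+1 by rewrite /w (last_nth v).
have n_v : next c v = u by exact: (nx 0 isT).
have n_w : next c w = v by rewrite Ew nx //= eqxx.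
have s1 : 1 < size s by [].
have sc : size c = (size s).+2 by [].
have n_u : next c u = nth v s 0.
  by have := nx 1 isT; rewrite sc !eqSS [0 == _]ltn_eqF // ltnW.
have wc : w \in c by rewrite Ew mem_nth.
have uc : u \in c by rewrite !inE eqxx orbT.
have vc : v \in c by rewrite !inE eqxx.
have w_u : w != u.
  by rewrite Ew -[u]/(nth v c 1) nth_uniq //; case: (size s) s1.
have w_v : w != v.
  by rewrite Ew; change (nth v c (size s).+1 != nth v c 0); rewrite nth_uniq.
have u_v : u != v by change (nth v c 1 != nth v c 0); rewrite nth_uniq.
have [||||S [Su Sw HS]] := H u v w.
- by rewrite adj_sym.
- by rewrite adj_sym.
- apply/negP => /(nc _ _ uc wc); rewrite n_u n_w (negbTE u_v) orbF.
  rewrite Ew -[nth v s 0]/(nth v c 2) nth_uniq //; first by case: (size s) s1 => [|[]].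
  by rewrite /c /= !ltnS; apply: ltnW.
- by rewrite eq_sym.
case/negP: Sw; rewrite /w.
have Hs : {subset s <= c} by move=> q Hq; rewrite !inE Hq !orbT.
have vs : v \notin s by move: Hc; rewrite /c /= inE negb_or => /andP[/andP[]].
have off q : q \in s -> off_path u v w q.
  move=> qs; rewrite /off_path; case: (boolP (adj v q)) => vq /=.
    have := nc _ _ vc (Hs _ qs) vq; rewrite n_v => /orP[->//|/eqP E].
    suff -> : q = w by rewrite eqxx orbT.
    by rewrite -(prev_next Hc q) -E -n_w prev_next.
  by rewrite andbT; apply/or3P/Or33; apply: contraNneq vs => <-.
have along a q : path (@adj G) a q -> S a -> (forall b, b \in q -> off_path u v w b) ->
    S (last a q).
  elim: q a => //= b q IH a /andP[ab Hq] Sa off_q; apply: IH => //.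
    by apply: HS Sa ab _; apply: off_q; rewrite inE eqxx.
  by move=> d Hd; apply: off_q; rewrite inE Hd orbT.
exact: along.
Qed.

(** The sets for all triples share one bit string: the digits [u], [v], [w], [q] in radix [n] give
    the position of the bit for [q] in the set for the path u - v - w. *)
Definition chordal_check n (a : nat -> nat -> bool) (Y : nat -> bool) :=
  all (fun u => all (fun v => all (fun w =>
    [&& a u v, a v w, ~~ a u w & u != w] ==>
    [&& Y (((u * n + v) * n + w) * n + u), ~~ Y (((u * n + v) * n + w) * n + w)
      & all (fun p => all (fun q =>
          [&& Y (((u * n + v) * n + w) * n + p), a p q
            & [|| q == u, q == w | (q != v) && ~~ a v q]] ==>
          Y (((u * n + v) * n + w) * n + q)) (iota 0 n)) (iota 0 n)])
  (iota 0 n)) (iota 0 n)) (iota 0 n).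

Theorem chordal_in_NP :
  in_NP (yes_language (P := final_zero_blocking_problem chordal)).
Proof.
apply: (@final_zero_blocking_in_NP _ chordal_check).
- by rewrite /chordal_check; definability.
- move=> G Y /all_iotaP HY; apply: no_detour_chordal => u v w uv vw uw u_w.
  have /all_iotaP/(_ v)/all_iotaP/(_ w) := HY u.
  rewrite !nat_adjE uv vw uw val_eqE u_w /= => /and3P[Yu Yw /all_iotaP H].
  exists (fun q : 'I_(n_vert G) => Y (((u * n_vert G + v) * n_vert G + w) * n_vert G + q)).
  split=> // p q Yp pq Hq; have /all_iotaP/(_ q) := H p.
  by rewrite !nat_adjE !val_eqE Yp pq -/(off_path u v w q) Hq.
- move=> G HG; set n := n_vert G.
  pose S i j k l := if (insub i, insub j, insub k, insub l) is
    (Some u, Some v, Some w, Some q) then connect (@detour G u v w) u q else false.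
  have ES (u v w q : 'I_n) : S u v w q = connect (@detour G u v w) u q.
    by rewrite /S !valK.
  pose Y z := (z < n ^ 4) && S (z %/ n %/ n %/ n) (z %/ n %/ n %% n) (z %/ n %% n) (z %% n).
  have EY (u v w q : 'I_n) : Y (((u * n + v) * n + w) * n + q) =
      connect (@detour G u v w) u q.
    have n0 : 0 < n by apply: leq_ltn_trans (ltn_ord u).
    have D (a : nat) (b : 'I_n) : (a * n + b) %/ n = a.
      by rewrite divnMDl // divn_small // addn0.
    have R (a : nat) (b : 'I_n) : (a * n + b) %% n = b.
      by rewrite modnMDl modn_small.
    have L a (b : 'I_n) m : a < m -> a * n + b < m * n.
      by move=> Ha; have := ltn_ord b; nia.
    rewrite /Y !D !R ES.
    rewrite (_ : ((u * n + v) * n + w) * n + q < n ^ 4) //.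
    by rewrite !expnSr expn0 mul1n; apply/L/L/L.
  exists Y; last by move=> z Hz; rewrite /Y ltnNge Hz.
  apply/all_iotaP => u; apply/all_iotaP => v; apply/all_iotaP => w.
  rewrite !nat_adjE; apply/implyP => /and4P[uv vw uw u_w].
  rewrite !EY connect0 chordal_no_detour //=.
  apply/all_iotaP => p; apply/all_iotaP => q; rewrite !EY !nat_adjE.
  apply/implyP => /and3P[Hp pq Hq]; apply: connect_trans Hp (connect1 _).
  by rewrite /detour /= pq.
Qed.

(* A perfect elimination order, with ties allowed. *)
Lemma chordal_rank (G : graph) (rank : 'I_(n_vert G) -> nat) :
  (forall u v w, adj v u -> adj v w -> rank v <= rank u -> rank v <= rank w ->
    u != w -> adj u w) -> chordal G.
Proof.
move=> H c c4 /andP[Hcyc Hc].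
(* For a vertex of least rank on the cycle, its two neighbours on the cycle are adjacent; this edge
   is a chord because the second and the third successor of [v] differ from [v]. *)
have [v vc Hv] : exists2 v, v \in c & forall u, u \in c -> rank v <= rank u.
  case: c c4 {Hcyc Hc} => // v0 c _.
  by case: (arg_minnP rank (mem_head v0 c)) => v vc Hv; exists v.
set u := prev c v; set w := next c v.
have uc : u \in c by rewrite mem_prev.
have wc : w \in c by rewrite mem_next.
have vu : adj v u by rewrite adj_sym; apply: prev_cycle.
have vw : adj v w by apply: next_cycle.
have nu : next c u = v by apply: next_prev.
have [i s Es] := rot_to vc.
have ss : 3 <= size s by move: c4; rewrite -(size_rot i c) Es.
have nE x : next c x = next (v :: s) x by rewrite -Es next_rot.
have Hs : uniq (v :: s) by rewrite -Es rot_uniq.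
have nx j : j < size (v :: s) -> next c (nth v (v :: s) j) =
  nth v (v :: s) (if j.+1 == size (v :: s) then 0 else j.+1).
  by move=> Hj; rewrite nE; apply: next_nth_uniq.
have Ew : w = nth v (v :: s) 1.
  by rewrite /w -[v in next c v]/(nth v (v :: s) 0) nx //=; case: (size s) ss.
have nw : next c w = nth v (v :: s) 2.
  by rewrite Ew nx /=; case: (size s) ss => [|[|[]]].
have n2 : nth v (v :: s) 2 != v.
  by change (nth v (v :: s) 2 != nth v (v :: s) 0); rewrite nth_uniq //= ltnW.
have n3 : nth v (v :: s) 3 != v.
  by change (nth v (v :: s) 3 != nth v (v :: s) 0); rewrite nth_uniq.
have u_w : u != w by apply: contraNneq n2 => E; rewrite -nw -E nu.
exists u, w; split=> //; first by apply: H vu vw (Hv _ uc) (Hv _ wc) u_w.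
  by rewrite nu; apply: contraTneq vw => ->; rewrite adj_irr.
have nn : next c (next c w) = nth v (v :: s) 3.
  by rewrite nw nx; [rewrite [3 == _]ltn_eqF | rewrite /= ltnW].
by apply: contraNneq n3 => E; rewrite -nn -E nu.
Qed.

(** * From satisfiability to final zero blocking sets *)

(** [lit c v b] says that clause [c] contains the literal of [v] that holds when [v] has the value
    [b]. *)
Definition satisfiable (M Q : nat) (lit : nat -> nat -> bool -> bool) : Prop :=
  exists a : nat -> bool, forall c, c < Q -> exists2 v, v < M & lit c v (a v).

Lemma count_eq1 (T : eqType) (P : pred T) (s : seq T) x :
  uniq s -> x \in s -> P x -> (forall y, y \in s -> P y -> y = x) -> count P s = 1.
Proof.
move=> Hu Hx Px H; rewrite (@eq_in_count _ _ (pred1 x)).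
  by rewrite count_uniq_mem // Hx.
by move=> y Hy /=; apply/idP/eqP => [/(H _ Hy)|->].
Qed.

Lemma count_gt1 (T : eqType) (P : pred T) (s : seq T) x y :
  x \in s -> y \in s -> x != y -> P x -> P y -> 1 < count P s.
Proof.
move=> Hx Hy xy Px Py; rewrite -size_filter.
apply: (@uniq_leq_size _ [:: x; y]); first by rewrite /= inE xy.
by move=> z; rewrite !inE mem_filter => /orP[]/eqP->; rewrite ?Px ?Py ?Hx ?Hy.
Qed.

(* Along a pendant path, two consecutive vertices outside a blocking set keep
   the whole path outside. *)
Lemma path_alternates (P : nat) (s : nat -> bool) :
  (forall t, t.+2 < P -> ~~ s t.+1 -> s t = s t.+2) ->
  forall t0, t0 < P -> s t0 -> forall t, t.+1 < P -> s t || s t.+1.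
Proof.
move=> F t0 Ht0 st0 t Ht; apply: contraT; rewrite negb_or => /andP[h1 h2].
have up d : t + d.+1 < P -> ~~ s (t + d) && ~~ s (t + d.+1).
  elim: d => [|d IH] Hd; first by rewrite addn0 addn1 h1.
  have Hd' : t + d.+1 < P by lia.
  have /andP[e1 e2] := IH Hd'; rewrite e2 /=.
  have := F (t + d); have -> : (t + d).+2 = t + d.+2 by lia.
  have -> : (t + d).+1 = t + d.+1 by lia.
  by move=> /(_ Hd e2) <-.
have down d : d <= t -> ~~ s (t - d) && ~~ s (t - d).+1.
  elim: d => [|d IH] Hd; first by rewrite subn0 h1.
  have /andP[e1 e2] := IH (ltnW Hd); have E : (t - d.+1).+1 = t - d by lia.
  rewrite E e1 andbT; have := F (t - d.+1); rewrite E => -> //; lia.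
have := st0; case: (leqP t0 t) => H.
  by have := down (t - t0) (leq_subr _ _); rewrite subKn // => /andP[/negbTE ->].
have := up (t0 - t).-1; rewrite prednK ?subn_gt0 // subnKC ?(ltnW H) // => /(_ Ht0).
by case/andP=> _ /negbTE ->.
Qed.

Section Gadget.
Variables (M Q : nat) (lit : nat -> nat -> bool -> bool) (clique : bool).

(* Vertex 0 is the root, [1 + v] and [1 + M + v] are the literals of the
   variable [v]; then come, for each check [c], the check itself and its
   pendant path of length [plen].  The checks are the sets
   {root, v_i, v_j, not v_j} for all i, j, and {root} + clause. *)
Definition nlit := (M + M).+1.
Definition plen := (M + M).+4.
Definition nchecks := M * M + Q.
Definition nverts := nlit + nchecks * plen.

(** The check of [i] and [j] has the number [i * M + j]; clauses are numbered from [M * M] on. *)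
Definition in_check c u : bool :=
  (u == 0) ||
  (if c < M * M then
     [|| u == (c %/ M).+1, u == (c %% M).+1 | u == (M + c %% M).+1]
   else if u <= M then lit (c - M * M) u.-1 true
   else lit (c - M * M) (u.-1 - M) false).

(** The checks are the vertices at offsets divisible by [plen]. Excluding them as targets in the
    second case keeps the end of a path apart from the next check. *)
Definition arc a b : bool :=
  [|| [&& a < nlit, nlit <= b, (b - nlit) %% plen == 0
        & in_check ((b - nlit) %/ plen) a],
      [&& nlit <= a, b == a.+1 & (b - nlit) %% plen != 0]
    | [&& clique, nlit <= a, nlit <= b, (a - nlit) %% plen == 0,
          (b - nlit) %% plen == 0 & a != b]].

Definition gadget_adj a b : bool := arc a b || arc b a.

Lemma gadget_adj_sym : symmetric gadget_adj.
Proof. by move=> a b; rewrite /gadget_adj orbC. Qed.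

Lemma gadget_adj_irr : irreflexive gadget_adj.
Proof.
move=> a; rewrite /gadget_adj orbb /arc; apply/negP.
case/or3P=> [/and4P[H1 H2 _ _]|/and3P[_ /eqP H _]|/and5P[_ _ _ _ /andP[_ /eqP//]]].
  by rewrite leqNgt H1 in H2.
by lia.
Qed.

(** Vertex [t] of the path hanging from check [c]; for [t = 0] it is the check itself. *)
Definition vpos c t := nlit + (c * plen + t).

Lemma vposP i : nlit <= i -> exists c t, [/\ t < plen & i = vpos c t].
Proof.
move=> Hi; exists ((i - nlit) %/ plen), ((i - nlit) %% plen).
by rewrite ltn_mod; split=> //; rewrite /vpos -divn_eq subnKC.
Qed.

Lemma vpos_mod c t : t < plen -> (vpos c t - nlit) %% plen = t.
Proof. by move=> Ht; rewrite addKn modnMDl modn_small. Qed.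

Lemma vpos_div c t : t < plen -> (vpos c t - nlit) %/ plen = c.
Proof. by move=> Ht; rewrite addKn divnMDl // divn_small // addn0. Qed.

Lemma vpos_ge c t : (vpos c t < nlit) = false.
Proof. by rewrite ltnNge leq_addr. Qed.

Lemma vpos_lt c t : t < plen -> (vpos c t < nverts) = (c < nchecks).
Proof.
move=> Ht; rewrite ltn_add2l; apply/idP/idP => H; last by nia.
by rewrite ltnNge; apply/negP => Hc; move: H; rewrite ltnNge; nia.
Qed.

Lemma vposS c t : (vpos c t).+1 = vpos c t.+1.
Proof. by rewrite /vpos !addnS. Qed.

Lemma arc_lit a j : a < nlit -> arc j a = false.
Proof.
move=> Ha; have Ha' : nlit <= a = false by rewrite leqNgt Ha.
rewrite /arc Ha' !andbF /= orbF; apply/negP => /and3P[Hj /eqP E _].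
by move: Ha Hj; rewrite E; lia.
Qed.

Lemma gadget_adj_lit a b : a < nlit -> b < nlit -> gadget_adj a b = false.
Proof. by move=> Ha Hb; rewrite /gadget_adj !arc_lit. Qed.

Lemma gadget_adj_vpos_lit c t u : t < plen -> u < nlit ->
  gadget_adj (vpos c t) u = (t == 0) && in_check c u.
Proof.
move=> Ht Hu; rewrite /gadget_adj arc_lit //= /arc Hu vpos_mod // vpos_div //.
by rewrite leq_addr (leqNgt nlit u) Hu !andbF !orbF.
Qed.

Lemma gadget_adj_path c t j : t.+1 < plen ->
  gadget_adj (vpos c t.+1) j =
    (j == vpos c t) || (j == vpos c t.+2) && (t.+2 < plen).
Proof.
move=> Ht; rewrite /gadget_adj /arc vpos_ge vpos_mod // /= !andbF /= !orbF.
rewrite leq_addr /= -vposS eqSS.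
case: (altP (j =P vpos c t)) => [->|Hj] /=.
  by rewrite leq_addr eqxx orbT.
rewrite !vposS [vpos c t == j]eq_sym (negbTE Hj) !andbF orbF; case: eqP => //= ->.
move: Ht; rewrite leq_eqVlt => /orP[/eqP E|Ht].
  by rewrite E ltnn /vpos addKn -mulSnr modnMl.
by rewrite vpos_mod // Ht.
Qed.

Lemma count_nverts (S : nat -> bool) : count (fun i => S i) (iota 0 nverts) =
  S 0 + (count (fun v => S v.+1) (iota 0 M) + count (fun v => S (M + v).+1) (iota 0 M))
  + count (fun i => S i) (iota nlit (nchecks * plen)).
Proof.
rewrite /nverts iotaD count_cat add0n; congr (_ + _).
rewrite /nlit -[iota 0 _]/(0 :: iota (1 + 0) (M + M)) /= iotaD count_cat.
congr (_ + (_ + _)).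
  by rewrite -[1]addn0 iotaDl count_map.
by rewrite -[1 + M]addn0 iotaDl count_map; apply: eq_count => v /=; rewrite add1n addSn.
Qed.

Hypothesis M2 : 1 < M.

(** The root and the true literals form the set: a check sees the root and at least one true
    literal, and any other vertex outside the set sees none of its elements. *)
Lemma satisfiable_fort : satisfiable M Q lit ->
  exists S, small_fort nverts gadget_adj M.+1 S.
Proof.
move=> [a Ha].
pose S u := [|| u == 0, (0 < u <= M) && a u.-1 | (M < u < nlit) && ~~ a (u.-1 - M)].
have S0 : S 0 by [].
have Slit u : S u -> u < nlit.
  by rewrite /S /nlit => /or3P[/eqP->|/andP[/andP[_ H] _]|/andP[/andP[_ H] _]] //; lia.
have Sv v : v < M -> S (if a v then v.+1 else (M + v).+1).
  move=> Hv; rewrite /S /nlit; case E : (a v) => /=.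
    by rewrite Hv E.
  by rewrite !ltnS leq_addr ltn_add2l Hv addKn E !orbT.
exists S; apply/and3P; split.
- by apply/hasP; exists 0 => //; rewrite mem_iota.
- apply/allP => i; rewrite mem_iota add0n => /andP[_ Hi]; apply/implyP => Si.
  case: (ltnP i nlit) => Hil.
    rewrite (@eq_count _ _ pred0) ?count_pred0 // => j /=.
    by apply/andP => -[/Slit Hj]; rewrite gadget_adj_lit.
  have [c [t [Ht Ei]]] := vposP Hil; subst i.
  have Hc : c < nchecks by rewrite -(vpos_lt c Ht).
  have adjE j : S j && gadget_adj (vpos c t) j = [&& S j, t == 0 & in_check c j].
    by case: (boolP (S j)) => // /Slit Hj; rewrite gadget_adj_vpos_lit.
  rewrite (eq_count adjE); case: (altP (t =P 0)) => [t0|t0]; last first.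
    by rewrite (@eq_count _ _ pred0) ?count_pred0 // => j /=; rewrite andbF.
  suff [u [Su u0 Cu]] : exists u, [/\ S u, u != 0 & in_check c u].
    rewrite neq_ltn; apply/orP; right; apply: (@count_gt1 _ _ _ 0 u).
    - by rewrite mem_iota /nverts /nlit.
    - by rewrite mem_iota add0n; apply: leq_trans (Slit _ Su) (leq_addr _ _).
    - by rewrite eq_sym.
    - by [].
    - by rewrite Su Cu.
  have [HcM|HcM] := ltnP c (M * M).
    pose j := c %% M; have Hj : j < M by rewrite ltn_mod; lia.
    exists (if a j then j.+1 else (M + j).+1); split; first exact: Sv.
      by case: (a j).
    by rewrite /in_check HcM -/j; case: (a j); rewrite eqxx !orbT.
  have HcQ : c - M * M < Q by move: Hc HcM; rewrite /nchecks; lia.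
  have [v Hv Hl] := Ha _ HcQ; exists (if a v then v.+1 else (M + v).+1).
  split; first exact: Sv; first by case: (a v).
  rewrite /in_check ltnNge HcM /=; case E : (a v); rewrite E in Hl; rewrite /= ?Hv //.
  by rewrite ltnNge leq_addr /= addKn.
rewrite count_nverts [S 0]/= (@eq_in_count _ _ pred0 (iota nlit _)); last first.
  move=> i; rewrite mem_iota => /andP[Hi _] /=.
  by apply/negbTE; apply/negP => /Slit; rewrite ltnNge Hi.
rewrite count_pred0 addn0 add1n ltnS.
rewrite (@eq_in_count _ _ a); last first.
  move=> v; rewrite mem_iota /= => Hv; rewrite /S /= Hv ltnNge.
  by rewrite (leq_trans Hv) ?leqnn //= ?orbF; case: (a v); rewrite ?orbF.
rewrite (@eq_in_count _ (fun v => S (M + v).+1) (predC a)); last first.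
  move=> v; rewrite mem_iota /= add0n => Hv; rewrite /S /nlit /= !ltnS.
  by rewrite leq_addr ltn_add2l Hv addKn ltnNge leq_addr.
by rewrite count_predC size_iota.
Qed.

Lemma fort_satisfiable S : small_fort nverts gadget_adj M.+1 S ->
  satisfiable M Q lit.
Proof.
case/and3P=> S_nonempty S_fort S_small.
have fort i : i < nverts -> ~~ S i ->
    count (fun j => S j && gadget_adj i j) (iota 0 nverts) <> 1.
  by move=> Hi Si; have /allP/(_ i) := S_fort; rewrite mem_iota Si => /(_ Hi)/eqP.
have no_path c t : c < nchecks -> t < plen -> ~~ S (vpos c t).
  move=> Hc Ht; apply/negP => St.
  have alt := @path_alternates plen (fun t => S (vpos c t)) _ t Ht St.
  have {}alt : forall t, t.+1 < plen -> S (vpos c t) || S (vpos c t.+1).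
    apply: alt => d Hd Sd; have Hd' : d.+1 < plen := ltnW Hd.
    have := @fort (vpos c d.+1); rewrite vpos_lt // => /(_ Hc Sd) Hcount.
    case E1 : (S (vpos c d)); case E2 : (S (vpos c d.+2)) => //; case: Hcount.
      apply: (@count_eq1 _ _ _ (vpos c d)); rewrite ?iota_uniq //.
      - by rewrite mem_iota add0n vpos_lt // ltnW.
      - by rewrite E1 gadget_adj_path // eqxx.
      - move=> y _; rewrite gadget_adj_path // => /andP[Sy /orP[/eqP//|/andP[/eqP E]]].
        by rewrite E E2 in Sy.
    apply: (@count_eq1 _ _ _ (vpos c d.+2)); rewrite ?iota_uniq //.
    - by rewrite mem_iota add0n vpos_lt.
    - by rewrite E2 gadget_adj_path // eqxx Hd orbT.
    - move=> y _; rewrite gadget_adj_path // => /andP[Sy /orP[/eqP E|/andP[/eqP//]]].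
      by rewrite E E1 in Sy.
  (* One element of [S] from each pair of positions [l.*2], [l.*2.+1]. The length [plen] provides M
     + 2 such pairs, one more than the budget allows. *)
  pose g l := vpos c (if S (vpos c l.*2) then l.*2 else l.*2.+1).
  suff: M.+2 <= count (fun i => S i) (iota 0 nverts) by rewrite ltnNge S_small.
  rewrite -size_filter -[M.+2](size_mkseq g); apply: uniq_leq_size.
    rewrite map_inj_in_uniq ?iota_uniq // => l1 l2 _ _ /eqP.
    rewrite /g /vpos !eqn_add2l => /eqP E.
    by move: E; case: ifP => _; case: ifP => _; lia.
  move=> y /mapP[l]; rewrite mem_iota add0n => /andP[_ Hl] ->.
  have Hl2 : l.*2.+1 < plen by rewrite /plen; lia.
  rewrite mem_filter mem_iota add0n /g.
  have := alt _ Hl2; case: ifP => [E _|E]; first by rewrite E vpos_lt // ltnW.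
  by rewrite orFb => ->; rewrite vpos_lt.
have S_lit i : i < nverts -> S i -> i < nlit.
  move=> Hi Si; rewrite ltnNge; apply/negP => /vposP[c [t [Ht Ei]]].
  subst i; rewrite vpos_lt // in Hi.
  by have := no_path c t Hi Ht; rewrite Si.
have lit_nverts u : u < nlit -> u < nverts by move=> Hu; apply: leq_trans Hu (leq_addr _ _).
(* The check vertex is outside [S], and its neighbours in [S] are exactly the elements of [S] in its
   set: if there is one, there is a second. *)
have check c u : c < nchecks -> u < nlit -> S u -> in_check c u ->
    exists u', [/\ u' < nlit, u' != u, S u' & in_check c u'].
  move=> Hc Hu Su Cu; have P0 : 0 < plen by [].
  have := @fort (vpos c 0); rewrite vpos_lt // => /(_ Hc (no_path _ _ Hc P0)) Hcount.
  case: (boolP (has (fun u' => [&& u' != u, S u' & in_check c u']) (iota 0 nlit))).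
    move=> /hasP[u']; rewrite mem_iota add0n => /andP[_ Hu'] /and3P[*].
    by exists u'.
  move=> /hasPn Hno; case: Hcount; apply: (@count_eq1 _ _ _ u).
  - exact: iota_uniq.
  - by rewrite mem_iota add0n lit_nverts.
  - by rewrite Su gadget_adj_vpos_lit.
  - move=> y; rewrite mem_iota add0n => /andP[_ Hy] /andP[Sy].
    have Hyl := S_lit _ Hy Sy; rewrite gadget_adj_vpos_lit //= => Cy.
    apply/eqP; apply: contraT => yu; have := Hno y.
    by rewrite mem_iota add0n Hyl yu Sy Cy => /(_ isT).
have pair_lt i j : i < M -> j < M -> i * M + j < M * M by move=> *; nia.
have check2 i j u : i < M -> j < M -> u < nlit -> S u ->
    [|| u == 0, u == i.+1, u == j.+1 | u == (M + j).+1] ->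
    exists u', [/\ u' != u, S u' & [|| u' == 0, u' == i.+1, u' == j.+1 | u' == (M + j).+1]].
  move=> Hi Hj Hu Su Cu; have Hc := pair_lt _ _ Hi Hj.
  have M0 : 0 < M by apply: ltnW.
  have CE v : in_check (i * M + j) v = [|| v == 0, v == i.+1, v == j.+1 | v == (M + j).+1].
    by rewrite /in_check Hc divnMDl // divn_small // addn0 modnMDl modn_small.
  have [||||u' [_ ne Su' Cu']] := check (i * M + j) u; rewrite ?CE //.
    by rewrite /nchecks ltn_addr.
  by exists u'; rewrite -CE.
have lit1 v : v < M -> v.+1 < nlit by rewrite /nlit; lia.
have lit2 v : v < M -> (M + v).+1 < nlit by rewrite /nlit; lia.
move: S_small; rewrite count_nverts => S_small.
case S0 : (S 0); last first.
  (* The check with both indices [v] has only the two literals of [v] besides the missing root. *)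
  have both v : v < M -> S v.+1 || S (M + v).+1 -> S v.+1 && S (M + v).+1.
    move=> Hv /orP[] Sv; rewrite Sv ?andbT /=.
      have [|||||u' [ne Su']] := check2 v v v.+1; rewrite ?eqxx ?orbT ?lit1 //.
      by case/or4P=> /eqP E; move: ne Su'; rewrite E ?S0 ?eqxx // => _ ->; rewrite ?orbT.
    have [|||||u' [ne Su']] := check2 v v (M + v).+1; rewrite ?eqxx ?orbT ?lit2 //.
    by case/or4P=> /eqP E; move: ne Su'; rewrite E ?S0 ?eqxx // => _ ->; rewrite ?orbT.
  have [v0 Hv0 Sv0] : exists2 v0, v0 < M & S v0.+1.
    case/hasP: S_nonempty => u; rewrite mem_iota add0n => /andP[_ Hu] Su.
    have := S_lit _ Hu Su; case: u Su {Hu} => [|u]; first by rewrite S0.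
    rewrite /nlit ltnS => Su Hu; case: (ltnP u M) => HuM; first by exists u.
    have Hv : u - M < M by lia.
    exists (u - M) => //; have := both _ Hv; rewrite subnKC // Su orbT.
    by case/(_ isT)/andP.
  (* The check of [v0] and [v] sees [v0], hence also a literal of [v]. *)
  have all_both v : v < M -> S v.+1 && S (M + v).+1.
    move=> Hv; apply: both => //; case: (altP (v =P v0)) => [->|ne0]; first by rewrite Sv0.
    have [|||||u' [ne Su']] := check2 v0 v v0.+1; rewrite ?eqxx ?orbT ?lit1 //.
    by case/or4P=> /eqP E; move: ne Su'; rewrite E ?S0 ?eqxx // => _ ->; rewrite ?orbT.
  have C1 : count (fun v => S v.+1) (iota 0 M) = M.
    apply/eqP; rewrite -[X in _ == X](size_iota 0) -all_count; apply/allP => v.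
    by rewrite mem_iota => /all_both/andP[].
  have C2 : count (fun v => S (M + v).+1) (iota 0 M) = M.
    apply/eqP; rewrite -[X in _ == X](size_iota 0) -all_count; apply/allP => v.
    by rewrite mem_iota => /all_both/andP[].
  by move: S_small; rewrite C1 C2; lia.
have some v : v < M -> S v.+1 || S (M + v).+1.
  move=> Hv; have [|||||u' [ne Su']] := check2 v v 0; rewrite ?eqxx //.
  by case/or4P=> /eqP E; move: ne Su'; rewrite E ?S0 ?eqxx // => _ ->; rewrite ?orbT.
(* Inclusion and exclusion: every variable has a literal in [S], and the budget without the root is
   [M], so no variable has two. *)
have not_both v : v < M -> ~~ (S v.+1 && S (M + v).+1).
  pose p v := S v.+1; pose q v := S (M + v).+1.
  have := count_predUI p q (iota 0 M).
  have -> : count (predU p q) (iota 0 M) = M.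
    apply/eqP; rewrite -[X in _ == X](size_iota 0) -all_count; apply/allP => i.
    by rewrite mem_iota => /some.
  move=> E Hv; have : count (predI p q) (iota 0 M) = 0.
    by move: S_small E; rewrite S0 -/p -/q; lia.
  move/eqP; rewrite -leqn0 leqNgt -has_count => /hasPn/(_ v).
  by rewrite mem_iota => /(_ Hv).
exists (fun v => S v.+1) => c Hc.
have HcM : M * M + c < nchecks by rewrite /nchecks ltn_add2l.
have [|||u' [Hu' ne Su']] := check _ 0 HcM; rewrite ?S0 //.
rewrite /in_check (negbTE ne) /= ltnNge leq_addr /= addKn.
case: u' Hu' ne Su' => // u; rewrite ltnS /= => Hu _ Su.
case: ltnP => HuM; first by exists u; rewrite ?Su.
move=> Hl; have Hv : u - M < M by lia.
exists (u - M) => //; have := not_both _ Hv; rewrite subnKC // Su andbT.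
by move/negbTE => ->.
Qed.

End Gadget.

(** * Membership of the gadget in the two graph classes *)

Definition gadget_graph M Q lit clique : graph :=
  graph_of (nverts M Q) (@gadget_adj_sym M lit clique) (@gadget_adj_irr M lit clique).

Lemma gadget_bipartite M Q lit : bipartite (gadget_graph M Q lit false).
Proof.
pose col i := (i < nlit M) || odd ((i - nlit M) %% plen M).
have H a b : arc M lit false a b -> col a != col b.
  rewrite /arc /= orbF => /orP[/and4P[Ha Hb /eqP Hm _]|/and3P[Ha /eqP -> Hm]].
    by rewrite /col Ha [b < _]ltnNge Hb Hm.
  rewrite /col [a < _]ltnNge Ha [a.+1 < _]ltnNge (leq_trans Ha (leqnSn _)) !orFb.
  rewrite subSn // modnS in Hm *; case: ifP Hm => //= _ _.
  by case: (odd _).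
exists [set u : 'I_(nverts M Q) | col u] => u v; rewrite !inE.
by case/orP=> /H //; rewrite eq_sym.
Qed.

(** The elimination order removes the root and the literals, whose neighbours are checks; then the
    paths from their free ends, where each vertex has a single neighbour of no smaller rank; and
    last the clique of checks. *)
Lemma gadget_chordal M Q lit : chordal (gadget_graph M Q lit true).
Proof.
pose md i := (i - nlit M) %% plen M.
pose rank i := if i < nlit M then 0 else if md i == 0 then (plen M).+1 else plen M - md i.
apply: (@chordal_rank (gadget_graph M Q lit true) (fun u => rank u)) => u v w.
change (gadget_adj M lit true v u -> gadget_adj M lit true v w ->
  rank v <= rank u -> rank v <= rank w -> u != w -> gadget_adj M lit true u w).
rewrite -val_eqE /=; move: (u : nat) (v : nat) (w : nat) => {u v w} u v w.
have checks a b : nlit M <= a -> md a = 0 -> nlit M <= b -> md b = 0 -> a != b ->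
    gadget_adj M lit true a b.
  move=> Ha ma Hb mb ab; apply/orP; left; apply/or3P/Or33.
  by rewrite Ha Hb ab -/(md a) -/(md b) ma mb.
case: (ltnP v (nlit M)) => Hv.
  have nb a : gadget_adj M lit true v a -> nlit M <= a /\ md a = 0.
    rewrite /gadget_adj (arc_lit _ _ _ Hv) orbF /arc Hv [nlit M <= v]leqNgt Hv /= ?andbF ?orbF.
    by case/and3P=> Ha /eqP.
  by move=> /nb[Hu mu] /nb[Hw mw] _ _; apply: checks.
have [c [[|t] [Ht E]]] := vposP Hv; subst v.
  have rv : rank (vpos M c 0) = (plen M).+1 by rewrite /rank vpos_ge /md vpos_mod.
  have top a : (plen M).+1 <= rank a -> nlit M <= a /\ md a = 0.
    rewrite /rank; case: (ltnP a (nlit M)) => // Ha; case: (md a =P 0) => // _.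
    by rewrite ltnNge leq_subr.
  by move=> _ _; rewrite rv => /top[Hu mu] /top[Hw mw]; apply: checks.
have rk s : s.+1 < plen M -> rank (vpos M c s.+1) = plen M - s.+1.
  by move=> Hs; rewrite /rank vpos_ge /md vpos_mod.
rewrite !gadget_adj_path // rk //.
have down a : (a == vpos M c t) || (a == vpos M c t.+2) && (t.+2 < plen M) ->
    plen M - t.+1 <= rank a -> a = vpos M c t.
  case/orP=> [/eqP -> //|/andP[/eqP -> Ht2]]; rewrite rk //; lia.
by move=> Hu Hw /(down _ Hu) -> /(down _ Hw) ->; rewrite eqxx.
Qed.

Lemma small_fort_adj_ext n a a' K S :
  (forall i j, i < n -> j < n -> a i j = a' i j) ->
  small_fort n a K S = small_fort n a' K S.
Proof.
move=> E; rewrite /small_fort; congr [&& _, _ & _].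
apply: eq_in_all => i; rewrite mem_iota => /andP[_ Hi]; congr (_ ==> (_ != _)).
by apply: eq_in_count => j; rewrite mem_iota => /andP[_ Hj]; rewrite E.
Qed.

Lemma mkseqD (T : Type) (f : nat -> T) m n :
  mkseq f (m + n) = mkseq f m ++ mkseq (fun i => f (m + i)) n.
Proof.
by rewrite /mkseq iotaD map_cat add0n -[X in iota X n]addn0 iotaDl -map_comp.
Qed.

(** * The reduction as a polynomial-time map on words *)

Section Reduction.
Variables (A : finType) (L : language A).
Variables (Mx Qx : seq A -> nat) (litp litn : seq A -> nat -> nat -> bool).
Hypothesis M2 : forall x, 1 < Mx x.
Hypothesis def_M : definable (fun x _ => Mx x).
Hypothesis def_Q : definable (fun x _ => Qx x).
Hypothesis def_litp : definable (fun x v => litp x (v 0) (v 1) : nat).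
Hypothesis def_litn : definable (fun x v => litn x (v 0) (v 1) : nat).
Let lit x c v (b : bool) := if b then litp x c v else litn x c v.
Hypothesis L_sat : forall x, L x <-> satisfiable (Mx x) (Qx x) (lit x).

Ltac definability_hook ::= lazymatch goal with
  | |- definable (fun w v => nat_of_bool (litp _ _ _)) =>
      apply: (def_call2 (F := fun x i j => nat_of_bool (litp x i j)))
  | |- definable (fun w v => nat_of_bool (litn _ _ _)) =>
      apply: (def_call2 (F := fun x i j => nat_of_bool (litn x i j)))
  end.

Lemma def_gadget_adj clique :
  definable (fun x v => gadget_adj (Mx x) (lit x) clique (v 0) (v 1) : nat).
Proof.
cbv beta iota delta [gadget_adj arc in_check nlit plen lit].
by definability.
Qed.

Let N x := nverts (Mx x) (Qx x).

Lemma def_N : definable (fun x _ => N x).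
Proof.
cbv beta iota delta [N nverts nlit nchecks plen].
by definability.
Qed.

Definition gadget_word clique x :=
  graph_word (N x) (gadget_adj (Mx x) (lit x) clique) (Mx x).+1.

(** The values index the list [None], [Some false], [Some true]; the single position between matrix
    and digits is the sign bit. *)
Definition gadget_letter clique x p : nat :=
  if p < N x * (N x).+1 then
    if p %% (N x).+1 == N x then 0
    else (gadget_adj (Mx x) (lit x) clique (p %/ (N x).+1) (p %% (N x).+1)).+1
  else if p == N x * (N x).+1 then 1
  else (iter (p - (N x * (N x).+1).+1) half (Mx x).+1 %% 2).+1.

Ltac definability_hook ::= lazymatch goal with
  | |- definable (fun w v => N _) => apply: def_N
  | |- definable (fun w v => nat_of_bool (gadget_adj _ _ ?c _ _)) =>
      apply: (def_call2 (F := fun x i j => nat_of_bool (gadget_adj (Mx x) (lit x) c i j)));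
      first exact: def_gadget_adj
  end.

Lemma gadget_word_polytime clique : polytime (gadget_word clique).
Proof.
apply: (@definable_polytime _ _ [:: None; Some false; Some true] None _
  (fun x => N x * (N x).+1 + (1 + nbits (Mx x).+1)) (gadget_letter clique)).
- by rewrite /nbits; definability.
- by rewrite /gadget_letter; definability.
move=> x; rewrite /gadget_word /graph_word mat_wordE bits_of_natE mkseqD mkseqD.
set n := N x * (N x).+1; congr (_ ++ _).
  rewrite /mkseq; apply/eq_in_map => p; rewrite mem_iota add0n => /andP[_ Hp].
  rewrite /gadget_letter -/n Hp; case: ifP => // _.
  by case: (gadget_adj _ _ _ _ _).
rewrite [mkseq _ 1]/= cat1s addn0 /gadget_letter -/n ltnn eqxx; congr (_ :: _).
rewrite /mkseq -map_comp; apply: eq_map => i; rewrite [(Some \o _) i]/=.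
rewrite add1n addnS ltnNge (leq_trans (leq_addr i n) (leqnSn _)).
rewrite [_ == n]gtn_eqF ?ltnS ?leq_addr // subSS addKn modn2.
by case: (odd _).
Qed.

Theorem gadget_reduction (C : graph -> Prop) clique :
  (forall x, C (gadget_graph (Mx x) (Qx x) (lit x) clique)) ->
  poly_reducible L (yes_language (P := final_zero_blocking_problem C)).
Proof.
move=> HC; exists (gadget_word clique); split; first exact: gadget_word_polytime.
move=> x; pose G := gadget_graph (Mx x) (Qx x) (lit x) clique.
have EG i j : i < N x -> j < N x ->
    nat_adj G i j = gadget_adj (Mx x) (lit x) clique i j.
  by move=> Hi Hj; rewrite nat_adj_graph_of Hi Hj.
have Ew : gadget_word clique x = graph_word (n_vert G) (nat_adj G) (Mx x).+1.
  rewrite /gadget_word /graph_word !mat_wordE; congr (_ ++ _).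
  rewrite /mkseq; apply/eq_in_map => p; rewrite mem_iota add0n => /andP[_ Hp].
  case: eqP => // Hm; rewrite EG //; first by rewrite ltn_divLR.
  by have := ltn_pmod p (ltn0Sn (N x)); rewrite ltnS leq_eqVlt => /orP[/eqP//|].
have EF S : small_fort (N x) (nat_adj G) (Mx x).+1 S =
    small_fort (N x) (gadget_adj (Mx x) (lit x) clique) (Mx x).+1 S.
  exact: small_fort_adj_ext.
split=> [/L_sat Hs|/yes_languageP[G' [K [_ E [S HS]]]]].
  apply/yes_languageP; exists G, (Mx x).+1; split; [exact: HC | exact: Ew |].
  have [S HS] := @satisfiable_fort (Mx x) (Qx x) (lit x) clique (M2 x) Hs.
  by exists S; rewrite EF.
(* A yes-instance with this word may come with another graph [G']; by injectivity of the encoding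
   its blocking set also serves the gadget. *)
rewrite Ew in E; have [En EK Ea] := graph_word_inj E.
apply/L_sat; apply: (@fort_satisfiable (Mx x) (Qx x) (lit x) clique (M2 x) S).
rewrite -EF EK -[N x]/(n_vert G) En (small_fort_adj_ext _ _ (a' := nat_adj G')) //.
by rewrite -En.
Qed.

End Reduction.

(** * Computations as satisfiability instances *)

Lemma horner_nat_mono (p : {poly nat}) m n : m <= n -> (p.[m]%R : nat) <= p.[n]%R.
Proof.
move=> H; rewrite /horner; elim: (polyseq p) => //= a s IH.
by apply: leq_add => //; apply: leq_mul.
Qed.

(* The cell at position [pos] of a tape whose head is placed at [P]. *)
Definition tape_cell (S : Type) (t : tape S) (P pos : nat) : option S :=
  if P <= pos then nth None (cur t :: rgt t) (pos - P)
  else nth None (lft t) (P - pos).-1.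

Lemma tape_cell_shift (S : Type) (t : tape S) c m P pos : 0 < pos -> 0 < P ->
  tape_cell (shift m (write c t)) P pos =
  match m with
  | MoveL => if pos == P.+1 then c else tape_cell t P pos.-1
  | Stay => if pos == P then c else tape_cell t P pos
  | MoveR => if pos.+1 == P then c else tape_cell t P pos.+1
  end.
Proof.
case: t => l h r pos0 P0; rewrite /tape_cell; case: m => /=.
- case: (ltngtP pos P) => H.
  + have -> : P <= pos.-1 = false by apply/negbTE; lia.
    rewrite (ltn_eqF (ltnW _ : pos < P.+1)) ?ltnS //.
    have -> : (P - pos.-1).-1 = (P - pos).-1.+1 by lia.
    by case: l => [|c' l] //=; rewrite nth_nil.
  + case: eqP => [->|ne]; first by rewrite subSnn; case: l.
    have -> : P <= pos.-1 by lia.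
    have [k Ek] : exists k, pos - P = k.+2 by exists (pos - P - 2); lia.
    have -> : pos.-1 - P = k.+1 by lia.
    by rewrite Ek; case: l.
  + subst pos; rewrite subnn ltn_eqF //.
    have -> : P <= P.-1 = false by apply/negbTE; lia.
    have -> : (P - P.-1).-1 = 0 by lia.
    by case: l.
- case: (ltngtP pos P) => H //; last by rewrite H subnn.
  by have [k ->] : exists k, pos - P = k.+1 by exists (pos - P).-1; lia.
- case: (ltngtP pos.+1 P) => H.
  + have -> : P <= pos = false by apply/negbTE; lia.
    have -> : (P - pos).-1 = (P - pos.+1).-1.+1 by lia.
    by case: r.
  + have -> : P <= pos by lia.
    have -> : pos.+1 - P = (pos - P).+1 by lia.
    by case: r => [|c' r] //=; rewrite nth_nil; case: (pos - P) => //= k; rewrite nth_nil.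
  + have -> : P <= pos = false by apply/negbTE; lia.
    have -> : (P - pos).-1 = 0 by lia.
    by case: r.
Qed.

Section CookLevin.
Variables (A : finType) (V : TM (A + bool)%type bool) (v : seq (A + bool) -> bool).
Variables (p pv : {poly nat}).
Hypothesis V_computes : forall w, outputs_within V pv.[size w]%R w [:: v w].

(** A site records the state and the symbols of all tapes at one distance from their heads. With the
    heads aligned, the next site depends only on three adjacent sites and the one under the
    heads. *)
Definition site : finType := (state V * {ffun tape_ix V -> option (sym V)})%type.

Definition site_at (cf : config V) (P pos : nat) : site :=
  (cstate cf, [ffun i => tape_cell (ctapes cf i) P pos]).

(* [k] tells the position of the site relative to the head: 0, 1, 2 for just
   left of it, on it, just right of it, and 3 for everything else. *)
Definition next_site (k : nat) (a b c e : site) : site :=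
  if halting e.1 then b else
  let: (q, act) := delta e.1 e.2 in
  (q, [ffun i => match (act i).2 with
       | MoveL => if k == 2 then (act i).1 else a.2 i
       | Stay => if k == 1 then (act i).1 else b.2 i
       | MoveR => if k == 0 then (act i).1 else c.2 i
       end]).

Definition kind (P pos : nat) : nat :=
  if pos.+1 == P then 0 else if pos == P then 1 else if pos == P.+1 then 2 else 3.

Lemma site_at_step cf P pos : 0 < pos -> 0 < P ->
  site_at (step cf) P pos =
  next_site (kind P pos) (site_at cf P pos.-1) (site_at cf P pos)
    (site_at cf P pos.+1) (site_at cf P P).
Proof.
move=> pos0 P0; rewrite /step /next_site /=.
case: ifP => // _.
have -> : [ffun i => tape_cell (ctapes cf i) P P] = [ffun i => cur (ctapes cf i)].
  by apply/ffunP => i; rewrite !ffunE /tape_cell leqnn subnn.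
case: (delta _ _) => q act; congr pair; apply/ffunP => i; rewrite !ffunE /=.
rewrite tape_cell_shift //.
have [-> -> ->] : [/\ (kind P pos == 2) = (pos == P.+1), (kind P pos == 1) = (pos == P)
  & (kind P pos == 0) = (pos.+1 == P)].
  rewrite /kind; case: (pos.+1 =P P) => E1; case: (pos =P P) => E2;
    case: (pos =P P.+1) => E3 //=; exfalso; lia.
by case: ((act i).2).
Qed.

Definition init_site (o : option (A + bool)) : site :=
  (start V, [ffun i => if i == io V then omap (@tm_in _ _ V) o else None]).

Definition cell_of (w : seq (A + bool)) (P pos : nat) : option (A + bool) :=
  if P <= pos then nth None (map Some w) (pos - P) else None.

Lemma site_at_init w P pos : site_at (init V w) P pos = init_site (cell_of w P pos).
Proof.
rewrite /site_at /init_site /=; congr pair; apply/ffunP => i; rewrite !ffunE.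
rewrite /tape_cell /cell_of; case: eqP => _ /=; last first.
  by case: ifP => _; [case: (pos - P) => //= k|]; rewrite nth_nil.
case: ifP => _; last by case: w => [|a w]; rewrite nth_nil.
case: w => [|a w] /=; first by case: (pos - P) => //= k; rewrite nth_nil.
case: (pos - P) => //= k; elim: w k => [|b w IH] [|k] //=.
Qed.

Definition accepting (d : site) : bool := d.2 (io V) == Some (tm_out V true).

(** The output is a single letter, so the cell under the output head decides acceptance, and a
    halted configuration no longer changes. *)
Lemma accepting_site w T P : (pv.[size w]%R : nat) <= T ->
  accepting (site_at (iter T (@step _ _ V) (init V w)) P P) = v w.
Proof.
move=> HT; have [Hh Ho] := V_computes w.
rewrite -(subnK HT) iterD iter_halted // /accepting /= ffunE /tape_cell leqnn subnn /=.
move: Ho; rewrite /tape_word /=; case: (cur _) => // s [-> _].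
apply/eqP/idP => [[/(@tm_out_inj _ _ V)->]//|->//].
Qed.

Definition window : finType := (site * site * site * site)%type.
Definition site_code (d : site) : nat := enum_rank d.
Definition window_code (r : window) : nat := enum_rank r.
Definition window_table (g : window -> nat) : seq nat := map g (enum window).

Lemma site_code_lt d : site_code d < #|site|. Proof. exact: ltn_ord. Qed.

Lemma site_code_inj : injective site_code.
Proof. by move=> d e /val_inj/enum_rank_inj. Qed.

Lemma window_code_lt r : window_code r < #|window|. Proof. exact: ltn_ord. Qed.

Lemma window_codeP q : q < #|window| -> exists r, q = window_code r.
Proof. by move=> H; exists (enum_val (Ordinal H)); rewrite /window_code enum_valK. Qed.

Lemma window_tableE g r : nth 0 (window_table g) (window_code r) = g r.
Proof.
rewrite /window_table (nth_map r) ?nth_enum_rank // -cardE; exact: window_code_lt.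
Qed.

Notation blank := (site_code (init_site None)).
Notation bit b := (site_code (init_site (Some (inr b)))).

Definition win1 (r : window) := site_code r.1.1.1.
Definition win2 (r : window) := site_code r.1.1.2.
Definition win3 (r : window) := site_code r.1.2.
Definition win4 (r : window) := site_code r.2.
Definition win_next k (r : window) := site_code (next_site k r.1.1.1 r.1.1.2 r.1.2 r.2).
Definition win_accept (r : window) : nat := accepting r.1.1.1.

(** * The satisfiability instance of an input word *)

Section Instance.
Variable x : seq A.

Definition clen := p.[size x]%R : nat.
Definition tmax := pv.[size x + clen]%R : nat.
(** The transition clauses do not reach the borders of a row, so row [t] is under control only [t]
    positions away from them. As [ctr] exceeds [tmax], the head column stays under control; the
    other summands make room for the input, the certificate and a blank. *)
Definition ctr := (tmax + size x + clen).+1.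
Definition width := (ctr + ctr).+1.

Definition allowed pos d : bool :=
  if pos < ctr then d == blank
  else if pos < ctr + size x then
    d == nth 0 (map (fun a => site_code (init_site (Some (inl a)))) x) (pos - ctr)
  else if pos < ctr + size x + clen then [|| d == blank, d == bit true | d == bit false]
  else d == blank.

(* The clauses say, for [f] = 0, 1, 2, 3: the transition function is obeyed;
   the first row holds the input and a certificate; blanks of the certificate
   are followed by blanks; the last row is accepting.  A site may carry several
   values at once, which is harmless: the clauses of kind 0 force the values of
   the actual computation to be among them. *)
Definition pos_clause f t pos q vt vp vd : bool :=
  if f == 0 then
    if [&& t < tmax, 0 < pos & pos.+1 < width] then
      [&& vt == t.+1, vp == pos
        & vd == (if pos.+1 == ctr then nth 0 (window_table (win_next 0)) q
                 else if pos == ctr then nth 0 (window_table (win_next 1)) q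
                 else if pos == ctr.+1 then nth 0 (window_table (win_next 2)) q
                 else nth 0 (window_table (win_next 3)) q)]
    else true
  else if f == 1 then [&& vt == 0, vp == pos & allowed pos vd]
  else if f == 2 then
    if (ctr + size x <= pos) && (pos < ctr + size x + clen) then
      [&& vt == 0, vp == pos.+1 & vd == blank]
    else true
  else nth 0 (window_table win_accept) q == 1.

Definition neg_clause f t pos q vt vp vd : bool :=
  if f == 0 then
    if [&& t < tmax, 0 < pos & pos.+1 < width] then
      (vt == t) && [|| (vp == pos.-1) && (vd == nth 0 (window_table win1) q),
                       (vp == pos) && (vd == nth 0 (window_table win2) q),
                       (vp == pos.+1) && (vd == nth 0 (window_table win3) q)
                     | (vp == ctr) && (vd == nth 0 (window_table win4) q)]
    else true
  else if f == 1 then false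
  else if f == 2 then
    if (ctr + size x <= pos) && (pos < ctr + size x + clen) then
      [&& vt == 0, vp == pos & vd == blank]
    else true
  else (nth 0 (window_table win_accept) q == 1) ||
       [&& vt == tmax, vp == ctr & vd == nth 0 (window_table win1) q].

(** The summand 2 makes the gadget's requirement of at least two variables immediate. *)
Definition nvars := tmax.+1 * width * #|site| + 2.
Definition nclauses := tmax.+1 * width * #|window| * 4.

(** Mixed radix: a clause number stands for time, position, window and kind, a variable number for
    time, position and site. *)
Definition decode_with (cl : nat -> nat -> nat -> nat -> nat -> nat -> nat -> bool) c u :=
  cl (c %% 4) (c %/ 4 %/ #|window| %/ width) (c %/ 4 %/ #|window| %% width)
     (c %/ 4 %% #|window|)
     (u %/ #|site| %/ width) (u %/ #|site| %% width) (u %% #|site|).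

Definition cl_lit c u (b : bool) :=
  if b then decode_with pos_clause c u else decode_with neg_clause c u.

Lemma mixed_radix_lt n m i j : i < m -> j < n -> i * n + j < m * n.
Proof. by move=> *; nia. Qed.

Lemma divn_radix n i j : j < n -> (i * n + j) %/ n = i.
Proof. by move=> H; rewrite divnMDl ?divn_small ?addn0 //; apply: leq_ltn_trans H. Qed.

Lemma modn_radix n i j : j < n -> (i * n + j) %% n = j.
Proof. by move=> H; rewrite modnMDl modn_small. Qed.

Lemma satisfiable_intro (Z : nat -> nat -> nat -> bool) :
  (forall f t pos r, f < 4 -> t <= tmax -> pos < width -> exists vt vp vd,
     [/\ vt <= tmax, vp < width, vd < #|site|
       & if Z vt vp vd then pos_clause f t pos (window_code r) vt vp vd
         else neg_clause f t pos (window_code r) vt vp vd]) ->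
  satisfiable nvars nclauses cl_lit.
Proof.
move=> H; pose a u := Z (u %/ #|site| %/ width) (u %/ #|site| %% width) (u %% #|site|).
exists a => c Hc.
have w0 : 0 < #|window|.
  by rewrite lt0n; apply: contraTneq Hc => E; rewrite /nclauses E muln0.
have [r Er] : exists r, c %/ 4 %% #|window| = window_code r.
  by apply: window_codeP; rewrite ltn_mod.
have Ht : c %/ 4 %/ #|window| %/ width <= tmax.
  by rewrite -ltnS !ltn_divLR.
have Hp : c %/ 4 %/ #|window| %% width < width by rewrite ltn_mod.
have [vt [vp [vd [h1 h2 h3 h4]]]] := H _ _ _ r (ltn_pmod c (isT : 0 < 4)) Ht Hp.
exists ((vt * width + vp) * #|site| + vd).
  by rewrite /nvars ltn_addr // mixed_radix_lt // mixed_radix_lt.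
rewrite /a /cl_lit /decode_with (divn_radix _ h3) (modn_radix _ h3) (divn_radix _ h2).
rewrite (modn_radix _ h2) Er.
by move: h4; case: (Z vt vp vd).
Qed.

Lemma satisfiable_elim : satisfiable nvars nclauses cl_lit ->
  exists Z, forall f t pos r, f < 4 -> t <= tmax -> pos < width -> exists vt vp vd,
     if Z vt vp vd then pos_clause f t pos (window_code r) vt vp vd
     else neg_clause f t pos (window_code r) vt vp vd.
Proof.
move=> [a H]; exists (fun t pos d => a ((t * width + pos) * #|site| + d)).
move=> f t pos r Hf Ht Hp; have Hr := window_code_lt r.
pose c := ((t * width + pos) * #|window| + window_code r) * 4 + f.
have Hc : c < nclauses by rewrite /c /nclauses; do 3 apply: mixed_radix_lt => //.
have [u _ Hu] := H c Hc.
exists (u %/ #|site| %/ width), (u %/ #|site| %% width), (u %% #|site|).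
rewrite -!divn_eq; move: Hu.
by rewrite /cl_lit /decode_with /c (divn_radix _ Hf) (modn_radix _ Hf) (divn_radix _ Hr)
  (modn_radix _ Hr) (divn_radix _ Hp) (modn_radix _ Hp).
Qed.

Lemma computation_satisfiable y : size y <= clen -> v (pair_word x y) ->
  satisfiable nvars nclauses cl_lit.
Proof.
move=> Hy Hv; set w := pair_word x y in Hv.
have sw : size w = size x + size y by rewrite size_cat !size_map.
pose S t pos := site_at (iter t (@step _ _ V) (init V w)) ctr pos.
apply: (@satisfiable_intro (fun t pos d => d == site_code (S t pos))) => f t pos r Hf Ht Hp.
have ctr_lt : ctr < width by rewrite /width ltnS leq_addr.
(* The assignment makes exactly the actual sites true. [lie] satisfies a clause by a negative
   literal on a site that is not actual, [truth] by a positive literal on an actual one. *)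
have lie vt vp d : vt <= tmax -> vp < width -> d <> S vt vp ->
    neg_clause f t pos (window_code r) vt vp (site_code d) ->
    exists vt vp vd, [/\ vt <= tmax, vp < width, vd < #|site| &
      if vd == site_code (S vt vp) then pos_clause f t pos (window_code r) vt vp vd
      else neg_clause f t pos (window_code r) vt vp vd].
  move=> h1 h2 h3 h4; exists vt, vp, (site_code d); split=> //.
    exact: site_code_lt.
  by case: eqP => // /site_code_inj.
have truth vt vp : vt <= tmax -> vp < width ->
    pos_clause f t pos (window_code r) vt vp (site_code (S vt vp)) ->
    exists vt vp vd, [/\ vt <= tmax, vp < width, vd < #|site| &
      if vd == site_code (S vt vp) then pos_clause f t pos (window_code r) vt vp vd
      else neg_clause f t pos (window_code r) vt vp vd].
  move=> h1 h2 h3; exists vt, vp, (site_code (S vt vp)); split=> //.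
    exact: site_code_lt.
  by rewrite eqxx.
case: f Hf lie truth => [|[|[|[|//]]]] _ lie truth.
- case E : [&& t < tmax, 0 < pos & pos.+1 < width]; last first.
    by apply: (truth 0 0) => //; rewrite /pos_clause /= E.
  have /and3P[Ht' Hp0 Hp1] := E.
  case: (altP (r.1.1.1 =P S t pos.-1)) => [E1|/eqP N]; last first.
    apply: (lie t pos.-1) N _ => //; first by apply: leq_ltn_trans Hp; apply: leq_pred.
    by rewrite /neg_clause /= E window_tableE !eqxx.
  case: (altP (r.1.1.2 =P S t pos)) => [E2|/eqP N]; last first.
    by apply: (lie t pos) N _ => //; rewrite /neg_clause /= E !window_tableE !eqxx !orbT.
  case: (altP (r.1.2 =P S t pos.+1)) => [E3|/eqP N]; last first.
    by apply: (lie t pos.+1) N _ => //; rewrite /neg_clause /= E !window_tableE !eqxx !orbT.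
  case: (altP (r.2 =P S t ctr)) => [E4|/eqP N]; last first.
    by apply: (lie t ctr) N _ => //; rewrite /neg_clause /= E !window_tableE !eqxx !orbT.
  apply: (truth t.+1 pos) => //; rewrite /pos_clause /= E !eqxx /= !window_tableE.
  rewrite /S iterS site_at_step // -/(S t _) -/(S t _) -/(S t _) -/(S t _).
  rewrite -[S t pos.-1]E1 -[S t pos]E2 -[S t pos.+1]E3 -[S t ctr]E4 /kind /win_next.
  by case: ifP => _ //; case: ifP => _ //; case: ifP.
- apply: (truth 0 pos) => //; rewrite /pos_clause /= !eqxx /= /S /= site_at_init.
  rewrite /allowed /cell_of; case: ltnP => // H1.
  have map_w : map Some w = map (Some \o inl) x ++ map (Some \o inr) y :> seq (option (A + bool)).
    by rewrite /w /pair_word map_cat -!map_comp.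
  rewrite map_w nth_cat size_map ltn_subLR //; case: ltnP => H2.
    have x0 : 0 < size x by lia.
    have a0 : A by case: (x) x0.
    by rewrite !(nth_map a0) // ltn_subLR.
  case: ltnP => H3; last by rewrite nth_default // size_map; lia.
  case: (ltnP (pos - ctr - size x) (size y)) => H4; last first.
    by rewrite nth_default ?size_map // eqxx.
  by rewrite (nth_map true) //=; case: (nth _ _ _); rewrite eqxx !orbT.
- case E : ((ctr + size x <= pos) && (pos < ctr + size x + clen)); last first.
    by apply: (truth 0 0) => //; rewrite /pos_clause /= E.
  have /andP[H1 H2] := E.
  have Hp1 : pos.+1 < width by move: H2; rewrite /width /ctr; lia.
  case: (ltnP (pos - ctr) (size w)) => H3.
    apply: (lie 0 pos (init_site None)) => //; last by rewrite /neg_clause /= E !eqxx.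
    rewrite /S /= site_at_init /cell_of (leq_trans (leq_addr _ _) H1) => -[] /ffunP/(_ (io V)).
    rewrite !ffunE eqxx; move: (w) H3 => w' H3.
    have a0 : (A + bool)%type by case: w' H3.
    by rewrite (nth_map a0).
  apply: (truth 0 pos.+1) => //; rewrite /pos_clause /= E !eqxx /= /S /= site_at_init.
  rewrite /cell_of (leq_trans (leq_trans (leq_addr _ _) H1) (leqnSn _)) nth_default //.
  by rewrite size_map subSn ?(leq_trans (leq_addr _ _) H1) // leqW.
- case: (boolP (accepting r.1.1.1)) => Hacc.
    by apply: (truth 0 0) => //; rewrite /pos_clause /= window_tableE /win_accept Hacc.
  apply: (lie tmax ctr r.1.1.1) => //.
    move=> E; move: Hacc; rewrite E accepting_site ?Hv //.
    by apply: horner_nat_mono; rewrite sw leq_add2l.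
  by rewrite /neg_clause /= !window_tableE !eqxx orbT.
Qed.

Lemma satisfiable_computation : satisfiable nvars nclauses cl_lit ->
  exists y, size y <= clen /\ v (pair_word x y).
Proof.
move=> /satisfiable_elim[Z HZ].
have r0 : window by have d := init_site None; exact: (d, d, d, d).
(* Since a cell may carry several values, the certificate is cut at the first cell that carries a
   blank, and a cell that carries both bits is read as [true]. By the clauses of kind 2 the later
   certificate cells carry a blank as well. *)
pose zb j := Z 0 (ctr + size x + j) blank.
pose l := find zb (iota 0 clen).
have Hl : l <= clen by rewrite -[X in _ <= X](size_iota 0); apply: find_size.
pose y := mkseq (fun j => Z 0 (ctr + size x + j) (bit true)) l.
exists y; split; first by rewrite size_mkseq.
set w := pair_word x y.
have in_width j : j <= size x + clen -> ctr + j < width.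
  by rewrite /width ltnS leq_add2l /ctr; lia.
have init_row pos : pos < width -> exists2 d, allowed pos d & Z 0 pos d.
  move=> Hp; have [vt [vp [vd]]] := HZ 1 0 pos r0 isT isT Hp.
  rewrite /pos_clause /neg_clause /=; case E : (Z _ _ _) => // /and3P[/eqP h1 /eqP h2 h3].
  by exists vd => //; rewrite -h1 -h2.
have zb_last : zb clen.
  have [d] := init_row _ (in_width (size x + clen) (leqnn _)).
  rewrite /zb addnA /allowed [_ < ctr]ltnNge -!addnA leq_addr /= ltn_add2l.
  by rewrite [_ < size x]ltnNge leq_addr /= ltnn => /eqP->.
have mono j : j < clen -> zb j -> zb j.+1.
  move=> Hj zj; pose pos := ctr + size x + j.
  have Hpos : pos < width by rewrite /pos -addnA in_width // leq_add2l ltnW.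
  have [vt [vp [vd]]] := HZ 2 0 pos r0 isT isT Hpos.
  rewrite /pos_clause /neg_clause /= leq_addr ltn_add2l Hj /=.
  case E : (Z _ _ _) => /and3P[/eqP h1 /eqP h2 /eqP h3].
    by rewrite /zb addnS -/pos -h2 -h3 -h1.
  by move: zj; rewrite /zb -/pos -h2 -h3 -h1 E.
have zb_l : zb l.
  case: (ltnP l clen) => H; last by have -> : l = clen by apply/eqP; rewrite eqn_leq Hl.
  have Hh : has zb (iota 0 clen) by rewrite has_find size_iota.
  by have := nth_find 0 Hh; rewrite -/l nth_iota.
have blanks d : l + d <= clen -> zb (l + d).
  elim: d => [|d IH] Hd; first by rewrite addn0.
  by rewrite addnS mono //; [rewrite -addnS|apply: IH; apply: ltnW; rewrite -addnS].
have row0 pos : pos < width -> Z 0 pos (site_code (site_at (init V w) ctr pos)).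
  move=> Hp; rewrite site_at_init; have [d] := init_row _ Hp.
  rewrite /allowed /cell_of; case: ltnP => [|H1]; first by move=> _ /eqP ->.
  have map_w : map Some w = map (Some \o inl) x ++ map (Some \o inr) y :> seq (option (A + bool)).
    by rewrite /w /pair_word map_cat -!map_comp.
  rewrite map_w nth_cat size_map ltn_subLR //; case: ltnP => H2.
    have x0 : 0 < size x by lia.
    have a0 : A by case: (x) x0.
    by rewrite !(nth_map a0) ?ltn_subLR // => /eqP ->.
  have Epos : pos = ctr + size x + (pos - ctr - size x).
    by rewrite -addnA subnKC ?subnKC // leq_subRL // .
  set j := pos - ctr - size x in Epos *.
  case: ltnP => H3; last first.
    move=> /eqP ->; rewrite nth_default // size_map size_mkseq.
    by apply: leq_trans Hl _; move: H3; rewrite Epos leq_add2l.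
  have Hj : j < clen by move: H3; rewrite Epos ltn_add2l.
  case: (ltnP j l) => Hjl; last first.
    move=> _ _; rewrite nth_default; last by rewrite size_map size_mkseq.
    by rewrite Epos -(subnKC Hjl); apply: blanks; rewrite subnKC // ltnW.
  have := before_find 0 Hjl; rewrite nth_iota // add0n => nb.
  rewrite (nth_map true) ?size_mkseq //= nth_mkseq //=.
  case E : (Z 0 _ (bit true)); first by move=> _ _; rewrite Epos.
  case/or3P=> /eqP -> h; rewrite ?h //.
    by move: nb; rewrite /zb -Epos h.
  by move: E; rewrite -Epos h.
pose S t pos := site_at (iter t (@step _ _ V) (init V w)) ctr pos.
(* Each step loses one position at either border. *)
have rows t : t <= tmax -> forall pos, t <= pos -> pos + t < width ->
    Z t pos (site_code (S t pos)).
  elim: t => [|t IH] Ht pos Hp1 Hp2; first by apply: row0; rewrite addn0 in Hp2.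
  have Hpos : pos < width by apply: leq_ltn_trans Hp2; apply: leq_addr.
  have ct : ctr + t.+1 < width by move: Ht; rewrite /width /ctr; lia.
  pose r : window := (S t pos.-1, S t pos, S t pos.+1, S t ctr).
  have [vt [vp [vd]]] := HZ 0 t pos r isT (ltnW Ht) Hpos.
  have E : [&& t < tmax, 0 < pos & pos.+1 < width].
    by rewrite Ht (leq_trans _ Hp1) //=; lia.
  have {}IH := IH (ltnW Ht).
  rewrite /pos_clause /neg_clause /= E !window_tableE.
  case EZ : (Z vt vp vd); last first.
    case/andP=> /eqP h0 /or4P[] /andP[/eqP h1 /eqP h2]; subst vt vp vd; move: EZ.
    - by rewrite IH //; lia.
    - by rewrite IH //; lia.
    - by rewrite IH //; lia.
    - by rewrite IH //; move: Ht ct; rewrite /ctr; lia.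
  case/and3P=> /eqP h0 /eqP h1 /eqP h2; subst vt vp; move: EZ; rewrite h2.
  rewrite /S iterS site_at_step //; last by apply: leq_trans Hp1.
  rewrite -/(S t _) -/(S t _) -/(S t _) -/(S t _) /kind /win_next /=.
  by case: ifP => _ //; case: ifP => _ //; case: ifP.
pose r : window := (S tmax ctr, S tmax ctr, S tmax ctr, S tmax ctr).
have ctr_lt : ctr < width by rewrite /width ltnS leq_addr.
have [vt [vp [vd]]] := HZ 3 0 ctr r isT isT ctr_lt.
have <- : accepting (S tmax ctr) = v w.
  apply: accepting_site; apply: horner_nat_mono.
  by rewrite size_cat !size_map size_iota leq_add2l.
rewrite /pos_clause /neg_clause /= !window_tableE /win_accept /=.
case EZ : (Z vt vp vd); first by case: (accepting _).
case/orP; first by case: (accepting _).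
case/and3P=> /eqP h0 /eqP h1 /eqP h2; subst vt vp vd; move: EZ.
by rewrite /win1 /= rows //; move: (size x) clen; rewrite /width /ctr; lia.
Qed.

End Instance.

(** * Definability of the instance and NP-hardness *)

Ltac definability_hook ::= lazymatch goal with
  | |- definable (fun w v => nth 0 (map _ _) _) => apply: def_nth_map
  end.

Lemma def_clen : definable (fun x _ => clen x).
Proof. by rewrite /clen; definability. Qed.

Lemma def_tmax : definable (fun x _ => tmax x).
Proof. by apply: def_horner; apply: def_add; [apply: def_len|apply: def_clen]. Qed.

Ltac definability_hook ::= lazymatch goal with
  | |- definable (fun w v => clen _) => apply: def_clen
  | |- definable (fun w v => tmax _) => apply: def_tmax
  | |- definable (fun w v => nth 0 (map _ _) _) => apply: def_nth_map
  end.

Lemma def_ctr : definable (fun x _ => ctr x).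
Proof. by rewrite /ctr; definability. Qed.

Lemma def_width : definable (fun x _ => width x).
Proof. by apply: def_succ; apply: def_add; apply: def_ctr. Qed.

Ltac definability_hook ::= lazymatch goal with
  | |- definable (fun w v => clen _) => apply: def_clen
  | |- definable (fun w v => tmax _) => apply: def_tmax
  | |- definable (fun w v => ctr _) => apply: def_ctr
  | |- definable (fun w v => width _) => apply: def_width
  | |- definable (fun w v => nth 0 (map _ _) _) => apply: def_nth_map
  end.

Lemma def_allowed : definable (fun x v => allowed x (v 0) (v 1) : nat).
Proof. by rewrite /allowed; definability. Qed.

Ltac definability_hook ::= lazymatch goal with
  | |- definable (fun w v => clen _) => apply: def_clen
  | |- definable (fun w v => tmax _) => apply: def_tmax
  | |- definable (fun w v => ctr _) => apply: def_ctr
  | |- definable (fun w v => width _) => apply: def_width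
  | |- definable (fun w v => nat_of_bool (allowed _ _ _)) =>
      apply: (def_call2 (F := fun x i j => nat_of_bool (allowed x i j)) def_allowed)
  end.

Lemma def_pos_lit :
  definable (fun x v => decode_with x (pos_clause x) (v 0) (v 1) : nat).
Proof. by rewrite /decode_with /pos_clause; definability. Qed.

Lemma def_neg_lit :
  definable (fun x v => decode_with x (neg_clause x) (v 0) (v 1) : nat).
Proof. by rewrite /decode_with /neg_clause; definability. Qed.

Lemma NP_reduction (C : graph -> Prop) clique (L : language A) :
  (forall x, L x <-> exists y, size y <= p.[size x]%R /\ v (pair_word x y)) ->
  (forall M Q lit, C (gadget_graph M Q lit clique)) ->
  poly_reducible L (yes_language (P := final_zero_blocking_problem C)).
Proof.
move=> HL HC.
apply: (gadget_reduction (Mx := nvars) (Qx := nclauses)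
  (litp := fun x => decode_with x (pos_clause x))
  (litn := fun x => decode_with x (neg_clause x)) _ _ _ def_pos_lit def_neg_lit _
  (clique := clique)) => //.
- by move=> x; rewrite /nvars addn2.
- by rewrite /nvars; definability.
- by rewrite /nclauses; definability.
move=> x; rewrite HL; split=> [[y [Hy Hv]]|].
  exact: computation_satisfiable Hy Hv.
exact: satisfiable_computation.
Qed.

End CookLevin.

Lemma final_zero_blocking_NP_hard (C : graph -> Prop) clique :
  (forall M Q lit, C (gadget_graph M Q lit clique)) ->
  NP_hard (yes_language (P := final_zero_blocking_problem C)).
Proof.
move=> HC A L [v [p [[V [pv HV]] HL]]].
exact: (NP_reduction HV HL HC).
Qed.

Theorem theorem8 :
  NP_complete (final_zero_blocking_problem bipartite) /\
  NP_complete (final_zero_blocking_problem chordal).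
Proof.
split; split.
- exact: bipartite_in_NP.
- exact: final_zero_blocking_NP_hard gadget_bipartite.
- exact: chordal_in_NP.
- exact: final_zero_blocking_NP_hard gadget_chordal.
Qed.
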